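(* Let $\mathcal H$ be a complex Hilbert space, let $A$ be an arbitrary self-adjoint operator on $\mathcal H$ (with no assumption on its spectrum), and let $f:\mathbb R\to\mathbb C$ be a smooth function with $\int|f(l)|^2\,dl=1$, $\int l\,|f(l)|^2\,dl=0$ and $\int l^2|f(l)|^2\,dl=\sigma_A^2<\infty$. Then the map $$\Phi(\rho)=\int_{\mathbb R} dl\; f(l-A)\,\rho\, f(l-A)^\dagger$$ is completely positive on $B(\mathcal H)$, and it is trace-preserving, i.e. $\mathrm{Tr}\,\Phi(\rho)=\mathrm{Tr}\,\rho$ for every trace-class $\rho$.
   Context: $B(\mathcal H)$ denotes the bounded operators on $\mathcal H$. $f(l-A)=\int f(l-\lambda)\,dP_\lambda$ is defined by the functional calculus of $A$, where $dP_\lambda$ is the projection-valued measure of $A=\int\lambda\,dP_\lambda$. The integral defining $\Phi(\rho)$ is understood weakly: $\langle\phi,\Phi(\rho)\psi\rangle=\int dl\,\langle f(l-A)^\dagger\phi,\ \rho\, f(l-A)^\dagger\psi\rangle$ for $\phi,\psi\in\mathcal H$ (for given $\psi$, $f(l-A)^\dagger\psi$ is defined for almost every $l$ and $l\mapsto f(l-A)^\dagger\psi$ is square-integrable). A linear map $\Phi:B(\mathcal H)\to B(\mathcal H)$ is completely positive if for every finite-dimensional Hilbert space $V$ the map $\Phi\otimes \mathrm{id}_{B(V)}$ on $B(\mathcal H\otimes V)$ maps positive semi-definite operators to positive semi-definite operators. ($\Phi(\rho)$ is the state after measuring the observable $A$ in state $\rho$ with a detector of acceptance function $|f|^2$ and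 resolution $\sigma_A$.) *)

(* Defs.v *)
From HB Require Import structures.
From mathcomp Require Import all_boot all_order all_algebra finmap.
From mathcomp Require Import all_classical all_reals all_analysis.
From mathcomp Require Import complex.

Set Implicit Arguments.
Unset Strict Implicit.
Unset Printing Implicit Defensive.

Import Order.TTheory GRing.Theory Num.Theory.
Import numFieldNormedType.Exports.

Local Open Scope classical_set_scope.
Local Open Scope ring_scope.
Local Open Scope complex_scope.

Local Notation Re := complex.Re.
Local Notation Im := complex.Im.

(* Forms [{dot _ for _}] are linear in their first argument; [inner] swaps the
   arguments so that, as in physics, it is linear in the second one. *)
HB.mixin Record CompleteNormedModule_isHilbert (R : realType) H
    & CompleteNormedModule R[i] H := {
  dotp : {dot H for (@conjc R)};
  dotp_norm : forall x : H, dotp x x = `|x| ^+ 2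
}.

#[short(type="hilbertType")]
HB.structure Definition Hilbert (R : realType) :=
  {H of CompleteNormedModule R[i] H & CompleteNormedModule_isHilbert R H}.

Definition inner (R : realType) (H : hilbertType R) (x y : H) : R[i] :=
  dotp y x.

Section InnerTheory.
Context {R : realType} {H : hilbertType R}.
Implicit Types (x y z : H) (a : R[i]).

Lemma innerDr x y z : inner x (y + z) = inner x y + inner x z.
Proof. by rewrite /inner linearDl. Qed.

Lemma innerZr a x y : inner x (a *: y) = a * inner x y.
Proof. by rewrite /inner linearZl_LR. Qed.

Lemma innerC x y : inner x y = (inner y x)^*.
Proof. by rewrite /inner hermC/= expr0 mul1r. Qed.

Lemma inner_norm x : inner x x = `|x| ^+ 2.
Proof. exact: dotp_norm. Qed.

Lemma innerDl x y z : inner (x + y) z = inner x z + inner y z.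
Proof. by rewrite innerC innerDr rmorphD/= -!innerC. Qed.

Lemma innerBr x y z : inner x (y - z) = inner x y - inner x z.
Proof. by rewrite innerDr -scaleN1r innerZr mulN1r. Qed.

Lemma innerNr x y : inner x (- y) = - inner x y.
Proof. by rewrite -scaleN1r innerZr mulN1r. Qed.

Lemma inner0r x : inner x 0 = 0.
Proof. by rewrite -[0]subr0 innerBr subrr. Qed.

Lemma inner_sumr x n (u : nat -> H) :
  inner x (\sum_(0 <= k < n) u k) = \sum_(0 <= k < n) inner x (u k).
Proof.
elim: n => [|n ih]; first by rewrite !big_geq// inner0r.
by rewrite !big_nat_recr//= innerDr ih.
Qed.

Lemma Re_inner_ler x y : Re (inner x y) <= Re `|x| * Re `|y|.
Proof.
have norm_re z : `|z| = (Re `|z|)%:C.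
  by have := normr_ge0 z; case: `|z| => a b; rewrite lecE/= => /andP[/eqP-> _].
have := ler_normD x y.
rewrite -(@ler_pXn2r _ 2)// ?nnegrE// ?addr_ge0// -inner_norm innerDr !innerDl.
rewrite !inner_norm sqrrD -!addrA lerD2l !addrA lerD2r.
rewrite [inner y x]innerC [in leRHS](norm_re x) [in leRHS](norm_re y).
rewrite lecE/= => /andP[_].
by case: (inner x y) => a b /=; rewrite !mulr0 !subr0 -!mulr2n ler_pMn2r.
Qed.

Lemma Re_inner_norm x y : `|Re (inner x y)| <= Re `|x| * Re `|y|.
Proof.
rewrite ler_norml Re_inner_ler andbT lerNl.
have := Re_inner_ler x (- y); rewrite normrN innerNr.
by case: (inner x y).
Qed.

Lemma cvg_Re_inner x (u : nat -> H) y : u @ \oo --> y ->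
  (fun n => Re (inner x (u n))) @ \oo --> Re (inner x y).
Proof.
move=> uy; apply/cvgrPdist_lt => e e0.
have M0 : 0 < Re `|x| + 1.
  have := normr_ge0 x; case: `|x| => a b; rewrite lecE/= => /andP[_ a0].
  exact: ltr_wpDl.
have d0 : 0 < (e / (Re `|x| + 1))%:C :> R[i] by rewrite ltcR divr_gt0.
have /cvgrPdist_lt/(_ _ d0) := uy; apply: filterS => n un.
have -> : Re (inner x y) - Re (inner x (u n)) = Re (inner x (y - u n)).
  by rewrite innerBr; case: (inner x y); case: (inner x (u n)).
apply: le_lt_trans (Re_inner_norm _ _) _.
have {}un : Re `|y - u n| < e / (Re `|x| + 1).
  by move: un; case: `|y - u n| => a b; rewrite ltcE/= => /andP[].
move: un; rewrite ltr_pdivlMr//; apply: le_lt_trans.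
rewrite mulrC ler_wpM2l// ?lerDl//.
by have := normr_ge0 (y - u n); case: `|_| => a b; rewrite lecE/= => /andP[].
Qed.

End InnerTheory.

Record bounded_op (R : realType) (H : hilbertType R) := BoundedOp {
  op_linear :> {linear H -> H};
  op_continuous : continuous op_linear
}.

(* Possibly unbounded operators on [H] are represented by their graphs. *)
Section UnboundedOperators.
Context {R : realType} {H : hilbertType R}.
Implicit Types G : set (H * H).

Definition op_domain G : set H := [set x | exists y, G (x, y)].

(* the value of the operator at [x], and 0 outside its domain *)
Definition op_value G (x : H) : H := xget 0 [set y | G (x, y)].

Definition linear_operator G :=
  [/\ G (0, 0),
      forall a x y x' y', G (x, y) -> G (x', y') ->
        G (a *: x + x', a *: y + y') &
      forall x y y', G (x, y) -> G (x, y') -> y = y'].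

Definition op_adjoint G : set (H * H) :=
  [set p | forall x y, G (x, y) -> inner p.1 y = inner p.2 x].

Definition self_adjoint G :=
  [/\ linear_operator G, dense (op_domain G) & op_adjoint G = G].

End UnboundedOperators.

Record pvm (R : realType) (H : hilbertType R) := PVM {
  proj_of :> set (measurableTypeR R) -> bounded_op H;
  pvm_idem : forall E, measurable E ->
    forall x, proj_of E (proj_of E x) = proj_of E x;
  pvm_selfadj : forall E, measurable E ->
    forall x y, inner (proj_of E x) y = inner x (proj_of E y);
  pvm_set0 : forall x, proj_of set0 x = 0;
  pvm_setT : forall x, proj_of setT x = x;
  pvm_sigma_additive : forall F : (set (measurableTypeR R))^nat,
    (forall k, measurable (F k)) -> trivIset setT F ->
    forall x, (fun n => \sum_(0 <= k < n) proj_of (F k) x) @ \oo -->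
              proj_of (\bigcup_k F k) x
}.

(* The measure <x, P(E) x>. It is written as |P(E) x|^2, to which it is equal
   when E is measurable, because a library measure has to be nonnegative on
   nonmeasurable sets too. *)
Definition spectral_measure (R : realType) (H : hilbertType R) (P : pvm H)
    (x : H) (E : set (measurableTypeR R)) : \bar R :=
  (Re (`|P E x| ^+ 2))%:E.

Section SpectralMeasure.
Context {R : realType} {H : hilbertType R} (P : pvm H) (x : H).

Lemma spectral_measureE E : measurable E ->
  spectral_measure P x E = (Re (inner x (P E x)))%:E.
Proof.
move=> mE; rewrite /spectral_measure -inner_norm.
by rewrite pvm_selfadj// pvm_idem.
Qed.

Let spectral_measure0 : spectral_measure P x set0 = 0%E.
Proof. by rewrite /spectral_measure pvm_set0 normr0 expr0n. Qed.

Let spectral_measure_ge0 E : (0 <= spectral_measure P x E)%E.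
Proof.
rewrite lee_fin; have : 0 <= `|P E x| ^+ 2 by rewrite exprn_ge0.
by case: (_ ^+ 2) => a b; rewrite lecE/= => /andP[].
Qed.

Let spectral_measure_sigma_additive :
  semi_sigma_additive (spectral_measure P x).
Proof.
move=> F mF tF mUF; rewrite spectral_measureE//.
under eq_fun do under eq_bigr do rewrite spectral_measureE//.
have -> : (fun n => \sum_(0 <= i < n) (Re (inner x (P (F i) x)))%:E)%E =
          EFin \o (fun n => Re (inner x (\sum_(0 <= k < n) P (F k) x))).
  apply/funext => n /=; rewrite inner_sumr sumEFin; congr EFin.
  by rewrite raddf_sum.
apply: cvg_EFin; first exact: nearW.
by apply: cvg_Re_inner; exact: pvm_sigma_additive.
Qed.

HB.instance Definition _ := isMeasure.Build _ _ _ (spectral_measure P x)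
  spectral_measure0 spectral_measure_ge0 spectral_measure_sigma_additive.

End SpectralMeasure.

Definition abs2 (R : realType) (z : R[i]) : R := Re z ^+ 2 + Im z ^+ 2.

Definition cintegrable (R : realType) (mu : {measure set (measurableTypeR R) -> \bar R})
    (g : R -> R[i]) :=
  mu.-integrable setT (fun l => (Re (g l))%:E) /\
  mu.-integrable setT (fun l => (Im (g l))%:E).

Definition cintegral (R : realType) (mu : {measure set (measurableTypeR R) -> \bar R})
    (g : R -> R[i]) : R[i] :=
  (\int[mu]_l Re (g l)) +i* (\int[mu]_l Im (g l)).

Section FunctionalCalculus.
Context {R : realType} {H : hilbertType R} (P : pvm H).
Implicit Types (g : R -> R[i]) (x y : H).

Definition calculus_domain g : set H :=
  [set x | (\int[spectral_measure P x]_l (abs2 (g l))%:E < +oo)%E].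

(* The integral of g against the complex measure <x, P(E) y>, which by
   polarization is 1/4 \sum_(k < 4) i^-k <z_k, P(E) z_k>, z_k := x + i^k y. *)
Definition sesqui_integral g x y : R[i] :=
  4^-1 * \sum_(k < 4)
    'i ^- k * cintegral (spectral_measure P (x + 'i ^+ k *: y)) g.

(* the operator \int g(l) dP_l, characterized by <x, g y> = \int g d<x, P y>
   for x in its (dense) domain *)
Definition functional_calculus g : set (H * H) :=
  [set p | calculus_domain g p.1 /\
    forall x, calculus_domain g x -> inner x p.2 = sesqui_integral g x p.1].

End FunctionalCalculus.

Definition smooth (R : realType) (f : R -> R[i]) :=
  forall n (l : R), derivable (derive1n n (fun k => Re (f k))) l 1 /\
                    derivable (derive1n n (fun k => Im (f k))) l 1.

(* the adjoint of f(l - A), when P is the projection-valued measure of A *)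
Definition detector_adjoint (R : realType) (H : hilbertType R) (P : pvm H)
    (f : R -> R[i]) (l : R) : set (H * H) :=
  op_adjoint (functional_calculus P (fun k => f (l - k))).

(* <x, Phi(rho) y> = \int <f(l - A)^* x, rho f(l - A)^* y> dl, the integral being
   absolutely convergent; this determines Phi. *)
Definition is_measurement_map (R : realType) (H : hilbertType R) (P : pvm H)
    (f : R -> R[i]) (Phi : bounded_op H -> bounded_op H) :=
  (forall y : H, {ae lebesgue_measure,
     forall l : R, op_domain (detector_adjoint P f l) y}) /\
  forall (rho : bounded_op H) (x y : H),
    let integrand (l : R) :=
      inner (op_value (detector_adjoint P f l) x)
            (rho (op_value (detector_adjoint P f l) y)) in
    cintegrable lebesgue_measure integrand /\
    inner x (Phi rho y) = cintegral lebesgue_measure integrand.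

Section CompletePositivity.
Context {R : realType}.

Definition positive_op (H : hilbertType R) (T : bounded_op H) :=
  forall x, 0 <= inner x (T x).

Definition linear_map (H : hilbertType R)
    (Phi : bounded_op H -> bounded_op H) :=
  forall (a : R[i]) (r s t : bounded_op H),
    (forall x, t x = a *: r x + s x) ->
    forall x, Phi t x = a *: Phi r x + Phi s x.

Definition finite_dim (V : hilbertType R) :=
  exists n (e : 'I_n -> V), forall v, exists c : 'I_n -> R[i],
    v = \sum_(i < n) c i *: e i.

(* [K], with [t] as the map (x, v) |-> x (x) v, is the Hilbert tensor product
   of [H] and [V] (which is unique up to a unitary). *)
Definition hilbert_tensor (H V K : hilbertType R) (t : {bilinear H -> V -> K}) :=
  (forall x y v w, inner (t x v) (t y w) = inner x y * inner v w) /\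
  dense [set z : K | exists n (x : 'I_n -> H) (v : 'I_n -> V),
                       z = \sum_(i < n) t (x i) (v i)].

(* c = a (x) b *)
Definition is_tensor_op (H V K : hilbertType R) (t : {bilinear H -> V -> K})
    (a : bounded_op H) (b : bounded_op V) (c : bounded_op K) :=
  forall x v, c (t x v) = t (a x) (b v).

(* Psi = Phi (x) id: as [V] is finite-dimensional, the operators a (x) b span
   the bounded operators on [K], so that Psi is determined by its linearity
   and its values on them. *)
Definition is_ampliation (H V K : hilbertType R) (t : {bilinear H -> V -> K})
    (Phi : bounded_op H -> bounded_op H) (Psi : bounded_op K -> bounded_op K) :=
  linear_map Psi /\
  forall a b c, is_tensor_op t a b c -> is_tensor_op t (Phi a) b (Psi c).

Definition completely_positive (H : hilbertType R)
    (Phi : bounded_op H -> bounded_op H) :=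
  linear_map Phi /\
  forall (V K : hilbertType R) (t : {bilinear H -> V -> K}),
    finite_dim V -> hilbert_tensor t ->
    exists2 Psi, is_ampliation t Phi Psi &
      forall T, positive_op T -> positive_op (Psi T).

End CompletePositivity.

Section Trace.
Context {R : realType} {H : hilbertType R}.
Implicit Types T S : bounded_op H.

Definition orthonormal_basis (I : choiceType) (e : I -> H) :=
  (forall i j, inner (e i) (e j) = (i == j)%:R) /\
  (forall x, (forall i, inner (e i) x = 0) -> x = 0).

(* S = |T|, the positive square root of T^* T *)
Definition is_abs T S :=
  positive_op S /\
  exists2 T' : bounded_op H,
    (forall x y, inner (T' x) y = inner x (T y)) &
    forall x, S (S x) = T' (T x).

Definition trace_class T :=
  exists2 S, is_abs T S & forall (I : choiceType) (e : I -> H),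
    orthonormal_basis e ->
    (\esum_(i in [set: I]) (Re (inner (e i) (S (e i))))%:E < +oo)%E.

(* The trace of T is t: in every orthonormal basis, the (unordered) sum of the
   diagonal elements of T converges to t. *)
Definition is_trace T (t : R[i]) :=
  forall (I : choiceType) (e : I -> H), orthonormal_basis e ->
  forall eps : R, 0 < eps ->
  exists J0 : {fset I}, forall J : {fset I}, (J0 `<=` J)%fset ->
    `|t - \sum_(i <- J) inner (e i) (T (e i))| < eps%:C.

End Trace.

(* Main.v *)
(** Let W_l = f(l - A)^* = \int conj(f(l - k)) dP_k. By Tonelli and translation
    invariance, \int |W_l y|^2 dl = \int (\int |f(l - k)|^2 dl) d<y, P_k y> = |y|^2,
    so that <x, Phi(rho) y> = \int <W_l x, rho W_l y> dl is a bounded form. Phi is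
    completely positive since W_l (x) id acts pointwise in l under this integral.
    A trace class rho is A^* B for Hilbert-Schmidt A and B, and by polarization one may
    take A = B = Q for the trace. In a basis (e_i),
      \sum_i \int |Q W_l e_i|^2 dl = \sum_i \sum_j \int |<f(l - A) Q^* e_j, e_i>|^2 dl
        = \sum_j \int |f(l - A) Q^* e_j|^2 dl = \sum_j |Q^* e_j|^2,
    which is the trace of Q^* Q. The sums and the integral may be exchanged, although H need
    not be separable, because l |-> f(l - A) u is a limit of continuous functions, whose values
    are orthogonal to all but countably many of the e_i. That Phi(rho) is trace class follows
    from its polar decomposition and
    |<W_l x, A^* B W_l y>| <= |A W_l x|^2 + |B W_l y|^2. *)

Require Import Defs.
From HB Require Import structures.
From mathcomp Require Import all_boot all_order all_algebra finmap.
From mathcomp Require Import all_classical all_reals all_analysis.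
From mathcomp Require Import measurable_realfun complex ring lra.

Set Implicit Arguments.
Unset Strict Implicit.
Unset Printing Implicit Defensive.

Import Order.TTheory GRing.Theory Num.Theory.
Import numFieldNormedType.Exports.

Local Open Scope classical_set_scope.
Local Open Scope ring_scope.
Local Open Scope complex_scope.

Local Notation Re := complex.Re.
Local Notation Im := complex.Im.

(** [f] may be unbounded, and then so is W_l: whether y lies in its domain depends on l, the
    exceptional null set depends on y, and W_l (a x + y) = a W_l x + W_l y holds for almost every l
    only. Extending W_l y by 0 off the domain gives total functions. The existence and complete
    positivity of Phi are then derived from three facts that tolerate null sets, collected in
    [instrument]: measurability, the norm identity and linearity almost everywhere. They suffice
    because Phi is given by a form, so that linearity is only used under an integral. The operators
    g(A) are given as graphs, by polarized integrals. They become tractable by truncating g to the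
    windows [-m, m], where it is bounded: y lies in the domain of g(A) exactly when the truncations
    converge at y, and g(A) y is their limit. This yields both the adjoint of f(l - A) and the
    measurability of W_l y in l. Preservation of the trace needs two instruments at once, f(l - A)^*
    in the definition of Phi and f(l - A) in the evaluation of the sums, linked by duality for
    almost every l. *)

Section ComplexParts.
Context {R : realType}.
Implicit Types z w : R[i].

Lemma ReD z w : Re (z + w) = Re z + Re w. Proof. by case: z; case: w. Qed.
Lemma ImD z w : Im (z + w) = Im z + Im w. Proof. by case: z; case: w. Qed.
Lemma ReN z : Re (- z) = - Re z. Proof. by case: z. Qed.
Lemma ImN z : Im (- z) = - Im z. Proof. by case: z. Qed.
Lemma ReM z w : Re (z * w) = Re z * Re w - Im z * Im w.
Proof. by case: z; case: w. Qed.
Lemma ImM z w : Im (z * w) = Re z * Im w + Im z * Re w.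
Proof. by case: z => a b; case: w => c d /=; rewrite addrC mulrC; ring. Qed.
Lemma ReJ z : Re (conjc z) = Re z. Proof. by case: z. Qed.
Lemma ImJ z : Im (conjc z) = - Im z. Proof. by case: z. Qed.
Definition ReImE := (ReD, ImD, ReN, ImN, ReM, ImM, ReJ, ImJ).

Lemma Re_sum I (r : seq I) (P : pred I) (F : I -> R[i]) :
  Re (\sum_(i <- r | P i) F i) = \sum_(i <- r | P i) Re (F i).
Proof. by apply: big_morph => // x y; rewrite ReD. Qed.

Lemma complex_ext z w : Re z = Re w -> Im z = Im w -> z = w.
Proof. by case: z => a b; case: w => c d /= -> ->. Qed.

Lemma abs2_ge0 z : 0 <= abs2 z.
Proof. by rewrite /abs2 addr_ge0 ?sqr_ge0. Qed.

Lemma abs2M z w : abs2 (z * w) = abs2 z * abs2 w.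
Proof. by rewrite /abs2 !ReImE; ring. Qed.

Lemma abs2J z : abs2 (conjc z) = abs2 z.
Proof. by rewrite /abs2 !ReImE; ring. Qed.

Lemma mulcJ z : conjc z * z = (abs2 z)%:C.
Proof. by apply: complex_ext; rewrite !ReImE /abs2 /=; ring. Qed.

Lemma abs2_eq0 z : abs2 z = 0 -> z = 0.
Proof.
case: z => a b; rewrite /abs2 /= => /eqP.
rewrite paddr_eq0 ?sqr_ge0// !sqrf_eq0 => /andP[/eqP-> /eqP->]//.
Qed.

Lemma abs2_le_Re z : Re z ^+ 2 <= abs2 z.
Proof. by rewrite /abs2 lerDl sqr_ge0. Qed.

Lemma abs2D_le z w : abs2 (z + w) <= 2 * (abs2 z + abs2 w).
Proof.
rewrite /abs2 !ReImE; have := sqr_ge0 (Re z - Re w); have := sqr_ge0 (Im z - Im w).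
by nra.
Qed.

Lemma conjcR (r : R) : conjc (r%:C : R[i]) = r%:C.
Proof. by apply: complex_ext => //=; rewrite oppr0. Qed.

Lemma normc_abs2 z : `|z| = (Num.sqrt (abs2 z))%:C.
Proof. by rewrite normc_def. Qed.

End ComplexParts.

(** * Hilbert spaces and bounded operators *)

Section Hilbert.
Context {R : realType} {H : hilbertType R}.
Implicit Types (x y z u v : H) (a : R[i]).

Definition sqn x : R := Re (inner x x).
(** Limits and estimates are carried out with this real inner product, to which real analysis
    applies directly; [Im_inner] recovers imaginary parts from it. *)
Definition rip x y : R := Re (inner x y).

Lemma norm_Re x : `|x| = (Re `|x|)%:C.
Proof.
by have := normr_ge0 x; case: `|x| => a b; rewrite lecE/= => /andP[/eqP-> _].
Qed.

Lemma Re_norm_ge0 x : 0 <= Re `|x|.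
Proof. by have := normr_ge0 x; rewrite norm_Re lecR. Qed.

Lemma sqn_norm x : sqn x = Re `|x| ^+ 2.
Proof. by rewrite /sqn inner_norm norm_Re -rmorphXn. Qed.

Lemma inner_sqn x : inner x x = (sqn x)%:C.
Proof. by rewrite inner_norm sqn_norm norm_Re -rmorphXn. Qed.

Lemma sqn_ge0 x : 0 <= sqn x. Proof. by rewrite sqn_norm sqr_ge0. Qed.

Lemma sqn_eq0 x : sqn x = 0 -> x = 0.
Proof.
rewrite sqn_norm => /eqP; rewrite sqrf_eq0 => /eqP h.
by apply/eqP; rewrite -normr_eq0 norm_Re h.
Qed.

Lemma norm_sqn x : `|x| = (Num.sqrt (sqn x))%:C.
Proof. by rewrite sqn_norm sqrtr_sqr ger0_norm ?Re_norm_ge0// -norm_Re. Qed.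

Lemma innerZl a x y : inner (a *: x) y = conjc a * inner x y.
Proof. by rewrite innerC innerZr rmorphM/= -innerC. Qed.

Lemma innerNl x y : inner (- x) y = - inner x y.
Proof. by rewrite innerC innerNr rmorphN/= -innerC. Qed.

Lemma innerBl x y z : inner (x - y) z = inner x z - inner y z.
Proof. by rewrite innerDl innerNl. Qed.

Lemma inner0l x : inner 0 x = 0.
Proof. by rewrite innerC inner0r conjc0. Qed.

Lemma inner_sum_r I (r : seq I) (Q : pred I) x (F : I -> H) :
  inner x (\sum_(i <- r | Q i) F i) = \sum_(i <- r | Q i) inner x (F i).
Proof. by apply: big_morph => [y z|]; rewrite ?innerDr ?inner0r. Qed.

Lemma inner_sum_l I (r : seq I) (Q : pred I) x (F : I -> H) :
  inner (\sum_(i <- r | Q i) F i) x = \sum_(i <- r | Q i) inner (F i) x.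
Proof.
by apply: (big_morph (fun y => inner y x)) => [y z|]; rewrite ?innerDl ?inner0l.
Qed.

Lemma ripC x y : rip x y = rip y x. Proof. by rewrite /rip innerC ReJ. Qed.
Lemma ripDr x y z : rip x (y + z) = rip x y + rip x z.
Proof. by rewrite /rip innerDr ReD. Qed.
Lemma ripDl x y z : rip (x + y) z = rip x z + rip y z.
Proof. by rewrite /rip innerDl ReD. Qed.
Lemma ripNr x y : rip x (- y) = - rip x y.
Proof. by rewrite /rip innerNr ReN. Qed.
Lemma ripNl x y : rip (- x) y = - rip x y.
Proof. by rewrite /rip innerNl ReN. Qed.
Lemma ripBr x y z : rip x (y - z) = rip x y - rip x z.
Proof. by rewrite ripDr ripNr. Qed.
Lemma ripBl x y z : rip (x - y) z = rip x z - rip y z.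
Proof. by rewrite ripDl ripNl. Qed.
Lemma ripZr (r : R) x y : rip x (r%:C *: y) = r * rip x y.
Proof. by rewrite /rip innerZr ReM /=; ring. Qed.
Lemma ripZl (r : R) x y : rip (r%:C *: x) y = r * rip x y.
Proof. by rewrite ripC ripZr ripC. Qed.
Lemma rip_sqn x : rip x x = sqn x. Proof. by []. Qed.
Lemma rip0r x : rip x 0 = 0. Proof. by rewrite /rip inner0r. Qed.
Lemma rip0l x : rip 0 x = 0. Proof. by rewrite /rip inner0l. Qed.

Lemma Im_inner x y : Im (inner x y) = rip ('i *: x) y.
Proof. by rewrite /rip innerZl !ReImE /=; ring. Qed.

Lemma sqnD x y : sqn (x + y) = sqn x + sqn y + 2 * rip x y.
Proof. by rewrite -!rip_sqn !ripDr !ripDl (ripC y x); ring. Qed.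
Lemma sqnB x y : sqn (x - y) = sqn x + sqn y - 2 * rip x y.
Proof. by rewrite -!rip_sqn !ripBr !ripBl (ripC y x); ring. Qed.
Lemma sqnN x : sqn (- x) = sqn x.
Proof. by rewrite -!rip_sqn ripNr ripNl opprK. Qed.
Lemma sqnBC x y : sqn (x - y) = sqn (y - x).
Proof. by rewrite -opprB sqnN. Qed.
Lemma sqnZ a x : sqn (a *: x) = abs2 a * sqn x.
Proof. by rewrite /sqn innerZr innerZl inner_sqn !ReImE /abs2 /=; ring. Qed.
Lemma sqnZR (r : R) x : sqn (r%:C *: x) = r ^+ 2 * sqn x.
Proof. by rewrite sqnZ /abs2 /= expr0n addr0. Qed.
Lemma sqn0 : sqn (0 : H) = 0. Proof. by rewrite -rip_sqn rip0r. Qed.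

Lemma sqnD_le x y : sqn (x + y) <= 2 * (sqn x + sqn y).
Proof. by have := sqn_ge0 (x - y); rewrite sqnB sqnD; nra. Qed.
Lemma sqnB_le x y : sqn (x - y) <= 2 * (sqn x + sqn y).
Proof. by have := sqn_ge0 (x + y); rewrite sqnB sqnD; nra. Qed.

Lemma rip_amgm x y : 2 * `|rip x y| <= sqn x + sqn y.
Proof.
have := sqn_ge0 (x - y); have := sqn_ge0 (x + y); rewrite sqnB sqnD.
by move=> h1 h2; case: (ger0P (rip x y)) => h; lra.
Qed.

Lemma rip_cs x y : rip x y ^+ 2 <= sqn x * sqn y.
Proof.
have [y0|y0] := eqVneq (sqn y) 0.
  by rewrite (sqn_eq0 y0) sqn0 rip0r expr0n mulr0.
have y1 : 0 < sqn y by rewrite lt_def y0 sqn_ge0.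
have := sqn_ge0 ((sqn y)%:C *: x - (rip x y)%:C *: y).
rewrite sqnB !sqnZR ripZl ripZr => h.
suff : 0 <= sqn y * (sqn x * sqn y - rip x y ^+ 2).
  by rewrite pmulr_rge0// subr_ge0.
by lra.
Qed.

Lemma rip_le x y : `|rip x y| <= Num.sqrt (sqn x) * Num.sqrt (sqn y).
Proof.
rewrite -sqrtrM ?sqn_ge0// -sqrtr_sqr ler_sqrt ?rip_cs//.
by rewrite mulr_ge0 ?sqn_ge0.
Qed.

Lemma inner_cs x y : abs2 (inner x y) <= sqn x * sqn y.
Proof.
(* Scaling [x] by [inner x y] makes the inner product with [y] the real number |<x, y>|^2. *)
have := rip_cs (inner x y *: x) y.
rewrite sqnZ /rip innerZl mulcJ /=.
have [z0|z0] := eqVneq (abs2 (inner x y)) 0.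
  by rewrite z0 mulr_ge0 ?sqn_ge0.
rewrite expr2 -mulrA ler_pM2l//.
by rewrite lt_def z0 abs2_ge0.
Qed.

Lemma rip_ext x y : (forall z, rip z x = rip z y) -> x = y.
Proof.
move=> h; apply/subr0_eq/sqn_eq0.
by rewrite -rip_sqn ripBr h subrr.
Qed.

Lemma inner_ext x y : (forall z, inner z x = inner z y) -> x = y.
Proof. by move=> h; apply: rip_ext => z; rewrite /rip h. Qed.

(** Norm convergence through real squared norms, since the norm of [H] takes its values in [R[i]];
    [hcvgE] is the link with the topology. *)
Definition hcvg (u : nat -> H) (y : H) := (fun n => sqn (u n - y)) @ \oo --> (0 : R).

Lemma hcvgP (u : nat -> H) (y : H) :
  hcvg u y <-> forall e : R, 0 < e -> \forall n \near \oo, sqn (u n - y) < e.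
Proof.
split=> [/cvgrPdist_lt h e e0|h].
  apply: filterS (h _ e0) => n; rewrite sub0r normrN ger0_norm ?sqn_ge0//.
apply/cvgrPdist_lt => e e0; apply: filterS (h _ e0) => n.
by rewrite sub0r normrN ger0_norm ?sqn_ge0.
Qed.

Lemma hcvgE (u : nat -> H) (y : H) : u @ \oo --> y <-> hcvg u y.
Proof.
rewrite hcvgP; split=> [/cvgrPdist_lt h e e0|h].
  have e1 : 0 < (Num.sqrt e)%:C :> R[i] by rewrite ltcR sqrtr_gt0.
  apply: filterS (h _ e1) => n.
  by rewrite norm_sqn ltcR ltr_sqrt// sqnBC.
apply/cvgrPdist_lt => -[e e']; rewrite ltcE /= => /andP[/eqP-> e0].
have e2 : 0 < e ^+ 2 by rewrite exprn_gt0.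
apply: filterS (h _ e2) => n.
rewrite norm_sqn ltcR sqnBC -(@ltr_sqrt _ (sqn _))//.
by rewrite sqrtr_sqr gtr0_norm.
Qed.

Lemma hcvg_complete (u : nat -> H) :
  (forall e : R, 0 < e -> exists N, forall n, (N <= n)%N -> sqn (u n - u N) < e) ->
  exists y, hcvg u y.
Proof.
move=> h; have : cvg (u @ \oo).
  apply/cauchy_cvgP/cauchy_exP => -[e e']; rewrite ltcE /= => /andP[/eqP-> e0].
  have e2 : 0 < e ^+ 2 by rewrite exprn_gt0.
  have [N hN] := h _ e2; exists (u N).
  exists N => // n /= Nn; rewrite -ball_normE/= norm_sqn.
  have /= := hN _ Nn; rewrite -(@ltr_sqrt _ (sqn _))// sqnBC.
  by rewrite sqrtr_sqr gtr0_norm// ltcR.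
by move=> c; exists (lim (u @ \oo)); apply/hcvgE.
Qed.

Lemma hcvg_cst y : hcvg (fun _ => y) y.
Proof. by rewrite /hcvg subrr sqn0; exact: cvg_cst. Qed.

Lemma hcvg_le (u : nat -> H) y (b : nat -> R) :
  b @ \oo --> (0 : R) -> (forall n, sqn (u n - y) <= b n) -> hcvg u y.
Proof.
move=> b0 h; apply: (squeeze_cvgr _ (cvg_cst (0 : R)) b0).
by apply: nearW => n; rewrite sqn_ge0 h.
Qed.

Lemma hcvgD (u v : nat -> H) y z :
  hcvg u y -> hcvg v z -> hcvg (fun n => u n + v n) (y + z).
Proof.
move=> hu hv; apply: (@hcvg_le _ _ (fun n => 2 * (sqn (u n - y) + sqn (v n - z)))).
  rewrite -[0](mulr0 (2 : R)) -[X in _ * X](addr0 0).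
  by apply: cvgMr; apply: cvgD.
by move=> n; rewrite opprD addrACA; exact: sqnD_le.
Qed.

Lemma hcvgZ a (u : nat -> H) y : hcvg u y -> hcvg (fun n => a *: u n) (a *: y).
Proof.
move=> hu; apply: (@hcvg_le _ _ (fun n => abs2 a * sqn (u n - y))).
  by rewrite -[0](mulr0 (abs2 a)); apply: cvgMr.
by move=> n; rewrite -scalerBr sqnZ.
Qed.

Lemma hcvgN (u : nat -> H) y : hcvg u y -> hcvg (fun n => - u n) (- y).
Proof. by move=> /(@hcvgZ (-1)); rewrite scaleN1r; under eq_fun do rewrite scaleN1r. Qed.

Lemma hcvgB (u v : nat -> H) y z :
  hcvg u y -> hcvg v z -> hcvg (fun n => u n - v n) (y - z).
Proof. by move=> hu /hcvgN; exact: hcvgD. Qed.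

Lemma hcvg_sqn (u : nat -> H) y : hcvg u y -> (fun n => sqn (u n)) @ \oo --> sqn y.
Proof.
move=> hu.
have hs : (fun n => Num.sqrt (sqn (u n - y))) @ \oo --> (0 : R).
  rewrite -(@sqrtr0 R).
  by apply: (@continuous_cvg _ _ _ _ _ _ Num.sqrt); [exact: sqrt_continuous|].
have h1 : (fun n => 2 * (Num.sqrt (sqn (u n - y)) * Num.sqrt (sqn y)) + sqn (u n - y))
     @ \oo --> (0 : R).
  rewrite [X in _ --> X](_ : 0 = 2 * (0 * Num.sqrt (sqn y)) + 0); last by ring.
  by apply: cvgD => //; apply: cvgMr; apply: cvgMl.
apply/cvgrPdist_le => e e0.
have /cvgrPdist_le/(_ _ e0) := h1; apply: filterS => n.
rewrite sub0r normrN => hn; apply: le_trans hn.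
rewrite [leRHS]ger0_norm; last first.
  apply: addr_ge0; last exact: sqn_ge0.
  by apply: mulr_ge0 => //; rewrite mulr_ge0 ?sqrtr_ge0.
have -> : sqn y - sqn (u n) = - (sqn (u n - y) + 2 * rip (u n - y) y).
  by rewrite sqnB ripBl rip_sqn; ring.
rewrite normrN (le_trans (ler_normD _ _))// addrC lerD//.
  by rewrite normrM ger0_norm// ler_wpM2l// rip_le.
by rewrite ger0_norm ?sqn_ge0.
Qed.

Lemma hcvg_rip (u v : nat -> H) y z : hcvg u y -> hcvg v z ->
  (fun n => rip (u n) (v n)) @ \oo --> rip y z.
Proof.
move=> hu hv.
have e (a b : H) : rip a b = 4^-1 * (sqn (a + b) - sqn (a - b)).
  by rewrite sqnD sqnB; field.
rewrite e; under eq_fun do rewrite e.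
by apply: cvgMr; apply: cvgB; apply: hcvg_sqn; [apply: hcvgD|apply: hcvgB].
Qed.

Lemma hcvg_unique (u : nat -> H) y z : hcvg u y -> hcvg u z -> y = z.
Proof.
move=> hy hz; apply: rip_ext => w.
have h1 := hcvg_rip (hcvg_cst w) hy.
have h2 := hcvg_rip (hcvg_cst w) hz.
exact: (cvg_unique _ h1 h2).
Qed.

Lemma hcvg_shift (u : nat -> H) y k : hcvg u y -> hcvg (fun n => u (n + k)%N) y.
Proof. by move=> hu; apply: (cvg_comp _ _ (cvg_addnr k) hu). Qed.

End Hilbert.

(** * Bounded operators, Riesz representation and bounded forms *)

Section Operators.
Context {R : realType}.
Implicit Types H K : hilbertType R.

Definition lin H K (f : H -> K) :=
  forall (a : R[i]) x y, f (a *: x + y) = a *: f x + f y.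

Lemma linD H K (f : H -> K) : lin f -> forall x y, f (x + y) = f x + f y.
Proof. by move=> lf x y; have := lf 1 x y; rewrite !scale1r. Qed.

Lemma lin0 H K (f : H -> K) : lin f -> f 0 = 0.
Proof. by move=> /linD/(_ 0 0); rewrite addr0 => /eqP; rewrite -subr_eq0 opprD addNKr oppr_eq0 => /eqP. Qed.

Lemma linZ H K (f : H -> K) : lin f -> forall a x, f (a *: x) = a *: f x.
Proof. by move=> lf a x; have := lf a x 0; rewrite (lin0 lf) !addr0. Qed.

Lemma linN H K (f : H -> K) : lin f -> forall x, f (- x) = - f x.
Proof. by move=> lf x; rewrite -scaleN1r linZ// scaleN1r. Qed.

Lemma linB H K (f : H -> K) : lin f -> forall x y, f (x - y) = f x - f y.
Proof. by move=> lf x y; rewrite linD// linN. Qed.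

Lemma lin_sum H K (f : H -> K) : lin f -> forall I (r : seq I) (F : I -> H),
  f (\sum_(i <- r) F i) = \sum_(i <- r) f (F i).
Proof. by move=> lf I r F; apply: big_morph; [exact: linD|exact: lin0]. Qed.

Lemma op_lin H (T : bounded_op H) : lin T.
Proof. by move=> a x y; rewrite linearD linearZ. Qed.

Lemma op_bound H (T : bounded_op H) :
  exists2 c : R, 0 <= c & forall x, sqn (T x) <= c * sqn x.
Proof.
have /linear_bounded_continuous/linear_boundedP := @op_continuous _ _ T.
move=> [[m m'] [mr h]].
have m0 : m' = 0 by move: mr; rewrite complex_real => /eqP.
have {}h := h (`|m| + 1)%:C.
have {}h : forall x, `|T x| <= (`|m| + 1)%:C * `|x|.
  apply: h; rewrite ltcE/= m0 eqxx/=.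
  by rewrite (le_lt_trans (ler_norm m))// ltrDl.
exists ((`|m| + 1) ^+ 2) => [|x]; first by rewrite sqr_ge0.
have := h x; rewrite !norm_sqn -rmorphM/= lecR => {}h.
rewrite -[sqn (T x)]sqr_sqrtr ?sqn_ge0// -[sqn x]sqr_sqrtr ?sqn_ge0//.
by rewrite -exprMn ler_sqr ?nnegrE ?mulr_ge0 ?sqrtr_ge0// addr_ge0.
Qed.

Lemma ex_op H (f : H -> H) (c : R) : lin f -> (forall x, sqn (f x) <= c * sqn x) ->
  exists T : bounded_op H, forall x, T x = f x.
Proof.
move=> lf bf.
pose g : {linear H -> H} := HB.pack f (GRing.isLinear.Build _ _ _ _ f lf).
suff cg : continuous g by exists (BoundedOp cg).
apply/linear_bounded_continuous/linear_boundedP.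
exists (Num.sqrt c)%:C; split; first by rewrite complex_real.
move=> [r r']; rewrite ltcE /= => /andP[/eqP-> cr] x.
have r0 : 0 <= r by rewrite (le_trans _ (ltW cr))// sqrtr_ge0.
rewrite !norm_sqn complexr0 -rmorphM/= lecR.
have h : sqn (g x) <= r ^+ 2 * sqn x.
  apply: le_trans (bf x) _; apply: ler_wpM2r; first exact: sqn_ge0.
  have [c0|c0] := leP c 0; first by rewrite (le_trans c0)// sqr_ge0.
  by rewrite -[c]sqr_sqrtr ?(ltW c0)// ler_sqr ?nnegrE ?sqrtr_ge0// (ltW cr).
rewrite -[X in _ <= X * _](_ : Num.sqrt (r ^+ 2) = r); last first.
  by rewrite sqrtr_sqr ger0_norm.
by rewrite -sqrtrM ?sqr_ge0// ler_wsqrtr.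
Qed.

Lemma op_hcvg H (T : bounded_op H) (u : nat -> H) y :
  hcvg u y -> hcvg (fun n => T (u n)) (T y).
Proof.
have [c _ h] := op_bound T => hu.
apply: (@hcvg_le _ _ _ _ (fun n => c * sqn (u n - y))).
  by rewrite -[0](mulr0 c); apply: cvgMr.
by move=> n; rewrite -(linB (@op_lin _ T)); exact: h.
Qed.

(* The minimizer of |x|^2 - 2 Re phi(x) over [D] is a limit of elements of [D]. *)
Lemma riesz H (D : set H) (phi : H -> R[i]) (c : R) : 0 <= c ->
  D 0 -> (forall a x y, D x -> D y -> D (a *: x + y)) ->
  (forall a x y, D x -> D y -> phi (a *: x + y) = a * phi x + phi y) ->
  (forall x, D x -> abs2 (phi x) <= c * sqn x) ->
  exists w, [/\ exists2 u : nat -> H, forall n, D (u n) & hcvg u w &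
    forall x, D x -> inner w x = phi x].
Proof.
move=> c0 D0 DD phiD phib.
have phi0 : phi 0 = 0.
  by apply/abs2_eq0/eqP; rewrite eq_le abs2_ge0 andbT (le_trans (phib _ D0))// sqn0 mulr0.
have DZ a x : D x -> D (a *: x) by move=> Dx; rewrite -[_ *: _]addr0; exact: DD.
have phiZ a x : D x -> phi (a *: x) = a * phi x.
  by move=> Dx; rewrite -[_ *: _]addr0 phiD// phi0 addr0.
pose F x := sqn x - 2 * Re (phi x).
have Fge x : D x -> - c <= F x.
  move=> Dx; have := le_trans (abs2_le_Re _) (phib _ Dx); rewrite /F => h.
  have s0 := sqn_ge0 x.
  have : (2 * Re (phi x)) ^+ 2 <= (c + sqn x) ^+ 2.
    have := sqr_ge0 (c - sqn x); nra.
  have [p0|p0] := leP (Re (phi x)) 0; first by lra.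
  rewrite ler_sqr ?nnegrE; first by lra.
    by rewrite mulr_ge0// ltW.
  by rewrite addr_ge0.
pose S := [set F x | x in D].
have Sinf : has_inf S.
  split; first by exists (F 0), 0.
  by exists (- c) => _ [x Dx <-]; exact: Fge.
pose d := inf S.
have dF x : D x -> d <= F x.
  by move=> Dx; apply: ge_inf; [exact: Sinf.2|exists x].
have /choice[u hu] : forall n : nat, exists u, D u /\ F u < d + n.+1%:R^-1.
  move=> n; have n0 : (0 : R) < n.+1%:R^-1 by rewrite invr_gt0.
  by have [_ [x Dx <-] h] := inf_adherent n0 Sinf; exists x.
have Du n : D (u n) by case: (hu n).
have Fu n : F (u n) < d + n.+1%:R^-1 by case: (hu n).
(* Parallelogram law, with [F] at least [d] at the midpoint of [u n] and [u m]. *)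
have uu n m : sqn (u n - u m) <= 2 * n.+1%:R^-1 + 2 * m.+1%:R^-1.
  have Dh : D ((2^-1)%:C *: (u n + u m)).
    by apply: DZ; rewrite -[u n]scale1r; exact: DD.
  have := dF _ Dh; rewrite /F sqnZR phiZ; last by rewrite -[u n]scale1r; exact: DD.
  rewrite -[X in phi (X + _)]scale1r phiD// mul1r ReM /= ReD mul0r subr0.
  have := Fu n; have := Fu m; rewrite /F sqnD sqnB.
  by move: (n.+1%:R^-1) (m.+1%:R^-1) => p q; lra.
have inv0 : (fun n : nat => n.+1%:R^-1 : R) @ \oo --> (0 : R) by exact: cvg_harmonic.
have [w uw] : exists w, hcvg u w.
  apply: hcvg_complete => e e0.
  have e4 : 0 < e / 4 by rewrite divr_gt0.
  have /cvgrPdist_lt/(_ _ e4)[N _ hN] := inv0.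
  exists N => n Nn; apply: le_lt_trans (uu n N) _.
  have := hN n Nn; have := hN N (leqnn N); rewrite /= !sub0r !normrN.
  by rewrite !ger0_norm ?invr_ge0//; move: (N.+1%:R^-1) (n.+1%:R^-1) => p q; lra.
exists w; split; first by exists u.
have Re_eq x : D x -> rip w x = Re (phi x).
  move=> Dx.
  (* First variation: [F (t x + u n)] is at least [d], and [F (u n)] tends to [d]. *)
  have key t : 0 <= 2 * t * (rip w x - Re (phi x)) + t ^+ 2 * sqn x.
    have lim : (fun n => 2 * t * (rip (u n) x - Re (phi x)) + t ^+ 2 * sqn x + n.+1%:R^-1)
        @ \oo --> 2 * t * (rip w x - Re (phi x)) + t ^+ 2 * sqn x + 0.
      apply: cvgD inv0; apply: cvgD; last exact: cvg_cst.
      apply: cvgMr; apply: cvgB; last exact: cvg_cst.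
      exact: hcvg_rip (hcvg_cst x).
    rewrite -[leRHS]addr0; apply: (ler_cvg_to (cvg_cst 0) lim).
    apply: nearW => n.
    have := dF (t%:C *: x + u n) (DD _ _ _ Dx (Du n)).
    rewrite /F sqnD sqnZR ripZl phiD// ReD ReM/= mul0r subr0 (ripC x).
    by have := Fu n; rewrite /F; move: (n.+1%:R^-1) => p; lra.
  apply/eqP; rewrite -subr_eq0; apply/eqP.
  set a := rip w x - Re (phi x) in key *.
  have s0 := sqn_ge0 x; set s := sqn x in key s0.
  have s1 : 0 < s + 1 by rewrite ltr_wpDl.
  (* The quadratic is minimal at -a/s; [s + 1] avoids a division by 0 and still gives a negative
     value unless [a] is 0. *)
  have := key (- a / (s + 1)).
  have -> : 2 * (- a / (s + 1)) * a + (- a / (s + 1)) ^+ 2 * s =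
    - (a ^+ 2 * ((s + 2) / (s + 1) ^+ 2)) by field; rewrite gt_eqF.
  rewrite oppr_ge0 pmulr_lle0; last first.
    by rewrite divr_gt0// ?exprn_gt0// ltr_wpDl.
  by move=> h; apply/eqP; rewrite -sqrf_eq0 eq_le h sqr_ge0.
move=> x Dx; apply: complex_ext; first exact: Re_eq.
have := Re_eq ('i *: x) (DZ _ _ Dx); rewrite phiZ// /rip innerZr !ReM /=.
by rewrite !mul0r !sub0r !mul1r => /oppr_inj.
Qed.

Lemma form_rep H K (B : H -> K -> R[i]) (c : R) : 0 <= c ->
  (forall a x y z, B (a *: x + y) z = conjc a * B x z + B y z) ->
  (forall a x y z, B x (a *: y + z) = a * B x y + B x z) ->
  (forall x z, abs2 (B x z) <= c * sqn x * sqn z) ->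
  exists T : K -> H, [/\ lin T, forall z, sqn (T z) <= c * sqn z &
    forall x z, inner x (T z) = B x z].
Proof.
move=> c0 Bl Br Bb.
have /choice[T hT] : forall z, exists w, forall x, inner x w = B x z.
  move=> z.
  case: (@riesz H setT (fun x => conjc (B x z)) (c * sqn z)
    (mulr_ge0 c0 (sqn_ge0 z)) I (fun _ _ _ _ _ => I)) => [a x y _ _|x _|w [_ h]].
  - by rewrite Bl rmorphD rmorphM/= conjcK.
  - by rewrite abs2J mulrAC.
  by exists w => x; rewrite innerC h// conjcK.
exists T; split=> //.
  by move=> a y z; apply: inner_ext => x; rewrite innerDr innerZr !hT Br.
move=> z; have := Bb (T z) z; rewrite -hT inner_sqn /abs2 /= expr0n addr0.
have [->|s0] := eqVneq (sqn (T z)) 0; first by rewrite mulr_ge0 ?sqn_ge0.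
rewrite expr2 mulrAC mulrC (mulrC _ (sqn (T z))) ler_pM2l//.
by rewrite lt_def s0 sqn_ge0.
Qed.

(** Integral estimates bound a form by a sum of squared norms. Homogeneity turns this into a
    product: on unit vectors the sum is 2, whence (2 c)^2 = 4 c^2. *)
Lemma form_bound H K (B : H -> K -> R[i]) (c : R) : 0 <= c ->
  (forall a x y z, B (a *: x + y) z = conjc a * B x z + B y z) ->
  (forall a x y z, B x (a *: y + z) = a * B x y + B x z) ->
  (forall x z, abs2 (B x z) <= (c * (sqn x + sqn z)) ^+ 2) ->
  forall x z, abs2 (B x z) <= 4 * c ^+ 2 * sqn x * sqn z.
Proof.
move=> c0 Bl Br Bb x z.
have B0l y : B 0 y = 0.
  have := Bl 1 0 0 y; rewrite scale1r addr0 rmorph1 mul1r => /eqP.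
  by rewrite -subr_eq0 opprD addNKr oppr_eq0 => /eqP.
have B0r y : B y 0 = 0.
  have := Br 1 y 0 0; rewrite scale1r addr0 mul1r => /eqP.
  by rewrite -subr_eq0 opprD addNKr oppr_eq0 => /eqP.
have abs20 : abs2 (0 : R[i]) = 0 by rewrite /abs2/= expr0n addr0.
have [x0|x0] := eqVneq (sqn x) 0; first by rewrite (sqn_eq0 x0) B0l abs20 sqn0 mulr0 mul0r.
have [z0|z0] := eqVneq (sqn z) 0; first by rewrite (sqn_eq0 z0) B0r abs20 sqn0 mulr0.
have x1 : 0 < sqn x by rewrite lt_def x0 sqn_ge0.
have z1 : 0 < sqn z by rewrite lt_def z0 sqn_ge0.
pose p := (Num.sqrt (sqn x))^-1; pose q := (Num.sqrt (sqn z))^-1.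
have p2 : p ^+ 2 = (sqn x)^-1 by rewrite exprVn sqr_sqrtr ?ltW.
have q2 : q ^+ 2 = (sqn z)^-1 by rewrite exprVn sqr_sqrtr ?ltW.
have := Bb (p%:C *: x) (q%:C *: z).
rewrite -[p%:C *: x]addr0 Bl B0l -[q%:C *: z]addr0 Br B0r !addr0 !abs2M abs2J.
rewrite !sqnZR p2 q2 !mulVf// {1 2}/abs2 /= expr0n !addr0 p2 q2.
rewrite mulrC ler_pdivrMr// mulrC ler_pdivrMr//; lra.
Qed.

Lemma op_of_form H (B : H -> H -> R[i]) (c : R) : 0 <= c ->
  (forall a x y z, B (a *: x + y) z = conjc a * B x z + B y z) ->
  (forall a x y z, B x (a *: y + z) = a * B x y + B x z) ->
  (forall x z, abs2 (B x z) <= (c * (sqn x + sqn z)) ^+ 2) ->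
  exists T : bounded_op H, forall x z, inner x (T z) = B x z.
Proof.
move=> c0 Bl Br Bb.
have c2 : 0 <= 4 * c ^+ 2 by rewrite mulr_ge0 ?sqr_ge0.
have [f [lf bf hf]] := form_rep c2 Bl Br (form_bound c0 Bl Br Bb).
by have [T hT] := ex_op lf bf; exists T => x z; rewrite hT hf.
Qed.

Lemma ex_adjoint H K (f : H -> K) (c : R) : 0 <= c -> lin f ->
  (forall x, sqn (f x) <= c * sqn x) ->
  exists g : K -> H, [/\ lin g, forall z, sqn (g z) <= c * sqn z &
    forall x z, inner x (g z) = inner (f x) z].
Proof.
move=> c0 lf bf; apply: form_rep => //.
- by move=> a x y z; rewrite lf innerDl innerZl.
- by move=> a x y z; rewrite innerDr innerZr.
by move=> x z; apply: le_trans (inner_cs _ _) _; rewrite ler_wpM2r ?sqn_ge0.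
Qed.

End Operators.

Section OperatorAlgebra.
Context {R : realType} {H : hilbertType R}.
Implicit Types (T S : bounded_op H).

Definition bdd (f : H -> H) := exists c : R, forall x, sqn (f x) <= c * sqn x.

Lemma ex_mkop (f : H -> H) : lin f /\ bdd f -> exists T : bounded_op H, forall x, T x = f x.
Proof. by move=> [lf [c bf]]; exact: ex_op lf bf. Qed.

Definition mkop (f : H -> H) (h : lin f /\ bdd f) : bounded_op H := sval (cid (ex_mkop h)).

Lemma mkopE (f : H -> H) (h : lin f /\ bdd f) x : mkop h x = f x.
Proof. exact: (svalP (cid (ex_mkop h))). Qed.

Lemma opD_subproof T S : lin (fun x => T x + S x) /\ bdd (fun x => T x + S x).
Proof.
split; first by move=> a x y; rewrite !op_lin scalerDr addrACA.
have [c c0 hc] := op_bound T; have [d d0 hd] := op_bound S.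
exists (2 * (c + d)) => x; apply: le_trans (sqnD_le _ _) _.
by rewrite -mulrA ler_pM2l// mulrDl lerD.
Qed.
Definition opD T S := mkop (opD_subproof T S).
Lemma opDE T S x : opD T S x = T x + S x. Proof. exact: mkopE. Qed.

Lemma opZ_subproof a T : lin (fun x => a *: T x) /\ bdd (fun x => a *: T x).
Proof.
split; first by move=> b x y; rewrite op_lin scalerDr !scalerA mulrC.
have [c c0 hc] := op_bound T.
by exists (abs2 a * c) => x; rewrite sqnZ -mulrA ler_wpM2l ?abs2_ge0.
Qed.
Definition opZ a T := mkop (opZ_subproof a T).
Lemma opZE a T x : opZ a T x = a *: T x. Proof. exact: mkopE. Qed.

Lemma opM_subproof T S : lin (fun x => T (S x)) /\ bdd (fun x => T (S x)).
Proof.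
split; first by move=> b x y; rewrite !op_lin.
have [c c0 hc] := op_bound T; have [d d0 hd] := op_bound S.
exists (c * d) => x; apply: le_trans (hc _) _.
by rewrite -mulrA ler_wpM2l.
Qed.
Definition opM T S := mkop (opM_subproof T S).
Lemma opME T S x : opM T S x = T (S x). Proof. exact: mkopE. Qed.

Lemma op0_subproof : lin (fun _ : H => 0 : H) /\ bdd (fun=> 0).
Proof.
split; first by move=> b x y; rewrite scaler0 addr0.
by exists 0 => x; rewrite sqn0 mul0r.
Qed.
Definition op0 := mkop op0_subproof.
Lemma op0E x : op0 x = 0. Proof. exact: mkopE. Qed.

Lemma ex_opadj T : exists T' : bounded_op H, forall x y, inner (T' x) y = inner x (T y).
Proof.
have [c c0 hc] := op_bound T.
have [g [lg bg hg]] := ex_adjoint c0 (@op_lin _ _ T) hc.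
have [T' hT'] := ex_op lg bg; exists T' => x y.
by rewrite hT' innerC hg -innerC.
Qed.
Definition opadj T := sval (cid (ex_opadj T)).
Lemma opadjE T x y : inner (opadj T x) y = inner x (T y).
Proof. exact: (svalP (cid (ex_opadj T))). Qed.
Lemma opadjEr T x y : inner x (opadj T y) = inner (T x) y.
Proof. by rewrite innerC opadjE -innerC. Qed.

End OperatorAlgebra.

(** * Square roots and polar decomposition *)

Section PositiveOperators.
Context {R : realType} {H : hilbertType R}.
Implicit Types (T S B : bounded_op H).

Lemma pos_Re B x : positive_op B -> inner x (B x) = (rip x (B x))%:C.
Proof. by move=> /(_ x); rewrite lecE /= => /andP[/eqP h _]; apply: complex_ext. Qed.

Lemma pos_rip B x : positive_op B -> 0 <= rip x (B x).
Proof. by move=> /(_ x); rewrite lecE /= => /andP[]. Qed.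

(** Expanding the diagonal at [u + v] shows that Im <u, B v> is antisymmetric; for [x] and [y] this
    compares imaginary parts, for [x] and ['i *: y] real parts. *)
Lemma selfadj_real B : (forall x, Im (inner x (B x)) = 0) ->
  forall x y, inner (B x) y = inner x (B y).
Proof.
move=> hB x y; rewrite innerC.
have h u v : Im (inner u (B v)) + Im (inner v (B u)) = 0.
  have := hB (u + v); rewrite (linD (@op_lin _ _ B)) !innerDr !innerDl !ImD !hB.
  by rewrite add0r addr0 addrC.
have := h x y; have := h x ('i *: y).
rewrite (linZ (@op_lin _ _ B)) innerZr innerZl !ReImE /= => h1 h2.
apply: complex_ext; rewrite ?ReJ ?ImJ; lra.
Qed.

Lemma pos_selfadj B : positive_op B -> forall x y, inner (B x) y = inner x (B y).
Proof. by move=> pB; apply: selfadj_real => x; rewrite pos_Re. Qed.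

Lemma pos_cs B x y : positive_op B -> rip x (B y) ^+ 2 <= rip x (B x) * rip y (B y).
Proof.
move=> pB.
have sym u v : rip v (B u) = rip u (B v).
  by rewrite ripC /rip (pos_selfadj pB).
have key t : 0 <= rip x (B x) + 2 * t * rip x (B y) + t ^+ 2 * rip y (B y).
  have := pos_rip (x + t%:C *: y) pB.
  rewrite (linD (@op_lin _ _ B)) (linZ (@op_lin _ _ B)) !ripDr !ripDl !ripZr !ripZl.
  by rewrite (sym y x); lra.
have := pos_rip y pB; rewrite le_eqVlt => /orP[/eqP y0|y0].
  have [->|n0] := eqVneq (rip x (B y)) 0; first by rewrite expr0n mulr_ge0 ?pos_rip.
  (* When <y, B y> = 0 the polynomial is affine in t, and this t gives it the value -1. *)
  have := key (- (rip x (B x) + 1) / (2 * rip x (B y))).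
  rewrite -y0 mulr0 addr0.
  have -> : 2 * (- (rip x (B x) + 1) / (2 * rip x (B y))) * rip x (B y)
     = - (rip x (B x) + 1) by field; exact: n0.
  by lra.
have := key (- rip x (B y) / rip y (B y)).
have -> : rip x (B x) + 2 * (- rip x (B y) / rip y (B y)) * rip x (B y)
   + (- rip x (B y) / rip y (B y)) ^+ 2 * rip y (B y)
   = rip x (B x) - rip x (B y) ^+ 2 / rip y (B y) by field; rewrite gt_eqF.
by rewrite subr_ge0 ler_pdivrMr.
Qed.

(** This is B^2 <= k B, from [pos_cs] at [B x] and [x] after division by |B x|^2. It makes 1 - B / k
    a contraction, as the square root iteration requires. *)
Lemma pos_bound B : positive_op B ->
  exists2 k : R, 0 < k & forall x, sqn (B x) <= k * rip x (B x).
Proof.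
move=> pB; have [c c0 hc] := op_bound B.
exists (c + 1) => [|x]; first by rewrite ltr_wpDl.
have [->|n0] := eqVneq (sqn (B x)) 0.
  by rewrite mulr_ge0 ?addr_ge0 ?pos_rip.
have n1 : 0 < sqn (B x) by rewrite lt_def n0 sqn_ge0.
have h1 := pos_cs (B x) x pB; rewrite rip_sqn in h1.
have h2 : rip (B x) (B (B x)) <= (c + 1) * sqn (B x).
  have := rip_amgm (B x) (B (B x)); have := hc (B x).
  have := ler_norm (rip (B x) (B (B x))).
  by nra.
have h3 : sqn (B x) * sqn (B x) <= ((c + 1) * rip x (B x)) * sqn (B x).
  rewrite -expr2 (le_trans h1)// mulrAC ler_wpM2r ?pos_rip//.
by rewrite -(ler_pM2r n1).
Qed.

(** [a] bounds the norm, not its square, so that constants add in [contrD] and multiply in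
    [contrM]. *)
Definition contr (a : R) (f : H -> H) := forall x, sqn (f x) <= a ^+ 2 * sqn x.

Lemma contrD a b f g : 0 <= a -> 0 <= b -> contr a f -> contr b g ->
  contr (a + b) (fun x => f x + g x).
Proof.
move=> a0 b0 hf hg x; rewrite sqnD.
have h : rip (f x) (g x) <= a * b * sqn x.
  apply: le_trans (ler_norm _) _; apply: le_trans (rip_le _ _) _.
  have -> : a * b * sqn x = Num.sqrt (a ^+ 2 * sqn x) * Num.sqrt (b ^+ 2 * sqn x).
    have e c : 0 <= c -> Num.sqrt (c ^+ 2 * sqn x) = c * Num.sqrt (sqn x).
      by move=> c0; rewrite sqrtrM ?sqr_ge0// sqrtr_sqr ger0_norm.
    by rewrite !e// mulrACA -expr2 sqr_sqrtr ?sqn_ge0.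
  by apply: ler_pM; rewrite ?sqrtr_ge0// ler_wsqrtr.
by have := hf x; have := hg x; nra.
Qed.

Lemma contrM a b f g : contr a f -> contr b g -> contr (a * b) (fun x => f (g x)).
Proof.
move=> hf hg x; apply: le_trans (hf _) _.
by rewrite exprMn -[leRHS]mulrA ler_wpM2l ?sqr_ge0.
Qed.

Lemma contrZ a (r : R) f : contr a f -> contr (r * a) (fun x => r%:C *: f x).
Proof. by move=> hf x; rewrite sqnZR exprMn -[leRHS]mulrA ler_wpM2l ?sqr_ge0. Qed.

Section SquareRoot.
Variable X : H -> H.
Hypotheses (lX : lin X) (cX : contr 1 X)
  (sX : forall x y, inner (X x) y = inner x (X y)).

Let h : R[i] := (2^-1)%:C.

(* Iteration solving Y = (X + Y^2) / 2, so that (1 - Y)^2 = 1 - X. *)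
Fixpoint sqrt_it n : H -> H :=
  if n is m.+1 then fun x => h *: (X x + sqrt_it m (sqrt_it m x)) else fun=> 0.

(** The same iteration for the scalar X = 1. It increases and is bounded by 1, and its increments
    dominate those of the operator iterates in norm. *)
Fixpoint sqrt_maj n : R := if n is m.+1 then 2^-1 * (1 + sqrt_maj m ^+ 2) else 0.

Lemma sqrt_itS n x : sqrt_it n.+1 x = h *: (X x + sqrt_it n (sqrt_it n x)).
Proof. by []. Qed.

Lemma sqrt_majS n : sqrt_maj n.+1 = 2^-1 * (1 + sqrt_maj n ^+ 2).
Proof. by []. Qed.

Lemma sqrt_maj01 n : 0 <= sqrt_maj n <= 1.
Proof.
elim: n => [|n /andP[h0 h1]] /=; first by rewrite lexx ler01.
by apply/andP; split; nra.
Qed.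

Lemma sqrt_maj_le n : sqrt_maj n <= sqrt_maj n.+1.
Proof. by rewrite /=; have := sqr_ge0 (sqrt_maj n - 1); lra. Qed.

Lemma sqrt_it_lin n : lin (sqrt_it n).
Proof.
elim: n => [|n ih] a x y /=; first by rewrite scaler0 addr0.
by rewrite lX !ih addrACA -[X in h *: (X + _)]scalerDr (scalerDr h) !scalerA (mulrC h).
Qed.

Lemma sqrt_it_contr n : contr (sqrt_maj n) (sqrt_it n).
Proof.
elim: n => [|n ih] /=; first by move=> x; rewrite sqn0 expr0n mul0r.
apply: contrZ; rewrite expr2; have /andP[y0 _] := sqrt_maj01 n.
by apply: contrD => //; [exact: mulr_ge0|exact: contrM].
Qed.

Lemma sqrt_it_comm (f : H -> H) : lin f -> (forall x, f (X x) = X (f x)) ->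
  forall n x, f (sqrt_it n x) = sqrt_it n (f x).
Proof.
move=> lf fX; elim=> [|n ih] x /=; first exact: lin0.
by rewrite (linZ lf) (linD lf) fX !ih.
Qed.

Lemma sqrt_it_comm2 n m x : sqrt_it n (sqrt_it m x) = sqrt_it m (sqrt_it n x).
Proof.
apply: sqrt_it_comm; first exact: sqrt_it_lin.
by move=> y; rewrite -(sqrt_it_comm lX).
Qed.

Lemma sqrt_it_selfadj n x y : inner (sqrt_it n x) y = inner x (sqrt_it n y).
Proof.
elim: n x y => [|n ih] x y /=; first by rewrite inner0l inner0r.
by rewrite innerZl innerZr (conjcR _ : conjc h = h) innerDl innerDr sX !ih.
Qed.

(** The iterates commute, so Y_(n+2) - Y_(n+1) = (Y_(n+1) + Y_n) (Y_(n+1) - Y_n) / 2. The scalars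
    satisfy the same identity, with nonnegative factors, so that the bound propagates. *)
Lemma sqrt_it_step n :
  contr (sqrt_maj n.+1 - sqrt_maj n) (fun x => sqrt_it n.+1 x - sqrt_it n x).
Proof.
elim: n => [|n ih].
  move=> x; have := @sqrt_it_contr 1 x; rewrite /= !subr0//.
have -> : (fun x => sqrt_it n.+2 x - sqrt_it n.+1 x) = fun x =>
    h *: ((fun z => sqrt_it n.+1 z + sqrt_it n z) (sqrt_it n.+1 x - sqrt_it n x)).
  apply/funext => x; rewrite (sqrt_itS n.+1).
  transitivity (h *: (X x + sqrt_it n.+1 (sqrt_it n.+1 x)) -
                h *: (X x + sqrt_it n (sqrt_it n x))); first by rewrite -sqrt_itS.
  rewrite -scalerBr opprD addrACA subrr add0r; congr (_ *: _).
  by rewrite !(linB (@sqrt_it_lin _)) (sqrt_it_comm2 n n.+1) addrA subrK.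
have -> : sqrt_maj n.+2 - sqrt_maj n.+1 =
   2^-1 * ((sqrt_maj n.+1 + sqrt_maj n) * (sqrt_maj n.+1 - sqrt_maj n)).
  rewrite (sqrt_majS n.+1).
  transitivity (2^-1 * (1 + sqrt_maj n.+1 ^+ 2) - 2^-1 * (1 + sqrt_maj n ^+ 2)).
    by rewrite -sqrt_majS.
  by ring.
apply: contrZ.
apply: (@contrM _ _ (fun z => sqrt_it n.+1 z + sqrt_it n z)
  (fun x => sqrt_it n.+1 x - sqrt_it n x)) => //.
by apply: contrD; try exact: sqrt_it_contr; [case/andP: (sqrt_maj01 n.+1)|case/andP: (sqrt_maj01 n)].
Qed.

Lemma sqrt_maj_mono n k : sqrt_maj n <= sqrt_maj (n + k).
Proof. by elim: k => [|k ih]; rewrite ?addn0// addnS (le_trans ih)// sqrt_maj_le. Qed.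

Lemma sqrt_it_diff n k :
  contr (sqrt_maj (n + k) - sqrt_maj n) (fun x => sqrt_it (n + k) x - sqrt_it n x).
Proof.
elim: k => [|k ih].
  by rewrite addn0 subrr => x; rewrite subrr sqn0 expr0n mul0r.
have -> : sqrt_maj (n + k.+1) - sqrt_maj n =
  (sqrt_maj (n + k).+1 - sqrt_maj (n + k)) + (sqrt_maj (n + k) - sqrt_maj n).
  by rewrite addnS addrA subrK.
have -> : (fun x => sqrt_it (n + k.+1) x - sqrt_it n x) = fun x =>
  (sqrt_it (n + k).+1 x - sqrt_it (n + k) x) + (sqrt_it (n + k) x - sqrt_it n x).
  by apply/funext => x; rewrite addnS addrA subrK.
apply: contrD => //; last exact: sqrt_it_step.
  by rewrite subr_ge0 sqrt_maj_le.
by rewrite subr_ge0 sqrt_maj_mono.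
Qed.

Lemma ex_sqrt_it_lim : exists Y : H -> H, forall x, hcvg (fun n => sqrt_it n x) (Y x).
Proof.
suff /choice[Y hY] : forall x, exists y, hcvg (fun n => sqrt_it n x) y by exists Y.
move=> x; apply: hcvg_complete => e e0.
have : cvgn sqrt_maj.
  apply: nondecreasing_is_cvgn.
    by apply/nondecreasing_seqP => n; exact: sqrt_maj_le.
  by exists 1 => _ [n _ <-]; case/andP: (sqrt_maj01 n).
move=> /cvg_ex[l hl].
have s1 : 0 < sqn x + 1 by rewrite ltr_wpDl ?sqn_ge0.
pose d := Num.sqrt (e / (sqn x + 1)).
have d0 : 0 < d by rewrite sqrtr_gt0 divr_gt0.
have d2 : 0 < d / 2 by rewrite divr_gt0.
have /cvgrPdist_lt/(_ _ d2)[N _ hN] := hl.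
exists N => n Nn; rewrite -(subnKC Nn).
apply: le_lt_trans (sqrt_it_diff _ _ _) _; rewrite subnKC//.
have h1 : 0 <= sqrt_maj n - sqrt_maj N.
  by rewrite subr_ge0 -(subnKC Nn) sqrt_maj_mono.
have h2 : sqrt_maj n - sqrt_maj N <= d.
  have := hN _ Nn; have := hN _ (leqnn N) => /=.
  by rewrite !ltr_norml => /andP[? ?] /andP[? ?]; lra.
have h3 : (sqrt_maj n - sqrt_maj N) ^+ 2 <= d ^+ 2.
  by rewrite ler_sqr ?nnegrE// ltW.
apply: (@le_lt_trans _ _ (d ^+ 2 * sqn x)); first by rewrite ler_wpM2r ?sqn_ge0.
rewrite sqr_sqrtr; last by rewrite ltW// divr_gt0.
by rewrite mulrAC ltr_pdivrMr// ltr_pM2l// ltrDl.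
Qed.

Lemma ex_sqrt_fix : exists Y : H -> H, [/\ lin Y, contr 1 Y,
  forall x y, inner (Y x) y = inner x (Y y) &
  forall x, 2%:C *: Y x = X x + Y (Y x)].
Proof.
have [Y hY] := ex_sqrt_it_lim; exists Y.
have lY : lin Y.
  move=> a x y; apply: (hcvg_unique (hY _)).
  under eq_fun do rewrite sqrt_it_lin.
  by apply: hcvgD => //; apply: hcvgZ.
have cY' n : contr 1 (sqrt_it n).
  move=> x; apply: le_trans (sqrt_it_contr _ _) _.
  by rewrite ler_wpM2r ?sqn_ge0//; have /andP[? ?] := sqrt_maj01 n; nra.
split => //.
- move=> x; apply: (ler_cvg_to (hcvg_sqn (hY x)) (cvg_cst (1 ^+ 2 * sqn x))).
  by apply: nearW => n; exact: cY'.
- have r x y : rip (Y x) y = rip x (Y y).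
    have h1 := hcvg_rip (hY x) (hcvg_cst y).
    have h2 := hcvg_rip (hcvg_cst x) (hY y).
    have e : (fun n => rip (sqrt_it n x) y) = fun n => rip x (sqrt_it n y).
      by apply/funext => n; rewrite /rip sqrt_it_selfadj.
    by rewrite e in h1; exact: (cvg_unique _ h1 h2).
  move=> x y; apply: complex_ext; first exact: r.
  by rewrite !Im_inner -(linZ lY) r.
move=> x.
(* Products of strongly convergent sequences converge strongly when the left factors are uniformly
   bounded, here by 1. *)
have hYY : hcvg (fun n => sqrt_it n (sqrt_it n x)) (Y (Y x)).
  apply: (@hcvg_le _ _ _ _ (fun n => 2 * (sqn (sqrt_it n x - Y x)
      + sqn (sqrt_it n (Y x) - Y (Y x))))).
    rewrite [X in _ --> X](_ : 0 = 2 * (0 + 0)); last by ring.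
    by apply: cvgMr; apply: cvgD; exact: hY.
  move=> n.
  have -> : sqrt_it n (sqrt_it n x) - Y (Y x) =
     sqrt_it n (sqrt_it n x - Y x) + (sqrt_it n (Y x) - Y (Y x)).
    by rewrite (linB (@sqrt_it_lin _)) addrA subrK.
  apply: le_trans (sqnD_le _ _) _; rewrite ler_pM2l// lerD2r.
  by have := cY' n (sqrt_it n x - Y x); rewrite expr1n mul1r.
have h1 := hcvgZ 2%:C (hcvg_shift 1 (hY x)).
apply: (hcvg_unique h1).
rewrite [X in hcvg X](_ : _ = fun n => X x + sqrt_it n (sqrt_it n x)).
  by apply: hcvgD => //; exact: hcvg_cst.
apply/funext => n; rewrite addn1 /= scalerA.
suff -> : (2%:C * h : R[i]) = 1 by rewrite scale1r.
by rewrite /h -rmorphM/= divff.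
Qed.

End SquareRoot.

Lemma ex_sqrt_op B : positive_op B ->
  exists N : bounded_op H, positive_op N /\ forall x, N (N x) = B x.
Proof.
move=> pB; have [k k0 hk] := pos_bound pB.
(* With (1 - Y)^2 = 1 - X = B / k, the root of B is sqrt k (1 - Y), which is positive because Y is a
   contraction. *)
pose X x := x - (k^-1)%:C *: B x.
have lX : lin X.
  move=> a x y; rewrite /X op_lin scalerDr opprD addrACA scalerBr; congr (_ - _ + _).
  by rewrite !scalerA mulrC.
have cX : contr 1 X.
  move=> x; rewrite expr1n mul1r /X sqnB sqnZR ripZr.
  have h1 : k^-1 ^+ 2 * sqn (B x) <= k^-1 * rip x (B x).
    rewrite expr2 -mulrA ler_pM2l ?invr_gt0// mulrC ler_pdivrMr// mulrC; exact: hk.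
  have h2 : 0 <= k^-1 * rip x (B x) by rewrite mulr_ge0 ?pos_rip// invr_ge0 ltW.
  by lra.
have sX x y : inner (X x) y = inner x (X y).
  by rewrite /X innerBl innerBr innerZl innerZr conjcR pos_selfadj.
have [Y [lY cY sY hY]] := ex_sqrt_fix lX cX sX.
have sk : 0 <= Num.sqrt k by rewrite sqrtr_ge0.
have [|N hN] := @ex_mkop _ _ (fun x => (Num.sqrt k)%:C *: (x - Y x)).
  split; first by move=> a x y; rewrite lY opprD addrACA -scalerBr scalerDr !scalerA mulrC.
  exists (k * 4) => x; rewrite sqnZR sqr_sqrtr ?(ltW k0)// -mulrA ler_pM2l//.
  apply: le_trans (sqnB_le _ _) _; have := cY x; lra.
exists N; split.
  move=> x; rewrite hN innerZr innerBr lecE.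
  have i0 : Im (inner x (Y x)) = 0.
    by have := sY x x; rewrite innerC => /(congr1 (@Im R)); rewrite ImJ; lra.
  rewrite !ReImE inner_sqn /= i0 !mul0r !subr0 mulr0 addr0 eqxx/=.
  rewrite mulr_ge0//.
  have := rip_amgm x (Y x); have := cY x; have := ler_norm (rip x (Y x)); rewrite /rip; lra.
move=> x; rewrite !hN (linZ lY) -scalerBr scalerA -rmorphM/= -expr2 sqr_sqrtr ?(ltW k0)//.
rewrite (linB lY).
have -> : x - Y x - (Y x - Y (Y x)) = x - (2%:C *: Y x - Y (Y x)).
  rewrite [2%:C](_ : _ = 1 + 1); last by rewrite -(rmorphD (real_complex R) 1 1).
  by rewrite scalerDl scale1r -[LHS]addrA -opprD addrA.
rewrite hY addrK /X opprB addrC subrK scalerA -rmorphM/= divff ?gt_eqF//.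
by rewrite scale1r.
Qed.

Lemma is_abs_sqn T S : is_abs T S -> forall x, sqn (S x) = sqn (T x).
Proof.
move=> [pS [T' hT' hS]] x.
by rewrite -!rip_sqn /rip (pos_selfadj pS) hS innerC hT' -innerC.
Qed.

Lemma ex_abs T : exists S, is_abs T S.
Proof.
have pB : positive_op (opM (opadj T) T).
  by move=> x; rewrite opME opadjEr inner_sqn lecR sqn_ge0.
have [S [pS hS]] := ex_sqrt_op pB.
exists S; split => //; exists (opadj T) => [x y|x]; first exact: opadjE.
by rewrite hS opME.
Qed.

(** [C v] is the Riesz vector of the functional T x |-> <v, S x>, taken in the closure of the range
    of [T]. This functional is well defined and bounded since |S x| = |T x|. The last clause says S
    = C^* T. *)
Lemma polar T S : is_abs T S -> exists C : bounded_op H,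
  [/\ forall x, sqn (C x) <= sqn x, forall x, C (S x) = T x &
      forall x v, inner (C v) (T x) = inner v (S x)].
Proof.
move=> /is_abs_sqn hTS.
have ST0 x : T x = 0 -> S x = 0 by move=> h; apply: sqn_eq0; rewrite hTS h sqn0.
pose D := range T.
pose cl w := exists2 u : nat -> H, forall n, D (u n) & hcvg u w.
have DD (a : R[i]) x y : D x -> D y -> D (a *: x + y).
  by move=> [x' _ <-] [y' _ <-]; exists (a *: x' + y') => //; rewrite op_lin.
have clD (a : R[i]) x y : cl x -> cl y -> cl (a *: x + y).
  move=> [u hu ux] [v hv vy]; exists (fun n => a *: u n + v n) => [n|]; first exact: DD.
  by apply: hcvgD => //; apply: hcvgZ.
have cl0 w : cl w -> (forall x, inner w (T x) = 0) -> w = 0.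
  move=> [u hu uw] hw; apply: sqn_eq0; rewrite -rip_sqn.
  have h := hcvg_rip (hcvg_cst w) uw.
  have e : (fun n => rip w (u n)) = cst 0.
    by apply/funext => n; have [x _ <-] := hu n; rewrite /rip hw.
  by rewrite e in h; exact: (cvg_unique _ h (cvg_cst 0)).
(* [g] is a section of [T] on its range; the preimage it picks does not matter to [S], whose kernel
   contains that of [T]. *)
have /choice[g hg] : forall u, exists x, D u -> T x = u.
  move=> u; have [[x _ <-]|nD] := pselect (D u); first by exists x.
  by exists 0.
have Sg x : S (g (T x)) = S x.
  apply/subr0_eq; rewrite -(linB (@op_lin _ _ S)); apply: ST0.
  by rewrite (linB (@op_lin _ _ T)) hg ?subrr//; exists x.
have /choice[C hC] : forall v, exists w, cl w /\ forall x, inner w (T x) = inner v (S x).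
  move=> v.
  case: (@riesz _ _ D (fun u => inner v (S (g u))) (sqn v) (sqn_ge0 v) _ DD) => [|a|u|].
  - by exists 0 => //; rewrite (lin0 (@op_lin _ _ T)).
  - move=> x y [x' _ <-] [y' _ <-].
    by rewrite -(@op_lin _ _ T) !Sg op_lin innerDr innerZr.
  - by move=> [x _ <-]; rewrite Sg -hTS; exact: inner_cs.
  move=> w [cw hw]; exists w; split=> // x; rewrite hw; last by exists x.
  by rewrite Sg.
have clC v : cl (C v) by case: (hC v).
have CE v x : inner (C v) (T x) = inner v (S x) by case: (hC v).
have uniq w1 w2 : cl w1 -> cl w2 -> (forall x, inner w1 (T x) = inner w2 (T x)) -> w1 = w2.
  move=> c1 c2 h; apply/subr0_eq/cl0 => [|x]; last by rewrite innerBl h subrr.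
  by rewrite addrC -scaleN1r; exact: clD.
have lC : lin C.
  move=> a x y; apply: uniq => //; first exact: clD.
  by move=> z; rewrite innerDl innerZl !CE innerDl innerZl.
have bC v : sqn (C v) <= sqn v.
  (* With u_n = T x_n tending to C v, <C v, u_n> = <v, S x_n> has real part at most (|v|^2 +
     |u_n|^2) / 2; the limit gives |C v|^2 <= (|v|^2 + |C v|^2) / 2. *)
  have [u hu uC] := clC v.
  have h1 := hcvg_rip (hcvg_cst (C v)) uC; rewrite rip_sqn in h1.
  have h2 : (fun n => 2^-1 * (sqn v + sqn (u n))) @ \oo --> 2^-1 * (sqn v + sqn (C v)).
    by apply: cvgMr; apply: cvgD; [exact: cvg_cst|exact: hcvg_sqn].
  have : sqn (C v) <= 2^-1 * (sqn v + sqn (C v)).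
    apply: (ler_cvg_to h1 h2); apply: nearW => n.
    have [x _ <-] := hu n; rewrite /rip CE -hTS -/(rip _ _).
    by have := rip_amgm v (S x); have := ler_norm (rip v (S x)); lra.
  by lra.
have [|T' hT'] := @ex_mkop _ _ C.
  by split=> //; exists 1 => x; rewrite mul1r.
exists T'; split=> [x|x|x v]; rewrite hT'//.
apply: uniq => // [|y]; first by exists (fun _ => T x) => [n|]; [exists x|exact: hcvg_cst].
(* Equal norms give equal inner products, so [T x] itself is the vector representing v = S x. *)
rewrite CE; have r u v : rip (S u) (S v) = rip (T u) (T v).
  have e (f : bounded_op H) : rip (f u) (f v) = 4^-1 * (sqn (f (u + v)) - sqn (f (u - v))).
    by rewrite (linD (@op_lin _ _ f)) (linB (@op_lin _ _ f)) sqnD sqnB; field.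
  by rewrite !e !hTS.
apply: complex_ext; first exact: r.
by rewrite !Im_inner -!(linZ (@op_lin _ _ _)) r.
Qed.

End PositiveOperators.

(** * Parseval's identity and Hilbert-Schmidt operators *)

Section NonnegSums.
Context {R : realType} {I : choiceType}.
Implicit Types (a : I -> R) (J : {fset I}).

Lemma sum_fset_le_esum a J : (forall i, 0 <= a i) ->
  ((\sum_(i <- J) a i)%:E <= \esum_(i in [set: I]) (a i)%:E)%E.
Proof.
move=> a0; apply: esum_ge; exists [set` J]; first by split.
by rewrite fsbig_finite//= set_fsetK sumEFin.
Qed.

Lemma esum_le_sum_fset a (c : \bar R) : (forall J, ((\sum_(i <- J) a i)%:E <= c)%E) ->
  (\esum_(i in [set: I]) (a i)%:E <= c)%E.
Proof.
move=> h; apply: ge_ereal_sup => _ [X [finX _] <-].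
by rewrite fsbig_finite//= sumEFin.
Qed.

Lemma sum_fsetS a J J' : (forall i, 0 <= a i) -> (J `<=` J')%fset ->
  \sum_(i <- J) a i <= \sum_(i <- J') a i.
Proof.
move=> a0 JJ'; rewrite [leRHS](big_fsetID _ (mem J))/=.
rewrite (_ : \sum_(i <- [fset x in J' | x \in J]%fset) a i = \sum_(i <- J) a i).
  by rewrite lerDl sumr_ge0.
by apply: eq_fbigl => i; rewrite !inE /= -(@in_fsetI _ J' J) (fsetIidPr _).
Qed.

Lemma esum_fset_approx a (c : R) : (forall i, 0 <= a i) ->
  \esum_(i in [set: I]) (a i)%:E = c%:E -> forall eps : R, 0 < eps ->
  exists J0, forall J, (J0 `<=` J)%fset -> `|c - \sum_(i <- J) a i| < eps.
Proof.
move=> a0 ac eps e0.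
have : ((c - eps)%:E < \esum_(i in [set: I]) (a i)%:E)%E.
  by rewrite ac lte_fin ltrBlDr ltrDl.
move=> /ereal_sup_gt[_ [X [finX _] <-]].
rewrite fsbig_finite//= sumEFin lte_fin => h.
exists (fset_set X) => J XJ.
have h1 := sum_fsetS a0 XJ.
have := sum_fset_le_esum J a0; rewrite ac lee_fin => h2.
by rewrite ger0_norm ?subr_ge0//; lra.
Qed.

(** The support is the union over n of the sets where a_i exceeds 1 / (n + 1), and such a set has at
    most c (n + 1) elements. *)
Lemma esum_countable_support a (c : R) : (forall i, 0 <= a i) ->
  (forall J, \sum_(i <- J) a i <= c) -> countable [set i | a i != 0].
Proof.
move=> a0 ac.
have -> : [set i | a i != 0] = \bigcup_n [set i | n.+1%:R^-1 < a i].
  apply/seteqP; split=> [i /= ai|i [n _ /=]]; last first.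
    by apply: contraTneq => ->; rewrite -leNgt invr_ge0.
  have ai0 : 0 < a i by rewrite lt_def ai a0.
  exists (Num.truncn (a i)^-1) => //=.
  rewrite invf_plt ?posrE//; exact: truncnS_gt.
apply: bigcup_countable => // n _; apply: finite_set_countable.
apply: contrapT => h.
have := @infinite_set_fset _ _ (Num.truncn (c * n.+1%:R)).+1 h.
move=> [J JA cJ].
have : (\sum_(i <- J) n.+1%:R^-1 : R) <= \sum_(i <- J) a i.
  by rewrite !big_seq; apply: ler_sum => i /JA /= /ltW.
move=> /le_trans/(_ (ac J)).
rewrite big_const_seq count_predT iter_addr_0 -[leLHS]mulr_natl ler_pdivrMr//.
move=> /le_lt_trans/(_ (truncnS_gt _)).
by rewrite ltr_nat ltnNge cJ.
Qed.

End NonnegSums.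

Section Parseval.
Context {R : realType} {H : hilbertType R} {I : choiceType} (e : I -> H).
Hypothesis he : orthonormal_basis e.
Implicit Types (J : {fset I}) (x y : H).

Lemma inner_span J (c : I -> R[i]) i : i \in J ->
  inner (e i) (\sum_(j <- J) c j *: e j) = c i.
Proof.
move=> iJ; rewrite inner_sum_r (bigD1_seq i)//= innerZr he.1 eqxx mulr1.
rewrite big1 ?addr0// => j ji; rewrite innerZr he.1 eq_sym (negbTE ji) mulr0//.
Qed.

Definition proj J x := \sum_(i <- J) inner (e i) x *: e i.

(** The squared distance of [x] to the span of the [e i], i in J ([residue_proj]). *)
Definition residue J x := sqn x - \sum_(i <- J) abs2 (inner (e i) x).

Lemma residue_proj J x : sqn (x - proj J x) = residue J x.
Proof.
have h1 : rip x (proj J x) = \sum_(i <- J) abs2 (inner (e i) x).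
  rewrite /rip /proj inner_sum_r Re_sum; apply: eq_bigr => i _.
  by rewrite innerZr mulrC (innerC x) mulcJ.
have h2 : sqn (proj J x) = \sum_(i <- J) abs2 (inner (e i) x).
  rewrite /sqn {1}/proj inner_sum_l Re_sum; apply: eq_big_seq => i iJ.
  by rewrite innerZl inner_span// mulcJ.
by rewrite sqnB h1 h2 /residue; ring.
Qed.

Lemma bessel J x : \sum_(i <- J) abs2 (inner (e i) x) <= sqn x.
Proof. by rewrite -subr_ge0 -/(residue J x) -residue_proj sqn_ge0. Qed.

Lemma residueD_le J (a : R[i]) x y :
  residue J (a *: x + y) <= 2 * (abs2 a * residue J x + residue J y).
Proof.
have -> : residue J (a *: x + y) = sqn (a *: (x - proj J x) + (y - proj J y)).
  rewrite -residue_proj; congr sqn.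
  have -> : proj J (a *: x + y) = a *: proj J x + proj J y.
    rewrite /proj scaler_sumr -big_split/=; apply: eq_bigr => i _.
    by rewrite innerDr innerZr scalerDl scalerA.
  by rewrite opprD addrACA -scalerBr.
by rewrite (le_trans (sqnD_le _ _))// sqnZ !residue_proj.
Qed.

Lemma residueS J J' x : (J `<=` J')%fset -> residue J' x <= residue J x.
Proof. by move=> JJ'; rewrite lerB// sum_fsetS// => i; exact: abs2_ge0. Qed.

(** The vectors approximable by finite spans form a subspace [D] that contains the basis. Riesz on
    [D] produces the projection w of [x] onto its closure; x - w is orthogonal to every [e i], hence
    0 by totality, and a limit of elements of [D] is again approximable. *)
Lemma residue_small x (eps : R) : 0 < eps -> exists J, residue J x < eps.
Proof.
pose D : set H := [set x | forall eps : R, 0 < eps -> exists J, residue J x < eps].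
suff : D x by move=> h; exact: h.
have DD (a : R[i]) u v : D u -> D v -> D (a *: u + v).
  move=> Du Dv d d0.
  have a1 : 0 < 4 * (abs2 a + 1) by rewrite mulr_gt0// ltr_wpDl// abs2_ge0.
  have [k k0 hk] : exists2 k, 0 < k & abs2 a * k <= d / 4.
    exists (d / (4 * (abs2 a + 1))); first exact: divr_gt0.
    have -> : abs2 a * (d / (4 * (abs2 a + 1))) = (d / 4) * (abs2 a / (abs2 a + 1)).
      by field; rewrite gt_eqF// ltr_wpDl// abs2_ge0.
    rewrite ler_piMr ?divr_ge0 ?(ltW d0)//.
    by rewrite ler_pdivrMr ?ltr_wpDl ?abs2_ge0// mul1r lerDl.
  have [J1 h1] := Du _ k0.
  have d4 : 0 < d / 4 by rewrite divr_gt0.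
  have [J2 h2] := Dv (d / 4) d4.
  exists (J1 `|` J2)%fset; apply: le_lt_trans (residueD_le _ _ _ _) _.
  have h1' := le_lt_trans (residueS u (fsubsetUl J1 J2)) h1.
  have h2' := le_lt_trans (residueS v (fsubsetUr J1 J2)) h2.
  have : abs2 a * residue (J1 `|` J2)%fset u <= abs2 a * k.
    by rewrite ler_wpM2l ?abs2_ge0// ltW.
  lra.
have D0 : D 0.
  by move=> d d0; exists fset0; rewrite /residue big_nil subr0 sqn0.
have De i : D (e i).
  move=> d d0; exists [fset i]%fset; rewrite /residue big_seq_fset1 /sqn he.1 eqxx.
  by rewrite /abs2/= expr1n expr0n addr0 subrr.
have sb u : D u -> abs2 (inner x u) <= sqn x * sqn u by move=> _; exact: inner_cs.
have [w [[u Du uw] hw]] := riesz (sqn_ge0 x) D0 DD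
  (fun a y z _ _ => etrans (innerDr x (a *: y) z) (congr1 (fun t => t + _) (innerZr a x y))) sb.
suff -> : x = w.
  move=> d d0.
  have d4 : 0 < d / 4 by rewrite divr_gt0.
  have /hcvgP/(_ _ d4)[n _ /(_ n (leqnn n)) /= hn] := uw.
  have [J hJ] := Du n _ d4; exists J.
  have -> : w = 1 *: u n + (w - u n) by rewrite scale1r addrC subrK.
  apply: le_lt_trans (residueD_le _ _ _ _) _.
  have : residue J (w - u n) <= sqn (w - u n).
    by rewrite lerBlDr lerDl sumr_ge0// => i _; exact: abs2_ge0.
  rewrite (sqnBC w) (_ : abs2 (1 : R[i]) = 1); last by rewrite /abs2/= expr1n expr0n addr0.
  lra.
apply/subr0_eq/he.2 => i; rewrite innerBr innerC -hw// -innerC subrr//.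
Qed.

Lemma parseval x : \esum_(i in [set: I]) (abs2 (inner (e i) x))%:E = (sqn x)%:E.
Proof.
have a0 i : 0 <= abs2 (inner (e i) x) by exact: abs2_ge0.
apply/eqP; rewrite eq_le; apply/andP; split.
  by apply: esum_le_sum_fset => J; rewrite lee_fin bessel.
apply/lee_addgt0Pr => eps e0; have [J hJ] := residue_small x e0.
apply: (@le_trans _ _ ((\sum_(i <- J) abs2 (inner (e i) x))%:E + eps%:E)%E).
  by rewrite -EFinD lee_fin; move: hJ; rewrite /residue; lra.
by rewrite leeD2r// sum_fset_le_esum.
Qed.

Lemma countable_inner_neq0 x : countable [set i | inner (e i) x != 0].
Proof.
have := @esum_countable_support R I (fun i => abs2 (inner (e i) x)) (sqn x)
  (fun i => abs2_ge0 _) (fun J => bessel J x).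
apply: sub_countable; apply: subset_card_le => i /=.
by apply: contra_neq => /abs2_eq0.
Qed.

End Parseval.

Section HilbertSchmidt.
Context {R : realType} {H : hilbertType R}.
Implicit Types (Q T C : bounded_op H).

(** The squared Hilbert-Schmidt norm, possibly infinite; by [hs_basis] it does not depend on the
    basis. *)
Definition hs (I : choiceType) (e : I -> H) Q : \bar R :=
  \esum_(i in [set: I]) (sqn (Q (e i)))%:E.

Lemma esum_swap (I J : choiceType) (a : I -> J -> \bar R) :
  (forall i j, 0 <= a i j)%E ->
  \esum_(i in [set: I]) \esum_(j in [set: J]) a i j =
  \esum_(j in [set: J]) \esum_(i in [set: I]) a i j.
Proof.
move=> a0; rewrite !esum_esum//.
rewrite (@reindex_esum _ _ _ ([set: J] `*`` fun=> [set: I])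
  ([set: I] `*`` fun=> [set: J]) (fun k => (k.2, k.1)))//.
split=> //= [[i j] [i' j'] _ _ /= [-> ->]//|[i j] _ /=].
by exists (j, i).
Qed.

(** Both sides are the double sum of |<f_j, Q e_i>|^2. That the two bases may differ is what yields
    [hs_basis]. *)
Lemma hs_adj (I J : choiceType) (e : I -> H) (f : J -> H) Q :
  orthonormal_basis e -> orthonormal_basis f -> hs e Q = hs f (opadj Q).
Proof.
move=> he hf; rewrite /hs.
under eq_esum do rewrite -(parseval hf).
rewrite esum_swap; last by move=> i j; rewrite lee_fin abs2_ge0.
apply: eq_esum => j _; rewrite -(parseval he); apply: eq_esum => i _.
by rewrite opadjEr innerC abs2J.
Qed.

Lemma hs_basis (I J : choiceType) (e : I -> H) (f : J -> H) Q :
  orthonormal_basis e -> orthonormal_basis f -> hs e Q = hs f Q.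
Proof. by move=> he hf; rewrite (hs_adj Q he hf) -(hs_adj Q hf hf). Qed.

Lemma hsD_le (I : choiceType) (e : I -> H) Q T :
  (hs e Q < +oo -> hs e T < +oo -> hs e (opD Q T) < +oo)%E.
Proof.
move=> hQ hT.
apply: (@le_lt_trans _ _ ((hs e Q + hs e T) + (hs e Q + hs e T))%E); last first.
  by rewrite !lte_add_pinfty.
have s0 (S : bounded_op H) i : (0 <= (sqn (S (e i)))%:E)%E by rewrite lee_fin sqn_ge0.
rewrite /hs -esumD//; rewrite -esumD; last 2 first.
- by move=> i _; rewrite adde_ge0.
- by move=> i _; rewrite adde_ge0.
apply: le_esum => i _; rewrite opDE -!EFinD lee_fin.
by rewrite -mulr2n -mulr_natl sqnD_le.
Qed.

Lemma hsZ_lt (I : choiceType) (e : I -> H) a Q :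
  (hs e Q < +oo -> hs e (opZ a Q) < +oo)%E.
Proof.
move=> hQ; have a2 := abs2_ge0 a.
(* A natural multiple dominates the factor |a|^2, and natural multiples follow from additivity of
   the sum by induction. *)
have : exists n : nat, abs2 a <= n%:R.
  by exists (Num.truncn (abs2 a)).+1; apply/ltW/truncnS_gt.
move=> [n an].
have : forall n : nat, (\esum_(i in [set: I]) (n%:R * sqn (Q (e i)))%:E < +oo)%E.
  elim=> [|m ih]; first by rewrite esum1// => i _; rewrite mul0r.
  rewrite (_ : \esum_(i in _) _ = (\esum_(i in [set: I]) (m%:R * sqn (Q (e i)))%:E + hs e Q)%E).
    by rewrite lte_add_pinfty.
  rewrite -esumD => [||i _]; last by rewrite lee_fin sqn_ge0.
    by apply: eq_esum => i _; rewrite -EFinD -natr1 mulrDl mul1r.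
  by move=> i _; rewrite lee_fin mulr_ge0 ?sqn_ge0.
move=> /(_ n); apply: le_lt_trans; apply: le_esum => i _.
by rewrite lee_fin opZE sqnZ ler_wpM2r ?sqn_ge0.
Qed.

End HilbertSchmidt.

(** * Functional calculus *)

Section BoundedMeasurable.
Context {R : realType} {d : measure_display} {T : measurableType d}.
Implicit Types (g h : T -> R).

Definition bm h := measurable_fun setT h /\ exists M, forall l, `|h l| <= M.

Lemma measurable_ge (u : T -> R) (c : R) : measurable_fun setT u ->
  measurable ([set k | c <= u k] : set T).
Proof.
move=> mu; have -> : [set k | c <= u k] = setT `&` u @^-1` `[c, +oo[.
  by apply/seteqP; split => k /=; rewrite in_itv/= andbT // => -[].
exact: mu.
Qed.

Lemma bm_cst (c : R) : bm (cst c).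
Proof. by split; [exact: measurable_cst|exists `|c|]. Qed.

Lemma bm_indic (E : set T) : measurable E -> bm (\1_E).
Proof.
move=> mE; split; first exact: measurable_indic.
by exists 1 => l; rewrite indicE; case: (_ \in _); rewrite ?normr0 ?normr1.
Qed.

Lemma bmD g h : bm g -> bm h -> bm (fun l => g l + h l).
Proof.
move=> [mg [M hM]] [mh [N hN]]; split; first exact: measurable_funD.
by exists (M + N) => l; rewrite (le_trans (ler_normD _ _))// lerD.
Qed.

Lemma bmM g h : bm g -> bm h -> bm (fun l => g l * h l).
Proof.
move=> [mg [M hM]] [mh [N hN]]; split; first exact: measurable_funM.
by exists (M * N) => l; rewrite normrM ler_pM.
Qed.

Lemma bmZ (c : R) h : bm h -> bm (fun l => c * h l).
Proof. by move=> bh; apply: bmM => //; exact: bm_cst. Qed.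

Lemma bmN h : bm h -> bm (fun l => - h l).
Proof.
by move=> /(bmZ (-1)); congr bm; apply/funext => l; rewrite mulN1r.
Qed.

Lemma bmB g h : bm g -> bm h -> bm (fun l => g l - h l).
Proof. by move=> bg bh; apply: bmD => //; exact: bmN. Qed.

(* binary expansion, for [h] with values in [0, 1] *)
Fixpoint bin_approx h n : T -> R :=
  if n is m.+1 then
    fun l => 2^-1 ^+ n * \1_[set k | 2^-1 ^+ n <= h k - bin_approx h m k] l + bin_approx h m l
  else fun=> 0.

Lemma bin_approxS h n l : bin_approx h n.+1 l =
  2^-1 ^+ n.+1 * \1_[set k | 2^-1 ^+ n.+1 <= h k - bin_approx h n k] l + bin_approx h n l.
Proof. by []. Qed.

Lemma bin_approx_bounds h n l : 0 <= h l <= 1 ->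
  0 <= h l - bin_approx h n l <= 2^-1 ^+ n.
Proof.
move=> h01; elim: n => [|n ih]; first by rewrite /= subr0 expr0.
rewrite bin_approxS indicE.
case: (boolP (l \in _)) => hl; rewrite ?mulr1 ?mulr0 ?add0r.
  move: hl; rewrite inE /= => hl; move: ih hl; rewrite exprS.
  by move: (2^-1 ^+ n) (bin_approx h n l) => u v /andP[? ?] ?; apply/andP; split; lra.
move: hl; rewrite notin_setE /= => /negP; rewrite -ltNge => hl; move: ih hl; rewrite exprS.
by move: (2^-1 ^+ n) (bin_approx h n l) => u v /andP[? ?] ?; apply/andP; split; lra.
Qed.

Lemma bin_approx_measurable h n : measurable_fun setT h ->
  measurable_fun setT (bin_approx h n).
Proof.
move=> mh; elim: n => [|n ih] /=; first exact: measurable_cst.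
apply: measurable_funD => //; apply: measurable_funM; first exact: measurable_cst.
by apply/measurable_indic/measurable_ge; exact: measurable_funB.
Qed.

Lemma bin_level_measurable h n : measurable_fun setT h ->
  measurable ([set k | 2^-1 ^+ n.+1 <= h k - bin_approx h n k] : set T).
Proof.
move=> mh; apply: measurable_ge; apply: measurable_funB => //.
exact: bin_approx_measurable.
Qed.

(** Induction principle by which the calculus is extended from projections. The explicit rate 2^-n
    makes the limit uniform, so that the operators attached to the approximations converge. *)
Lemma bm_ind (Q : (T -> R) -> Prop) :
  (forall E : set T, measurable E -> Q (\1_E)) ->
  (forall a g h, bm g -> bm h -> Q g -> Q h -> Q (fun l => a * g l + h l)) ->
  (forall (h_ : nat -> T -> R) h, (forall n, bm (h_ n)) -> bm h -> (forall n, Q (h_ n)) ->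
     (forall n l, `|h l - h_ n l| <= 2^-1 ^+ n) -> Q h) ->
  forall h, bm h -> Q h.
Proof.
move=> Q1 QD Qlim.
have bin_bm h n : measurable_fun setT h -> bm (bin_approx h n).
  move=> mh; elim: n => [|n ih] /=; first exact: bm_cst.
  apply: bmD => //; apply: bmZ; apply: bm_indic; exact: bin_level_measurable.
have Q01 h : measurable_fun setT h -> (forall l, 0 <= h l <= 1) -> Q h.
  move=> mh h01; apply: (Qlim (bin_approx h)) => //.
  - by move=> n; exact: bin_bm.
  - by split => //; exists 1 => l; have /andP[? ?] := h01 l; rewrite ger0_norm.
  - elim=> [|n ih] /=.
      have -> : (fun=> 0) = \1_(set0 : set T) :> (T -> R) by apply/funext => l; rewrite indicE in_set0.
      exact: Q1.
    apply: QD => //; [apply: bm_indic; exact: bin_level_measurable|exact: bin_bm|].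
    by apply: Q1; exact: bin_level_measurable.
  - move=> n l; have /andP[? ?] := bin_approx_bounds n (h01 l).
    by rewrite ger0_norm.
move=> h [mh [M hM]].
pose N := `|M| + 1.
have N0 : 0 < N by rewrite /N ltr_wpDl.
have hN l : `|h l| <= N by rewrite (le_trans (hM l))// /N (le_trans (ler_norm M))// lerDl.
pose g (l : T) : R := (h l + N) / (2 * N).
have mg : measurable_fun setT g.
  by apply: measurable_funM; [apply: measurable_funD => //; exact: measurable_cst|exact: measurable_cst].
have g01 l : 0 <= g l <= 1.
  have := hN l; rewrite ler_norml /g => /andP[? ?]; apply/andP; split.
    by rewrite divr_ge0 ?mulr_ge0 ?(ltW N0)//; lra.
  by rewrite ler_pdivrMr ?mulr_gt0//; lra.
(* Undoes the affine rescaling to [0, 1]; the indicator of [set0] is a zero term that gives the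
   constant the shape a g + h required by [QD]. *)
have -> : h = fun l => (2 * N) * g l + (- N * \1_(setT : set T) l + \1_(set0 : set T) l).
  apply/funext => l; rewrite !indicE in_setT in_set0 /g /= mulrCA divff.
    by rewrite !mulr1 addr0 addrK.
  by rewrite gt_eqF ?mulr_gt0.
have bT : bm (\1_(setT : set T)) by apply: bm_indic.
have b0 : bm (\1_(set0 : set T)) by apply: bm_indic.
apply: (QD (2 * N)) => //.
- by split => //; exists 1 => l; have /andP[? ?] := g01 l; rewrite ger0_norm.
- by apply: bmD => //; exact: bmZ.
- exact: Q01.
- by apply: (QD (- N)) => //; exact: Q1.
Qed.

End BoundedMeasurable.

Section NumericalRange.
Context {R : realType} {H : hilbertType R}.
Implicit Types (S T : bounded_op H).

(** Linearity is only assumed along x + t y, so that [f] may be an unbounded operator completed by 0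
    off its domain. *)
Lemma polarization (f : H -> H) x y :
  (forall t : R[i], f (x + t *: y) = f x + t *: f y) ->
  4^-1 * \sum_(k < 4) 'i ^- k * inner (x + 'i ^+ k *: y) (f (x + 'i ^+ k *: y)) =
  inner x (f y).
Proof.
move=> hf.
have hi : (Num.imaginary : R[i]) = 0 +i* 1 by [].
have i0 : (0 +i* 1 : R[i]) != 0 by rewrite eq_complex /= oner_eq0 andbF.
have i2 : (0 +i* 1 : R[i]) * (0 +i* 1) = -1 by rewrite -expr2 sqr_i.
have iV : (0 +i* 1 : R[i])^-1 = - (0 +i* 1).
  by apply: (mulfI i0); rewrite mulfV// mulrN i2 opprK.
have iJ : conjc (0 +i* 1 : R[i]) = - (0 +i* 1) by apply: complex_ext => /=; rewrite ?oppr0.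
have e (t : R[i]) : inner (x + t *: y) (f (x + t *: y)) =
   inner x (f x) + t * inner x (f y) + conjc t * inner y (f x) + conjc t * t * inner y (f y).
  by rewrite hf !innerDl !innerDr !innerZl !innerZr; ring.
have cN (t : R[i]) : conjc (- t) = - conjc t by rewrite rmorphN.
have c1 : conjc (1 : R[i]) = 1 by rewrite rmorph1.
have i3 : (0 +i* 1 : R[i]) ^+ 3 = - (0 +i* 1) by rewrite exprS expr2 i2 mulrN1.
have [G hG] : exists G, forall t : R[i], inner (x + t *: y) (f (x + t *: y)) = G t.
  by exists (fun t => inner (x + t *: y) (f (x + t *: y))).
under eq_bigr do rewrite hG.
rewrite hi !big_ord_recl big_ord0 /= /bump /= !add1n i3 expr2 i2 !expr0 !expr1.
rewrite -!hG !e; move: i0 i2 iV iJ; move: (0 +i* 1 : R[i]) => i i0 i2 iV iJ.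
rewrite !cN iJ c1 !invrN invr1 !iV !opprK.
move: (inner x (f x)) (inner x (f y)) (inner y (f x)) (inner y (f y)) => a b c d.
apply: (mulfI (_ : (4 : R[i]) != 0)); first by rewrite pnatr_eq0.
rewrite mulrA mulfV ?pnatr_eq0// mul1r.
transitivity (2 * b + 2 * c - 2 * (i * i) * b + 2 * (i * i) * c); first by ring.
by rewrite i2; ring.
Qed.

Lemma op_eq_diag T S : (forall x, inner x (T x) = inner x (S x)) ->
  forall x, T x = S x.
Proof.
move=> h y; apply: inner_ext => x.
have lT (U : bounded_op H) (t : R[i]) : U (x + t *: y) = U x + t *: U y.
  by rewrite (linD (@op_lin _ _ U)) (linZ (@op_lin _ _ U)).
by rewrite -(polarization (lT T)) -(polarization (lT S)); under eq_bigr do rewrite h.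
Qed.

(** Integrals against spectral measures control quadratic forms only; this passes to operator norms.
    The parallelogram law bounds Re <x, T y>, replacing x by i x bounds the imaginary part, and
    [form_bound] contributes the factor 4. *)
Lemma numerical_radius T (r : H -> R) (c : R) : 0 <= c ->
  (forall x, inner x (T x) = (r x)%:C) -> (forall x, `|r x| <= c * sqn x) ->
  forall x, sqn (T x) <= 4 * c ^+ 2 * sqn x.
Proof.
move=> c0 hr rc.
have sT : forall x y, inner (T x) y = inner x (T y) by apply: selfadj_real => x; rewrite hr.
have rE x : rip x (T x) = r x by rewrite /rip hr.
have ripT x y : 2 * `|rip x (T y)| <= c * (sqn x + sqn y).
  have -> : rip x (T y) = 4^-1 * (r (x + y) - r (x - y)).
    rewrite -!rE !(linD (@op_lin _ _ T)) !(linN (@op_lin _ _ T)) !ripDr !ripDl !ripNr !ripNl.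
    by rewrite (_ : rip y (T x) = rip x (T y)); [field|rewrite ripC /rip sT].
  have := ler_normB (r (x + y)) (r (x - y)); have := rc (x + y); have := rc (x - y).
  rewrite normrM ger0_norm ?invr_ge0// (sqnD x y) (sqnB x y); lra.
have Bb x y : abs2 (inner x (T y)) <= (c * (sqn x + sqn y)) ^+ 2.
  have h1 := ripT x y; have h2 := ripT ('i *: x) y.
  have i1 : abs2 ('i : R[i]) = 1 by rewrite /abs2 /= expr0n expr1n add0r.
  rewrite sqnZ i1 mul1r -Im_inner in h2.
  rewrite /abs2 -/(rip x _).
  have := normr_ge0 (rip x (T y)); have := normr_ge0 (Im (inner x (T y))).
  rewrite -(real_normK (num_real (rip x (T y)))) -(real_normK (num_real (Im _))).
  by move: `|rip _ _| `|Im _| h1 h2 => a b h1 h2 a0 b0; nra.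
have c2 : 0 <= 4 * c ^+ 2 by rewrite mulr_ge0 ?sqr_ge0.
move=> x; have := @form_bound _ _ _ (fun x y => inner x (T y)) c c0 _ _ Bb (T x) x.
rewrite inner_sqn /abs2 /= expr0n addr0 => h.
have {}h : sqn (T x) ^+ 2 <= 4 * c ^+ 2 * sqn (T x) * sqn x.
  apply: h => [a u v z|a u v z]; first by rewrite innerDl innerZl.
  by rewrite op_lin innerDr innerZr.
have [->|s0] := eqVneq (sqn (T x)) 0; first by rewrite mulr_ge0 ?sqn_ge0.
have s1 : 0 < sqn (T x) by rewrite lt_def s0 sqn_ge0.
by rewrite -(ler_pM2r s1) -expr2 mulrAC.
Qed.

End NumericalRange.

(** * Integration of bounded functions against a projection-valued measure *)

Section BoundedCalculus.
Context {R : realType} {H : hilbertType R} (P : pvm H).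
Local Notation T := (measurableTypeR R).
Implicit Types (x y z : H) (E F : set T) (g h : R -> R).

Lemma pvm_rip E x : measurable E -> inner x (P E x) = (sqn (P E x))%:C.
Proof. by move=> mE; rewrite -inner_sqn pvm_selfadj// pvm_idem. Qed.

Lemma spectral_measure_sqn x E : spectral_measure P x E = (sqn (P E x))%:E.
Proof. by rewrite /spectral_measure -inner_norm. Qed.

Lemma spectral_measureT x : spectral_measure P x setT = (sqn x)%:E.
Proof. by rewrite spectral_measure_sqn pvm_setT. Qed.

Let spectral_fin x : fin_num_fun (spectral_measure P x).
Proof. by move=> E mE; rewrite spectral_measure_sqn. Qed.

HB.instance Definition _ x :=
  @Measure_isFinite.Build _ _ _ (spectral_measure P x) (@spectral_fin x).

Definition q h x : R := \int[spectral_measure P x]_l h l.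

Lemma bm_integrable h x : bm (h : T -> R) ->
  (spectral_measure P x).-integrable setT (EFin \o h).
Proof.
move=> [mh [M hM]]; apply: measurable_bounded_integrable => //.
  by rewrite [X in (X < _)%E](spectral_measureT x) ltry.
exists M; split; first exact: num_real.
by move=> N MN l _ /=; rewrite (le_trans (hM l))// ltW.
Qed.

Lemma q_linear a g h x : bm (g : T -> R) -> bm (h : T -> R) ->
  q (fun l => a * g l + h l) x = a * q g x + q h x.
Proof.
move=> bg bh.
have i1 : (spectral_measure P x).-integrable setT (EFin \o (fun l => a * g l)).
  by apply: (@bm_integrable (fun l => a * g l)); exact: bmZ.
have e := @RintegralD _ _ _ (spectral_measure P x) setT (fun l => a * g l) h measurableT i1
  (bm_integrable x bh).
apply: (etrans e); congr (_ + _).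
by apply: RintegralZl => //; exact: bm_integrable.
Qed.

Lemma qD g h x : bm (g : T -> R) -> bm (h : T -> R) ->
  q (fun l => g l + h l) x = q g x + q h x.
Proof.
move=> bg bh; rewrite -(mul1r (q g x)) -q_linear//; congr q.
by apply/funext => l; rewrite mul1r.
Qed.

Lemma qB g h x : bm (g : T -> R) -> bm (h : T -> R) ->
  q (fun l => g l - h l) x = q g x - q h x.
Proof.
move=> bg bh; rewrite addrC -mulN1r -q_linear//; congr q.
by apply/funext => l; rewrite mulN1r addrC.
Qed.

Lemma q_indic E x : measurable E -> q (\1_E) x = sqn (P E x).
Proof.
move=> mE; rewrite /q /Rintegral (integral_indic _ measurableT)// setIT.
exact: (congr1 fine (spectral_measure_sqn x E)).
Qed.

Lemma q_cst c x : q (cst c) x = c * sqn x.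
Proof. by rewrite /q Rintegral_cst// [X in fine X](spectral_measureT x). Qed.

Lemma q_le g h x : bm (g : T -> R) -> bm (h : T -> R) ->
  (forall l, g l <= h l) -> q g x <= q h x.
Proof.
move=> bg bh gh; apply: le_Rintegral => //; exact: bm_integrable.
Qed.

Lemma q_bound h x c : bm (h : T -> R) -> (forall l, `|h l| <= c) ->
  `|q h x| <= c * sqn x.
Proof.
move=> bh hc; rewrite ler_norml -mulNr -!q_cst.
by apply/andP; split; apply: q_le => //; try exact: bm_cst;
  move=> l; have := hc l; rewrite ler_norml => /andP[].
Qed.

(** The diagonal determines the operator by [op_eq_diag], so identities in the calculus reduce to
    identities of real integrals. *)
Definition represents (S : bounded_op H) h := forall x, inner x (S x) = (q h x)%:C.

Lemma represents_indic E : measurable E -> represents (P E) (\1_E).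
Proof. by move=> mE x; rewrite pvm_rip// q_indic. Qed.

(** Indicators give the projections. For a uniform limit, [numerical_radius] applied to [S n - S m]
    makes the operators Cauchy on every vector. *)
Lemma ex_represents h : bm (h : T -> R) -> exists S, represents S h.
Proof.
move: h; apply: (@bm_ind R _ T (fun h => exists S, represents S h))
  => [E mE|a g h bg bh [S hS] [S' hS']|h_ h bh_ bh].
- by exists (P E); exact: represents_indic.
- exists (opD (opZ a%:C S) S') => x.
  by rewrite opDE opZE innerDr innerZr hS hS' q_linear// rmorphD rmorphM.
move=> /choice[S hS] hh.
have qlim x : (fun n => q (h_ n) x) @ \oo --> q h x.
  have lim0 : (fun n => 2^-1 ^+ n * sqn x : R) @ \oo --> (0 : R).
    rewrite [X in _ --> X](_ : 0 = 0 * sqn x); last by rewrite mul0r.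
    apply: cvgMl; apply: cvg_expr.
    by rewrite ger0_norm ?invr_ge0// invf_lt1// ltr1n.
  apply/cvgrPdist_le => e e0; have /cvgrPdist_le/(_ _ e0) := lim0.
  apply: filterS => n; rewrite sub0r normrN => hn; apply: le_trans (le_trans (ler_norm _) hn).
  by rewrite -qB//; apply: q_bound => //; exact: bmB.
have Sdiff n m x : sqn (S n x - S m x) <= 4 * (2^-1 ^+ n + 2^-1 ^+ m) ^+ 2 * sqn x.
  have hr z : inner z (opD (S n) (opZ (-1) (S m)) z) = (q (fun l => h_ n l - h_ m l) z)%:C.
    rewrite opDE opZE innerDr innerZr (hS n) (hS m) qB//.
    by rewrite rmorphB mulN1r.
  have := numerical_radius _ hr _ x.
  rewrite opDE opZE scaleN1r; apply; first by rewrite addr_ge0// exprn_ge0// invr_ge0.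
  move=> z; apply: q_bound; first exact: bmB.
  move=> l; have -> : h_ n l - h_ m l = (h l - h_ m l) - (h l - h_ n l) by ring.
  by rewrite (le_trans (ler_normB _ _))// addrC lerD.
have /choice[f hf] : forall x, exists y, hcvg (fun n => S n x) y.
  move=> x; apply: hcvg_complete => e e0.
  have lim0 : (fun n => 2^-1 ^+ n : R) @ \oo --> (0 : R).
    by apply: cvg_expr; rewrite ger0_norm ?invr_ge0// invf_lt1// ltr1n.
  have s1 : 0 < 16 * (sqn x + 1) by rewrite mulr_gt0// ltr_wpDl ?sqn_ge0.
  (* When 2^-n and 2^-N are below d <= 1, [Sdiff] gives at most 4 (2 d)^2 |x|^2 <= 16 d |x|^2, which
     is below e. *)
  pose d := Num.min 1 (e / (16 * (sqn x + 1))).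
  have d0 : 0 < d by rewrite lt_min ltr01 divr_gt0.
  have /cvgrPdist_lt/(_ _ d0)[N _ hN] := lim0.
  exists N => n Nn; apply: le_lt_trans (Sdiff _ _ _) _.
  have p0 k : 0 <= 2^-1 ^+ k :> R by rewrite exprn_ge0// invr_ge0.
  have := hN _ Nn; have := hN _ (leqnn N); rewrite /= !sub0r !normrN !ger0_norm//.
  move: (p0 N) (p0 n); move: (2^-1 ^+ N) (2^-1 ^+ n) => u v u0 v0 ud vd.
  have d1 : d <= 1 by rewrite ge_min lexx.
  have de : d * (16 * (sqn x + 1)) <= e.
    by rewrite -ler_pdivlMr// ge_min lexx orbT.
  have sx := sqn_ge0 x.
  have h1 : (v + u) ^+ 2 <= 4 * d by nra.
  apply: (@le_lt_trans _ _ (16 * d * sqn x)); first by nra.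
  by apply: lt_le_trans de; nra.
have lf : lin f.
  move=> a x y; apply: (hcvg_unique (hf _)).
  under eq_fun do rewrite op_lin.
  by apply: hcvgD => //; exact: hcvgZ.
have [|U hU] := @ex_mkop _ _ f.
  split=> //; have [c c0 hc] := op_bound (S 0%N).
  (* 16 = 4 (1 + 1)^2 bounds [Sdiff] at the indices n and 0, and [c] is the bound of [S 0]. *)
  exists (2 * (16 + c)) => x.
  have -> : f x = (f x - S 0%N x) + S 0%N x by rewrite subrK.
  apply: le_trans (sqnD_le _ _) _; rewrite -mulrA ler_pM2l// mulrDl lerD//.
  have h1 := hcvg_sqn (hcvgB (hf x) (hcvg_cst (S 0%N x))).
  apply: (ler_cvg_to h1 (cvg_cst (16 * sqn x))); apply: nearW => n.
  apply: le_trans (Sdiff _ _ _) _; rewrite expr0 ler_wpM2r ?sqn_ge0//.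
  have : 0 <= 2^-1 ^+ n :> R by rewrite exprn_ge0// invr_ge0.
  have : 2^-1 ^+ n <= 1 :> R by rewrite exprn_ile1 ?invr_ge0// invf_le1// ler1n.
  by move: (2^-1 ^+ n) => u ? ?; nra.
exists U => x; rewrite hU; apply: complex_ext => /=.
  have h1 := hcvg_rip (hcvg_cst x) (hf x).
  have e : (fun n => rip x (S n x)) = fun n => q (h_ n) x.
    by apply/funext => n; rewrite /rip hS.
  by rewrite e in h1; exact: (cvg_unique _ h1 (qlim x)).
rewrite Im_inner.
have h1 := hcvg_rip (hcvg_cst ('i *: x)) (hf x).
have e : (fun n => rip ('i *: x) (S n x)) = cst 0.
  by apply/funext => n; rewrite -Im_inner hS.
by rewrite e in h1; exact: (cvg_unique _ h1 (cvg_cst 0)).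
Qed.

(* \int h dP; it is 0 unless [h] is bounded and measurable *)
Definition op_of h : bounded_op H :=
  if pselect (exists S, represents S h) is left e then sval (cid e) else op0.

Lemma op_ofP h : bm (h : T -> R) -> represents (op_of h) h.
Proof.
move=> bh; rewrite /op_of; case: pselect => [e|[]]; last exact: ex_represents.
exact: (svalP (cid e)).
Qed.

Lemma represents_op_of h S : bm (h : T -> R) -> represents S h -> forall x, op_of h x = S x.
Proof. by move=> bh hS; apply: op_eq_diag => x; rewrite hS op_ofP. Qed.

Lemma op_of_indic E x : measurable E -> op_of (\1_E) x = P E x.
Proof.
by move=> mE; apply: represents_op_of; [exact: bm_indic|exact: represents_indic].
Qed.

Lemma op_of_linear a g h x : bm (g : T -> R) -> bm (h : T -> R) ->
  op_of (fun l => a * g l + h l) x = a%:C *: op_of g x + op_of h x.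
Proof.
move=> bg bh; rewrite -opZE -opDE; apply: represents_op_of.
  by apply: bmD => //; exact: bmZ.
by move=> y; rewrite opDE opZE innerDr innerZr !op_ofP// q_linear// rmorphD rmorphM.
Qed.

Lemma op_of_selfadj h x y : bm (h : T -> R) -> inner (op_of h x) y = inner x (op_of h y).
Proof. by move=> bh; apply: selfadj_real => z; rewrite op_ofP. Qed.

Lemma op_of_lim (h_ : nat -> R -> R) h (M : R) :
  (forall n, bm (h_ n : T -> R)) -> bm (h : T -> R) ->
  (forall n l, `|h l - h_ n l| <= M * 2^-1 ^+ n) ->
  forall x, hcvg (fun n => op_of (h_ n) x) (op_of h x).
Proof.
move=> bh_ bh hh x.
have p0 k : 0 <= 2^-1 ^+ k :> R by rewrite exprn_ge0// invr_ge0.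
have M0 : 0 <= M by have := le_trans (normr_ge0 _) (hh 0%N 0); rewrite expr0 mulr1.
apply: (@hcvg_le _ _ _ _ (fun n => (4 * M ^+ 2 * sqn x) * 2^-1 ^+ n)).
  rewrite [X in _ --> X](_ : 0 = 4 * M ^+ 2 * sqn x * 0); last by rewrite mulr0.
  by apply: cvgMr; apply: cvg_expr; rewrite ger0_norm ?invr_ge0// invf_lt1// ltr1n.
move=> n; rewrite sqnBC.
have hr z : inner z (opD (op_of h) (opZ (-1) (op_of (h_ n))) z) =
    (q (fun l => h l - h_ n l) z)%:C.
  by rewrite opDE opZE innerDr innerZr !op_ofP// qB// rmorphB mulN1r.
have := numerical_radius (mulr_ge0 M0 (p0 n)) hr _ x; rewrite opDE opZE scaleN1r => h1.
apply: le_trans (h1 _) _; first by move=> z; apply: q_bound => //; exact: bmB.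
have p1 : 2^-1 ^+ n <= 1 :> R by rewrite exprn_ile1 ?invr_ge0// invf_le1// ler1n.
have := sqn_ge0 x; move: (2^-1 ^+ n) (p0 n) p1 => v v0 v1 s0.
have : v ^+ 2 <= v by nra.
have : 0 <= M ^+ 2 * sqn x by rewrite mulr_ge0 ?sqr_ge0.
rewrite exprMn; nra.
Qed.

(** The measure of P(F) x vanishes on the complement of F, since F already carries its total mass by
    idempotence. Multiplicativity of P is thus a consequence of additivity. *)
Lemma pvm_disjoint E F x : measurable E -> measurable F -> E `&` F = set0 ->
  P E (P F x) = 0.
Proof.
move=> mE mF EF; apply: sqn_eq0; apply/eqP; rewrite eq_le sqn_ge0 andbT.
have mCF : measurable (~` F) by exact: measurableC.
have h1 : (spectral_measure P (P F x) E <= spectral_measure P (P F x) (~` F))%E.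
  by apply: le_measure; rewrite ?inE//; exact/disjoints_subset.
have h2 : (spectral_measure P (P F x) F + spectral_measure P (P F x) (~` F) =
    spectral_measure P (P F x) setT)%E.
  by rewrite -(setUv F) measureU// setICr.
move: h1 h2; rewrite spectral_measureT !spectral_measure_sqn lee_fin pvm_idem//.
move=> h1; rewrite -EFinD => -[] h2.
by apply: le_trans h1 _; lra.
Qed.

Lemma pvmU E F x : measurable E -> measurable F -> E `&` F = set0 ->
  P (E `|` F) x = P E x + P F x.
Proof.
move=> mE mF EF; rewrite -opDE; move: x; apply: op_eq_diag => x.
have mU : measurable (E `|` F) by exact: measurableU.
rewrite opDE innerDr !pvm_rip// -rmorphD; congr (_%:C).
have : spectral_measure P x (E `|` F) = (spectral_measure P x E + spectral_measure P x F)%E.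
  by rewrite measureU.
by rewrite !spectral_measure_sqn -EFinD => -[].
Qed.

Lemma pvmI E F x : measurable E -> measurable F -> P E (P F x) = P (E `&` F) x.
Proof.
move=> mE mF.
have mI : measurable (E `&` F) by exact: measurableI.
have mEF : measurable (E `\` F) by exact: measurableD.
have mFE : measurable (F `\` E) by exact: measurableD.
have eE : E = (E `&` F) `|` (E `\` F) by rewrite setUIDK.
have eF : F = (E `&` F) `|` (F `\` E) by rewrite setIC setUIDK.
have d0 : E `&` F `&` (E `\` F) = set0.
  by apply/seteqP; split => l //= [[? ?] [? ?]].
transitivity (P (E `&` F `|` E `\` F) (P (E `&` F `|` F `\` E) x)).
  by rewrite -eE -eF.
rewrite pvmU//.
have d1 : E `&` F `&` (F `\` E) = set0.
  by apply/seteqP; split => l //= [[? ?] [? ?]].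
rewrite pvmU// (linD (@op_lin _ _ (P (E `&` F)))) (linD (@op_lin _ _ (P (E `\` F)))).
rewrite pvm_idem// !pvm_disjoint// ?addr0//; apply/seteqP; split=> l //=.
- by move=> [[? ?] [? ?]].
- by move=> [[? ?] [? ?]].
Qed.


(** Two nested inductions, on [h] for fixed [g] and then on [g] for an indicator [h], end at
    [pvmI]. *)
Lemma op_ofM h g x : bm (h : T -> R) -> bm (g : T -> R) ->
  op_of h (op_of g x) = op_of (fun l => h l * g l) x.
Proof.
have limM (h_ : nat -> R -> R) u k y : (forall n, bm (h_ n : T -> R)) -> bm (u : T -> R) ->
    bm (k : T -> R) -> (forall n l, `|u l - h_ n l| <= 2^-1 ^+ n) ->
    hcvg (fun n => op_of (fun l => h_ n l * k l) y) (op_of (fun l => u l * k l) y).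
  move=> bh_ bu bk hc; have [_ [M hM]] := bk.
  apply: (@op_of_lim _ _ M) => [n||n l]; try exact: bmM.
  by rewrite -mulrBl normrM mulrC ler_pM.
have limT (h_ : nat -> R -> R) u y : (forall n, bm (h_ n : T -> R)) -> bm (u : T -> R) ->
    (forall n l, `|u l - h_ n l| <= 2^-1 ^+ n) ->
    hcvg (fun n => op_of (h_ n) y) (op_of u y).
  by move=> bh_ bu hc; apply: (@op_of_lim _ _ 1) => // n l; rewrite mul1r.
move=> bh bg; move: h bh x.
apply: (@bm_ind R _ T (fun h => forall x, op_of h (op_of g x) = op_of (fun l => h l * g l) x)) => [E mE x|a u v bu bv hu hv x|h_ u bh_ bu hh hc x]; last 2 first.
- rewrite op_of_linear// hu hv -op_of_linear; try exact: bmM.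
  by congr (op_of _ _); apply/funext => l; rewrite mulrDl mulrA.
- apply: (hcvg_unique (limT _ _ _ bh_ bu hc)).
  by under eq_fun do rewrite hh; exact: limM.
have bE := @bm_indic R _ T E mE.
rewrite op_of_indic//.
have -> : op_of (fun l => \1_E l * g l) x = op_of (fun l => g l * \1_E l) x.
  by congr (op_of _ _); apply/funext => l; rewrite mulrC.
move: g bg x.
apply: (@bm_ind R _ T (fun g => forall x, P E (op_of g x) = op_of (fun l => g l * \1_E l) x)) => [F mF x|a u v bu bv hu hv x|h_ u bh_ bu hh hc x].
- rewrite op_of_indic// pvmI// -op_of_indic; last exact: measurableI.
  by congr (op_of _ _); rewrite setIC indicI.
- rewrite op_of_linear// op_lin hu hv -op_of_linear; try exact: bmM.
  by congr (op_of _ _); apply/funext => l; rewrite mulrDl mulrA.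
- apply: (hcvg_unique (op_hcvg (P E) (limT _ _ _ bh_ bu hc))).
  by under eq_fun do rewrite hh; exact: limM.
Qed.

End BoundedCalculus.

(* Locked, like [window] below: deciding by unfolding that two such operators differ
   is very slow. *)
HB.lock Definition cop (R : realType) (H : hilbertType R) (P : pvm H) (g : R -> R[i]) :
    bounded_op H :=
  opD (op_of P (fun l => Re (g l))) (opZ (0 +i* 1) (op_of P (fun l => Im (g l)))).

Section ComplexCalculus.
Context {R : realType} {H : hilbertType R} (P : pvm H).
Local Notation T := (measurableTypeR R).
Implicit Types (x y z : H) (E F : set T) (g h : R -> R[i]).

Definition cbm g := bm ((fun l => Re (g l)) : T -> R) /\ bm ((fun l => Im (g l)) : T -> R).

Lemma copE g x : cop P g x =
  op_of P (fun l => Re (g l)) x + (0 +i* 1) *: op_of P (fun l => Im (g l)) x.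
Proof. by rewrite cop.unlock opDE opZE. Qed.

Lemma cop_diag g z : cbm g -> inner z (cop P g z) = cintegral (spectral_measure P z) g.
Proof.
move=> [br bi]; rewrite copE innerDr innerZr !op_ofP//.
by apply: complex_ext; rewrite !ReImE /= /q; ring.
Qed.

Lemma cbm_abs2 g : cbm g -> bm ((fun l => abs2 (g l)) : T -> R).
Proof. by move=> [br bi]; apply: bmD; apply: bmM. Qed.

Lemma cbmB g h : cbm g -> cbm h -> cbm (fun l => g l - h l).
Proof.
move=> [br bi] [br' bi']; split.
  under eq_fun do rewrite ReD ReN; exact: bmB.
under eq_fun do rewrite ImD ImN; exact: bmB.
Qed.

Lemma cbmJ g : cbm g -> cbm (fun l => conjc (g l)).
Proof.
move=> [br bi]; split; first by under eq_fun do rewrite ReJ.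
by under eq_fun do rewrite ImJ; exact: bmN.
Qed.

Lemma copB g h x : cbm g -> cbm h -> cop P (fun l => g l - h l) x = cop P g x - cop P h x.
Proof.
move=> bg bh; have bgh := cbmB bg bh.
have opB a b : bm (a : T -> R) -> bm (b : T -> R) ->
    op_of P (fun l => a l - b l) x = op_of P a x - op_of P b x.
  move=> ba bb; rewrite [RHS]addrC -scaleN1r -[-1](rmorphN1 (real_complex R)) -op_of_linear//.
  by congr (op_of P _ _); apply/funext => l; rewrite mulN1r addrC.
move: bg bh => [br bi] [br' bi']; rewrite !copE.
have -> : op_of P (fun l => Re (g l - h l)) x =
    op_of P (fun l => Re (g l)) x - op_of P (fun l => Re (h l)) x.
  by rewrite -opB//; congr (op_of P _ _); apply/funext => l; rewrite ReD ReN.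
have -> : op_of P (fun l => Im (g l - h l)) x =
    op_of P (fun l => Im (g l)) x - op_of P (fun l => Im (h l)) x.
  by rewrite -opB//; congr (op_of P _ _); apply/funext => l; rewrite ImD ImN.
by rewrite scalerBr opprD addrACA.
Qed.

Lemma cop_adj g x y : cbm g -> inner (cop P g x) y = inner x (cop P (fun l => conjc (g l)) y).
Proof.
move=> [br bi]; rewrite !copE.
have -> : op_of P (fun l => Re (conjc (g l))) y = op_of P (fun l => Re (g l)) y.
  by congr (op_of P _ _); apply/funext => l; rewrite ReJ.
have -> : op_of P (fun l => Im (conjc (g l))) y = - op_of P (fun l => Im (g l)) y.
  have b0 := @bm_cst R _ T 0.
  have h : represents P op0 (cst 0) by move=> z; rewrite op0E inner0r q_cst mul0r.
  rewrite -scaleN1r -[-1](rmorphN1 (real_complex R)) -[RHS]addr0.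
  rewrite -[X in _ + X](op0E y) -(represents_op_of b0 h) -op_of_linear//.
  by congr (op_of P _ _); apply/funext => l; rewrite ImJ mulN1r addr0.
rewrite innerDl innerDr innerZl innerZr innerNr -!op_of_selfadj//.
by congr (_ + _); apply: complex_ext; rewrite !ReImE /=; ring.
Qed.

Lemma sqn_cop g x : cbm g -> sqn (cop P g x) = q P (fun l => abs2 (g l)) x.
Proof.
move=> bg; have [br bi] := bg.
rewrite /sqn copE !innerDl !innerDr !innerZl !innerZr !op_of_selfadj// !op_ofM//.
have -> : (fun l => Im (g l) * Re (g l)) = fun l => Re (g l) * Im (g l).
  by apply/funext => l; rewrite mulrC.
have b1 := bmM br br; have b2 := bmM bi bi; have b3 := bmM br bi.
rewrite !op_ofP// !ReImE /= /abs2.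
rewrite [RHS](_ : _ = q P (fun l => Re (g l) * Re (g l) + Im (g l) * Im (g l)) x)//.
by rewrite qD//; ring.
Qed.

Lemma cop_pvm g E x : measurable E -> cbm g ->
  cop P g (P E x) = cop P (fun l => (\1_E l)%:C * g l) x.
Proof.
move=> mE [br bi]; have bE := @bm_indic R _ T E mE.
rewrite !copE -!op_of_indic// !op_ofM//; congr (op_of P _ _ + _ *: op_of P _ _).
  by apply/funext => l; rewrite ReM /= mul0r subr0 mulrC.
by apply/funext => l; rewrite ImM /= mul0r addr0 mulrC.
Qed.

Lemma pvm_cop g E x : measurable E -> cbm g ->
  P E (cop P g x) = cop P (fun l => (\1_E l)%:C * g l) x.
Proof.
move=> mE [br bi]; have bE := @bm_indic R _ T E mE.
rewrite !copE (linD (@op_lin _ _ (P E))) (linZ (@op_lin _ _ (P E))).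
rewrite -!op_of_indic// !op_ofM//; congr (op_of P _ _ + _ *: op_of P _ _).
  by apply/funext => l; rewrite ReM /= mul0r subr0.
by apply/funext => l; rewrite ImM /= mul0r addr0.
Qed.

End ComplexCalculus.

HB.lock Definition window (R : realType) (m : nat) : set (measurableTypeR R) :=
  `[- m%:R, m%:R]%classic.

Lemma windowE (R : realType) (m : nat) (l : R) : (window m : set (measurableTypeR R)) l = (- m%:R <= l <= m%:R).
Proof. by rewrite window.unlock /= in_itv. Qed.

(** * Unbounded functions of a self-adjoint operator, by truncation to windows *)

Section UnboundedCalculus.
Context {R : realType} {H : hilbertType R} (P : pvm H).
Local Notation T := (measurableTypeR R).
Local Notation wnd := (@window R).
Implicit Types (x y z : H) (g h : R -> R[i]) (m n : nat).

Lemma measurable_window m : measurable (wnd m).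
Proof. by rewrite window.unlock; exact: measurable_itv. Qed.

Lemma windowS m n : (m <= n)%N -> wnd m `<=` wnd n.
Proof.
move=> mn l; rewrite !windowE => /andP[h1 h2].
have : (m%:R : R) <= n%:R by rewrite ler_nat.
by move=> mn'; apply/andP; split; lra.
Qed.

Lemma window_indicM m n l : (m <= n)%N -> \1_(wnd m) l * \1_(wnd n) l = \1_(wnd m) l :> R.
Proof.
move=> mn; rewrite !indicE; case: (boolP (l \in wnd m)); rewrite ?mul0r// mul1r => hl.
by rewrite (_ : l \in wnd n)//; move: hl; rewrite !inE; exact: windowS.
Qed.

Lemma bigcup_window : \bigcup_m wnd m = setT.
Proof.
apply/seteqP; split=> // l _; exists (Num.truncn `|l|).+1 => //=.
rewrite windowE -ler_norml; exact/ltW/truncnS_gt.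
Qed.

(** Locally bounded measurable functions: every truncation to a window falls under the bounded
    calculus. *)
Definition lbm g :=
  [/\ measurable_fun setT ((fun l => Re (g l)) : T -> R),
      measurable_fun setT ((fun l => Im (g l)) : T -> R) &
      forall m, exists M, forall l, wnd m l -> `|Re (g l)| <= M /\ `|Im (g l)| <= M].

Lemma lbmJ g : lbm g -> lbm (fun l => conjc (g l)).
Proof.
move=> [mr mi b]; split; first by under eq_fun do rewrite ReJ.
  by under eq_fun do rewrite ImJ; exact: measurable_funN.
by move=> m; have [M hM] := b m; exists M => l /hM; rewrite ReJ ImJ normrN.
Qed.

Definition win m g : R -> R[i] := fun l => (\1_(wnd m) l)%:C * g l.

Lemma win_cbm m g : lbm g -> cbm (win m g).
Proof.
move=> [mr mi /(_ m)[M hM]]; have mE := measurable_window m; rewrite /win; split.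
  under eq_fun do rewrite ReM /= mul0r subr0.
  split; first by apply: measurable_funM => //; exact: measurable_indic.
  exists `|M| => l; rewrite indicE; case: (boolP (l \in _)); rewrite ?mul0r ?normr0// mul1r.
  by rewrite inE => /hM[h _]; rewrite (le_trans h)// ler_norm.
under eq_fun do rewrite ImM /= mul0r addr0.
split; first by apply: measurable_funM => //; exact: measurable_indic.
exists `|M| => l; rewrite indicE; case: (boolP (l \in _)); rewrite ?mul0r ?normr0// mul1r.
by rewrite inE => /hM[_ h]; rewrite (le_trans h)// ler_norm.
Qed.

Lemma win_win m n g : (m <= n)%N -> (fun l => (\1_(wnd m) l)%:C * win n g l) = win m g.
Proof.
by move=> mn; apply/funext => l; rewrite /win mulrA -rmorphM /= window_indicM.
Qed.

Lemma winJ m g : (fun l => conjc (win m g l)) = win m (fun l => conjc (g l)).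
Proof. by apply/funext => l; apply: complex_ext; rewrite /win !ReImE /=; ring. Qed.

Definition cowin g m := cop P (win m g).

Lemma cowinE g m : cowin g m = cop P (win m g).
Proof. by []. Qed.

Lemma pvm_cowin g m n x : lbm g -> (m <= n)%N -> P (wnd m) (cowin g n x) = cowin g m x.
Proof.
move=> lg mn; rewrite !cowinE.
exact: (etrans (pvm_cop P x (measurable_window m) (win_cbm n lg))
  (congr1 (fun h => cop P h x) (win_win g mn))).
Qed.

Lemma cowin_pvm g m n x : lbm g -> (m <= n)%N -> cowin g n (P (wnd m) x) = cowin g m x.
Proof.
move=> lg mn; rewrite !cowinE.
exact: (etrans (cop_pvm P x (measurable_window m) (win_cbm n lg))
  (congr1 (fun h => cop P h x) (win_win g mn))).
Qed.

Lemma sqn_cowin g m x : lbm g -> (sqn (cowin g m x))%:E =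
  (\int[spectral_measure P x]_(l in wnd m) (abs2 (g l))%:E)%E.
Proof.
move=> lg; have bw := win_cbm m lg; rewrite !cowinE (sqn_cop P x bw).
have fin := integrable_fin_num measurableT (bm_integrable P x (cbm_abs2 bw)).
rewrite /q /Rintegral fineK// [RHS]integral_mkcond.
apply: eq_integral => l _ /=; rewrite patchE /win abs2M indicE.
by case: ifP => _; rewrite /abs2 /= ?expr1n expr0n addr0 ?mul1r ?mul0r.
Qed.

Lemma measurable_abs2 g : lbm g -> measurable_fun setT ((fun l => abs2 (g l)) : T -> R).
Proof. by move=> [mr mi _]; apply: measurable_funD; apply: measurable_funM. Qed.

Lemma cowin_cvg_integral g x : lbm g ->
  (fun m => (sqn (cowin g m x))%:E) @ \oo -->
  (\int[spectral_measure P x]_l (abs2 (g l))%:E)%E.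
Proof.
move=> lg; under eq_fun do rewrite sqn_cowin//.
rewrite -bigcup_window; apply: ge0_nondecreasing_set_cvg_integral.
- by move=> m n mn; apply/subsetPset; exact: windowS.
- exact: measurable_window.
- move=> m; apply/measurable_EFinP; apply: measurable_funTS; exact: measurable_abs2.
- by move=> m l _; rewrite lee_fin abs2_ge0.
Qed.

Lemma sqn_cowin_diff g m n x : lbm g -> (m <= n)%N ->
  sqn (cowin g n x - cowin g m x) = sqn (cowin g n x) - sqn (cowin g m x).
Proof.
move=> lg mn; have := pvm_cowin x lg mn.
move: (cowin g n x) (cowin g m x) => u v <-.
by rewrite sqnB /rip (pvm_rip P u (measurable_window m)) /=; ring.
Qed.

Lemma sqn_cowin_mono g m n x : lbm g -> (m <= n)%N -> sqn (cowin g m x) <= sqn (cowin g n x).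
Proof. by move=> lg mn; rewrite -subr_ge0 -sqn_cowin_diff// sqn_ge0. Qed.

(** By Pythagoras ([sqn_cowin_diff]) squared increments are differences of squared norms, and these
    form a bounded increasing sequence. *)
Lemma cowin_bounded_cvg g x (K : R) : lbm g -> (forall m, sqn (cowin g m x) <= K) ->
  exists z, hcvg (fun m => cowin g m x) z.
Proof.
move=> lg hK; apply: hcvg_complete => e e0.
have : cvgn (fun m => sqn (cowin g m x)).
  apply: nondecreasing_is_cvgn; first by move=> m n mn; exact: sqn_cowin_mono.
  by exists K => _ [m _ <-]; exact: hK.
move=> /cvg_ex[c hc].
have e2 : 0 < e / 2 by rewrite divr_gt0.
have /cvgrPdist_lt/(_ _ e2)[N _ hN] := hc; exists N => n Nn.
rewrite sqn_cowin_diff//; have := hN n Nn; have := hN N (leqnn N) => /=.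
move: (sqn (cowin g n x)) (sqn (cowin g N x)) => a b.
by rewrite !ltr_norml => /andP[? ?] /andP[? ?]; lra.
Qed.

(** By monotone convergence the integral of |g|^2 is the limit of the squared norms of the
    truncations. In this form the domain is visibly a subspace. *)
Lemma calculus_domainP g x : lbm g ->
  calculus_domain P g x <-> exists z, hcvg (fun m => cowin g m x) z.
Proof.
move=> lg; have h := @cowin_cvg_integral g x lg; rewrite /calculus_domain /=.
have i0 : (0 <= \int[spectral_measure P x]_l (abs2 (g l))%:E)%E.
  by apply: integral_ge0 => l _; rewrite lee_fin abs2_ge0.
split=> [fin|[z hz]].
  have finn : (\int[spectral_measure P x]_l (abs2 (g l))%:E)%E \is a fin_num.
    by rewrite ge0_fin_numE.
  apply: (@cowin_bounded_cvg _ _ (fine (\int[spectral_measure P x]_l (abs2 (g l))%:E)%E)) => // m.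
  rewrite -lee_fin fineK// sqn_cowin//; apply: ge0_subset_integral => //.
  - exact: measurable_window.
  - by apply/measurable_EFinP; exact: measurable_abs2.
  - by move=> l _; rewrite lee_fin abs2_ge0.
have h2 : (fun m => (sqn (cowin g m x))%:E) @ \oo --> (sqn z)%:E.
  by apply: cvg_EFin; [exact: nearW|exact: hcvg_sqn].
apply: (le_lt_trans _ (ltry (sqn z))).
by rewrite le_eqVlt; apply/orP; left; apply/eqP; exact: (cvg_unique _ h h2).
Qed.

(* the value of \int g dP at x, and 0 outside of the domain of this operator *)
Definition wop g x : H :=
  if pselect (exists z, hcvg (fun m => cowin g m x) z) is left e then sval (cid e) else 0.

Lemma wopP g x : lbm g -> calculus_domain P g x -> hcvg (fun m => cowin g m x) (wop g x).
Proof.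
move=> lg /(calculus_domainP _ lg) e; rewrite /wop; case: pselect => // e'.
exact: (svalP (cid e')).
Qed.

Lemma wop_out g x : lbm g -> ~ calculus_domain P g x -> wop g x = 0.
Proof.
move=> lg nd; rewrite /wop; case: pselect => // e.
by exfalso; apply: nd; apply/(calculus_domainP _ lg).
Qed.

Lemma wop_eq g x z : lbm g -> hcvg (fun m => cowin g m x) z -> wop g x = z.
Proof.
move=> lg hz; refine (hcvg_unique (wopP lg _) hz).
by apply/calculus_domainP => //; exists z.
Qed.

Lemma sqn_wop g x : lbm g -> calculus_domain P g x ->
  (sqn (wop g x))%:E = (\int[spectral_measure P x]_l (abs2 (g l))%:E)%E.
Proof.
move=> lg dx; have h := @cowin_cvg_integral g x lg.
have h2 : (fun m => (sqn (cowin g m x))%:E) @ \oo --> (sqn (wop g x))%:E.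
  by apply: cvg_EFin; [exact: nearW|exact: hcvg_sqn (wopP lg dx)].
exact: (cvg_unique _ h2 h).
Qed.

Lemma calculus_domain_lin g a x y : lbm g -> calculus_domain P g x -> calculus_domain P g y ->
  calculus_domain P g (a *: x + y) /\ wop g (a *: x + y) = a *: wop g x + wop g y.
Proof.
move=> lg dx dy.
have h : hcvg (fun m => cowin g m (a *: x + y)) (a *: wop g x + wop g y).
  under eq_fun do rewrite op_lin.
  by apply: hcvgD; [apply: hcvgZ|]; exact: wopP.
split; last exact: wop_eq.
by apply/calculus_domainP => //; eexists; exact: h.
Qed.

Lemma wop_window g m x : lbm g ->
  calculus_domain P g (P (wnd m) x) /\ wop g (P (wnd m) x) = cowin g m x.
Proof.
move=> lg; have h : hcvg (fun n => cowin g n (P (wnd m) x)) (cowin g m x).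
  apply/hcvgP => e e0; exists m => // n mn /=.
  by rewrite cowin_pvm// subrr sqn0.
split; last exact: wop_eq.
by apply/calculus_domainP => //; eexists; exact: h.
Qed.

Lemma pvm_window_cvg x : hcvg (fun m => P (wnd m) x) x.
Proof.
have h : (fun m => spectral_measure P x (wnd m)) @ \oo -->
    spectral_measure P x (\bigcup_m wnd m).
  apply: nondecreasing_cvg_mu; first by move=> m; exact: measurable_window.
    by rewrite bigcup_window.
  by move=> m n mn; apply/subsetPset; exact: windowS.
move: h; rewrite bigcup_window spectral_measureT => /fine_cvgP[_ h].
have e : fine \o (fun m => spectral_measure P x (wnd m)) = fun m => sqn (P (wnd m) x).
  by apply/funext => m; exact: (congr1 fine (spectral_measure_sqn P x (wnd m))).
rewrite e in h.
rewrite /hcvg (_ : (fun _ => _) = fun m => sqn x - sqn (P (wnd m) x)).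
  by rewrite -(subrr (sqn x)); apply: cvgB => //; exact: cvg_cst.
by apply/funext => m; rewrite sqnB /rip innerC ReJ (pvm_rip P x (measurable_window m)) /=; ring.
Qed.

(** The vectors P([-m, m]) z belong to the domain and tend to z. *)
Lemma calculus_domain_dense g u v : lbm g ->
  (forall x, calculus_domain P g x -> inner x u = inner x v) -> u = v.
Proof.
move=> lg h; apply: rip_ext => z.
have h1 := hcvg_rip (pvm_window_cvg z) (hcvg_cst u).
have h2 := hcvg_rip (pvm_window_cvg z) (hcvg_cst v).
have e : (fun m => rip (P (wnd m) z) u) = fun m => rip (P (wnd m) z) v.
  by apply/funext => m; rewrite /rip h//; case: (wop_window m z lg).
by rewrite e in h1; exact: (cvg_unique _ h1 h2).
Qed.

Lemma cintegral_wop g z : lbm g -> calculus_domain P g z ->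
  cintegral (spectral_measure P z) g = inner z (wop g z).
Proof.
move=> lg dz; have [mr mi _] := lg.
(* 1 + |g|^2 dominates both parts of g and of its truncations; it is integrable because the spectral
   measure is finite and z is in the domain. *)
have ifin : (spectral_measure P z).-integrable setT (fun l => (1 + abs2 (g l))%:E).
  have i1 : (spectral_measure P z).-integrable setT (EFin \o cst 1).
    by apply: finite_measure_integrable_cst.
  have i2 : (spectral_measure P z).-integrable setT (fun l => (abs2 (g l))%:E).
    apply/integrableP; split; first by apply/measurable_EFinP; exact: measurable_abs2.
    apply: (le_lt_trans _ dz); rewrite le_eqVlt; apply/orP; left; apply/eqP.
    by apply: eq_integral => l _; rewrite gee0_abs// lee_fin abs2_ge0.
  exact: (integrableD measurableT i1 i2).
have key (part : R[i] -> R) :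
    measurable_fun setT ((fun l => part (g l)) : T -> R) ->
    (forall l, `|part (g l)| <= 1 + abs2 (g l)) ->
    (forall m l, part (win m g l) = \1_(wnd m) l * part (g l)) ->
    (fun m => \int[spectral_measure P z]_l part (win m g l)) @ \oo -->
    \int[spectral_measure P z]_l part (g l).
  move=> mf fb hw.
  have mm m : measurable_fun setT ((fun l => (part (win m g l))%:E) : T -> \bar R).
    apply/measurable_EFinP; under eq_fun do rewrite hw.
    by apply: measurable_funM => //; apply: measurable_indic; exact: measurable_window.
  have mf' : measurable_fun setT ((fun l => (part (g l))%:E) : T -> \bar R).
    exact/measurable_EFinP.
  have cv (l : T) : (fun m => (part (win m g l))%:E) @ \oo --> (part (g l))%:E.
    have : (\bigcup_m wnd m) l by rewrite bigcup_window.
    move=> [N _ lN]; apply: cvg_near_cst; exists N => // m /= Nm.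
    by rewrite hw indicE (_ : l \in wnd m) ?mul1r//; rewrite inE; exact: windowS lN.
  have dom (l : T) m : (`|(part (win m g l))%:E| <= (1 + abs2 (g l))%:E)%E.
    rewrite /= lee_fin hw indicE; case: (_ \in _); rewrite ?mul1r// mul0r normr0.
    by rewrite addr_ge0// abs2_ge0.
  have [i1 _ c1] := dominated_convergence measurableT mm mf'
    (aeW _ (fun l _ => cv l)) ifin (aeW _ (fun l m _ => dom l m)).
  by apply: fine_cvg; rewrite fineK ?integrable_fin_num.
have hw := wopP lg dz.
have e m : inner z (cowin g m z) = cintegral (spectral_measure P z) (win m g).
  by rewrite !cowinE cop_diag//; exact: win_cbm.
have abs2_ge (a b : R) : `|a| <= 1 + (a ^+ 2 + b ^+ 2).
  have := sqr_ge0 b; have := sqr_ge0 (`|a| - 1); rewrite -(real_normK (num_real a)).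
  by have := normr_ge0 a; move: `|a| => u; nra.
apply/esym/complex_ext.
  have h1 := hcvg_rip (hcvg_cst z) hw.
  have winRe m l : Re (win m g l) = \1_(wnd m) l * Re (g l).
    by rewrite /win ReM /= mul0r subr0.
  have h2 := key _ mr (fun l => abs2_ge _ _) winRe.
  have e1 : (fun m => rip z (cowin g m z)) =
      fun m => \int[spectral_measure P z]_l Re (win m g l).
    by apply/funext => m; rewrite /rip e.
  by rewrite e1 in h1; exact: (cvg_unique _ h1 h2).
rewrite Im_inner.
have h1 := hcvg_rip (hcvg_cst ('i *: z)) hw.
have e1 : (fun m => rip ('i *: z) (cowin g m z)) =
    fun m => \int[spectral_measure P z]_l Im (win m g l).
  by apply/funext => m; rewrite -Im_inner e.
have winIm m l : Im (win m g l) = \1_(wnd m) l * Im (g l).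
  by rewrite /win ImM /= mul0r addr0.
have gIm l : `|Im (g l)| <= 1 + abs2 (g l) by rewrite /abs2 (addrC (Re _ ^+ 2)) abs2_ge.
by rewrite e1 in h1; exact: (cvg_unique _ h1 (key _ mi gIm winIm)).
Qed.

Lemma sesqui_integral_wop g x y : lbm g -> calculus_domain P g x -> calculus_domain P g y ->
  sesqui_integral P g x y = inner x (wop g y).
Proof.
move=> lg dx dy; rewrite /sesqui_integral -(@polarization _ _ (wop g)).
  congr (_ * _); apply: eq_bigr => k _; congr (_ * _); apply: cintegral_wop => //.
  by rewrite addrC; case: (calculus_domain_lin ('i ^+ k) lg dy dx).
move=> t; rewrite addrC; case: (calculus_domain_lin t lg dy dx) => _ ->.
by rewrite addrC.
Qed.

Lemma functional_calculusP g u w : lbm g ->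
  functional_calculus P g (u, w) <-> calculus_domain P g u /\ w = wop g u.
Proof.
move=> lg; split=> [[/= du h]|[du ->]].
  split=> //; apply: (calculus_domain_dense lg) => x dx.
  by rewrite h// sesqui_integral_wop.
by split=> //= x dx; rewrite sesqui_integral_wop.
Qed.

Lemma calculus_domainJ g x : calculus_domain P (fun l => conjc (g l)) x = calculus_domain P g x.
Proof. by rewrite /calculus_domain /=; under eq_integral do rewrite abs2J. Qed.

(** The substantial inclusion is that the adjoint has no larger domain: testing (y, z) on vectors
    supported in a window identifies the truncation of conj(g) at y with P([-m, m]) z. The
    truncations are therefore bounded by |z|, which puts y in the domain. *)
Lemma op_adjointP g y z : lbm g ->
  op_adjoint (functional_calculus P g) (y, z) <->
  calculus_domain P g y /\ z = wop (fun l => conjc (g l)) y.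
Proof.
move=> lg; have lgJ := lbmJ lg.
have adj m u v : inner (cowin (fun l => conjc (g l)) m u) v = inner u (cowin g m v).
  rewrite !cowinE -winJ cop_adj; last by apply: cbmJ; exact: win_cbm.
  by congr (inner _ (cop P _ _)); apply/funext => l; rewrite conjcK.
have dual u : calculus_domain P g y -> calculus_domain P g u ->
    inner y (wop g u) = inner (wop (fun l => conjc (g l)) y) u.
  move=> dy du; rewrite -calculus_domainJ in dy.
  have r v : calculus_domain P g v -> rip y (wop g v) = rip (wop (fun l => conjc (g l)) y) v.
    move=> dv; have h1 := hcvg_rip (hcvg_cst y) (wopP lg dv).
    have h2 := hcvg_rip (wopP lgJ dy) (hcvg_cst v).
    have e1 : (fun m => rip y (cowin g m v)) =
        fun m => rip (cowin (fun l => conjc (g l)) m y) v.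
      by apply/funext => m; rewrite /rip adj.
    by rewrite e1 in h1; exact: (cvg_unique _ h1 h2).
  have d0 : calculus_domain P g 0.
    have [] := wop_window 0 0 lg.
    by rewrite (lin0 (@op_lin _ _ (P (wnd 0)))).
  have w0 : wop g 0 = 0.
    apply: wop_eq => //; have := hcvg_cst (0 : H); congr hcvg.
    by apply/funext => m; rewrite (lin0 (@op_lin _ _ (cowin g m))).
  (* [r] compares real parts; at -i u the same identity compares imaginary parts. *)
  have [di wi] := calculus_domain_lin (- 'i) lg du d0.
  rewrite addr0 w0 addr0 in di wi.
  apply: complex_ext; first exact: r.
  have := r _ di; rewrite wi /rip !innerZr !ReM /=.
  by rewrite !oppr0 !mul0r !sub0r !mulN1r !opprK.
split=> [h|[dy ->]]; last first.
  by move=> u w /(functional_calculusP _ _ lg)[du ->] /=; exact: dual.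
have dy : calculus_domain P g y.
  rewrite -calculus_domainJ; apply/calculus_domainP => //.
  apply: (@cowin_bounded_cvg _ _ (sqn z)) => // m.
  have -> : cowin (fun l => conjc (g l)) m y = P (wnd m) z.
    apply: inner_ext => v; have [dv wv] := wop_window m v lg.
    have := h (P (wnd m) v) (cowin g m v).
    rewrite /= => /(_ (iffRL (functional_calculusP _ _ lg) (conj dv (esym wv)))).
    rewrite -adj -pvm_selfadj; last exact: measurable_window.
    by move=> e; rewrite innerC e -innerC.
  have := @spectral_measureT _ _ P z; have := @le_measure _ _ _ (spectral_measure P z)
    (wnd m) setT; rewrite !inE => h1 h2.
  have := h1 (measurable_window m) measurableT (@subsetT _ _).
  by rewrite [X in (_ <= X)%E]h2 [X in (X <= _)%E]spectral_measure_sqn lee_fin.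
split=> //; apply: (calculus_domain_dense lg) => u du.
have := h u (wop g u); rewrite /= dual// => e.
rewrite [LHS]innerC [RHS]innerC; congr conjc; apply/esym; apply: e.
by apply/functional_calculusP.
Qed.

End UnboundedCalculus.

Lemma ae_impl d (T : measurableType d) (R : realType) (mu : {measure set T -> \bar R})
  (A B : T -> Prop) : (forall x, A x -> B x) ->
  {ae mu, forall x, A x} -> {ae mu, forall x, B x}.
Proof. by move=> AB; apply: filterS. Qed.

Lemma ae_impl2 d (T : measurableType d) (R : realType) (mu : {measure set T -> \bar R})
  (A B C : T -> Prop) : (forall x, A x -> B x -> C x) ->
  {ae mu, forall x, A x} -> {ae mu, forall x, B x} -> {ae mu, forall x, C x}.
Proof. by move=> AB; apply: filterS2. Qed.

(** * The operators f(l - A) *)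

Section StronglyMeasurable.
Context {R : realType} {H : hilbertType R}.
Local Notation T := (measurableTypeR R).
Implicit Types (V : R -> H).

Definition seq_continuous V := forall (u : nat -> R) l, u @ \oo --> l ->
  hcvg (fun n => V (u n)) (V l).

(* The [Vm m] need only be continuous in l, so that countably many values determine
   them, whereas H may fail to be separable. *)
Definition smeas V := exists D : set T, measurable D /\ exists Vm : nat -> R -> H,
  [/\ forall m, seq_continuous (Vm m),
      forall l, D l -> hcvg (fun m => Vm m l) (V l) &
      forall l, ~ D l -> V l = 0].

Lemma seq_continuous_rip V V' : seq_continuous V -> seq_continuous V' ->
  measurable_fun setT ((fun l => rip (V l) (V' l)) : T -> R).
Proof.
move=> cV cV'; apply: continuous_measurable_fun => l.
apply/(@cvg_nbhsP _ R^o) => u ul; apply: hcvg_rip; [exact: cV|exact: cV'].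
Qed.

Lemma smeas_rip V V' : smeas V -> smeas V' ->
  measurable_fun setT ((fun l => rip (V l) (V' l)) : T -> R).
Proof.
move=> [D [mD [Vm [cV V1 V0]]]] [D' [mD' [Vm' [cV' V1' V0']]]].
have mI : measurable (D `&` D' : set T) by exact: measurableI.
apply: (@measurable_fun_cvg _ T R setT
  (fun m l => \1_(D `&` D') l * rip (Vm m l) (Vm' m l))).
  move=> m; apply: measurable_funM; first exact: measurable_indic.
  exact: seq_continuous_rip.
move=> l _; rewrite indicE; case: (boolP (l \in _)) => [|].
  rewrite inE => -[Dl Dl'] /=; under eq_fun do rewrite mul1r.
  by apply: hcvg_rip; [exact: V1|exact: V1'].
rewrite notin_setE => /not_andP h /=; under eq_fun do rewrite mul0r.
rewrite (_ : rip _ _ = 0); first exact: cvg_cst.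
by case: h => [/V0 ->|/V0' ->]; rewrite ?rip0l ?rip0r.
Qed.

Lemma smeas_cst x : smeas (fun=> x).
Proof.
exists setT; split; first exact: measurableT.
by exists (fun _ _ => x); split=> [m u l _|l _|l []//]; exact: hcvg_cst.
Qed.

Lemma smeas_op (A : bounded_op H) V : smeas V -> smeas (fun l => A (V l)).
Proof.
move=> [D [mD [Vm [cV V1 V0]]]]; exists D; split=> //; exists (fun m l => A (Vm m l)).
split=> [m u l ul|l Dl|l nDl]; try apply: op_hcvg; [exact: cV|exact: V1|].
by rewrite V0// (lin0 (@op_lin _ _ A)).
Qed.

Lemma smeas_Re V V' : smeas V -> smeas V' ->
  measurable_fun setT ((fun l => Re (inner (V l) (V' l))) : T -> R).
Proof. exact: smeas_rip. Qed.

Lemma smeas_Im V V' : smeas V -> smeas V' ->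
  measurable_fun setT ((fun l => Im (inner (V l) (V' l))) : T -> R).
Proof.
move=> mV mV'; under eq_fun do rewrite Im_inner.
(* Im <x, y> = Re <i x, y>, and multiplication by i is a bounded operator, which preserves
   [smeas]. *)
have [h1 [c hc]] : lin (fun x : H => (Num.imaginary : R[i]) *: x) /\
    bdd (fun x : H => (Num.imaginary : R[i]) *: x).
  split; first by move=> a x y; rewrite scalerDr !scalerA mulrC.
  by exists (abs2 (Num.imaginary : R[i])) => x; rewrite sqnZ.
have [A hA] := ex_op h1 hc.
under eq_fun do rewrite -hA.
by apply: smeas_rip => //; exact: smeas_op.
Qed.

Lemma smeas_abs2 V V' : smeas V -> smeas V' ->
  measurable_fun setT ((fun l => abs2 (inner (V l) (V' l))) : T -> R).
Proof.
move=> mV mV'; have mr := smeas_Re mV mV'; have mi := smeas_Im mV mV'.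
by apply: measurable_funD; apply: measurable_funM.
Qed.

Lemma smeas_sqn V : smeas V -> measurable_fun setT ((fun l => sqn (V l)) : T -> R).
Proof. by move=> mV; apply: smeas_rip. Qed.

Lemma rat_approx (l : R) :
  (fun n => (Num.floor (l * n.+1%:R))%:~R / n.+1%:R : R) @ \oo --> l.
Proof.
apply/cvgrPdist_lt => e e0; have /cvgrPdist_lt/(_ _ e0) := @cvg_harmonic R.
apply: filterS => n; rewrite sub0r normrN /= /harmonic => hn; apply: le_lt_trans hn.
rewrite [leRHS]ger0_norm ?invr_ge0//.
have n0 : (0 : R) < n.+1%:R by [].
have -> : l - (Num.floor (l * n.+1%:R))%:~R / n.+1%:R =
    (l * n.+1%:R - (Num.floor (l * n.+1%:R))%:~R) / n.+1%:R.
  by rewrite mulrBl mulfK// gt_eqF.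
rewrite normrM normfV [X in _ / X]ger0_norm//.
rewrite -[leRHS]mul1r; apply: ler_wpM2r; first by rewrite invr_ge0.
have /andP[h1 h2] := floor_itv (l * n.+1%:R).
by rewrite ger0_norm ?subr_ge0// lerBlDl -intrD1 ltW.
Qed.

(** If [e i] is orthogonal to all [Vm m] at rational points, it is so at all points by continuity
    and to every [V l] in the limit m -> oo. Each of the countably many vectors involved excludes
    countably many indices. *)
Lemma smeas_countable V (I : choiceType) (e : I -> H) : orthonormal_basis e -> smeas V ->
  countable [set i | exists l, inner (e i) (V l) != 0].
Proof.
move=> he [D [mD [Vm [cV V1 V0]]]].
pose r (p : nat * int) : R := p.2%:~R / p.1.+1%:R.
apply: (@sub_countable _ _ _ (\bigcup_(p : nat * (nat * int))
    [set i | inner (e i) (Vm p.1 (r p.2)) != 0])); last first.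
  by apply: bigcup_countable => // p _; exact: countable_inner_neq0.
apply: subset_card_le => i /= [l]; apply: contraPP => h; apply/negP; rewrite negbK; apply/eqP.
have hV m k n : inner (e i) (Vm m (r (n, k))) = 0.
  apply/eqP; rewrite -[_ == _]negbK; apply/negP => h'.
  by apply: h; exists (m, (n, k)).
have [Dl|nDl] := pselect (D l); last by rewrite V0// inner0r.
have zero (u : nat -> H) v : hcvg u v -> (forall n, inner (e i) (u n) = 0) -> inner (e i) v = 0.
  move=> uv hu; apply: complex_ext.
    have h1 := hcvg_rip (hcvg_cst (e i)) uv.
    have e1 : (fun n => rip (e i) (u n)) = cst 0 by apply/funext => n; rewrite /rip hu.
    by rewrite e1 in h1; exact: (cvg_unique _ h1 (cvg_cst 0)).
  rewrite Im_inner; have h1 := hcvg_rip (hcvg_cst ('i *: e i)) uv.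
  have e1 : (fun n => rip ('i *: e i) (u n)) = cst 0.
    by apply/funext => n; rewrite -Im_inner hu.
  by rewrite e1 in h1; exact: (cvg_unique _ h1 (cvg_cst 0)).
apply: (zero _ _ (V1 l Dl)) => m.
by apply: (zero _ _ (cV m _ _ (@rat_approx l))) => n; exact: hV.
Qed.

End StronglyMeasurable.

Section Shifted.
Context {R : realType} {H : hilbertType R} (P : pvm H) (f : R -> R[i]).
Local Notation T := (measurableTypeR R).
Hypotheses (cr : continuous (fun k => Re (f k))) (ci : continuous (fun k => Im (f k)))
  (f1 : (\int[lebesgue_measure]_l (abs2 (f l))%:E = 1)%E).

Let g (l : R) : R -> R[i] := fun k => f (l - k).

Lemma continuous_window_bounded (u : R -> R) : continuous u ->
  forall m, exists M, forall k, @window R m k -> `|u k| <= M.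
Proof.
move=> cu m.
have cn : continuous (fun k => `|u k|).
  by move=> k; apply: continuous_comp; [exact: cu|exact: norm_continuous].
have [||c _ hc] := @EVT_max R (fun k => `|u k|) (- m%:R) m%:R.
- by apply: (@le_trans _ _ 0); rewrite ?oppr_le0 ler0n.
- exact: continuous_subspaceT.
by exists `|u c| => k; rewrite windowE => /hc.
Qed.

Lemma shift_lbm l : lbm (g l).
Proof.
have cs : continuous (fun k : R => l - k).
  by move=> k; apply: cvgB; [exact: cvg_cst|exact: cvg_id].
have c1 : continuous (fun k => Re (f (l - k))).
  by move=> k; apply: (@continuous_comp _ _ _ (fun k => l - k) (fun k => Re (f k)));
    [exact: cs|exact: cr].
have c2 : continuous (fun k => Im (f (l - k))).
  by move=> k; apply: (@continuous_comp _ _ _ (fun k => l - k) (fun k => Im (f k)));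
    [exact: cs|exact: ci].
split; try exact: continuous_measurable_fun.
move=> m; have [M hM] := continuous_window_bounded c1 m.
have [N hN] := continuous_window_bounded c2 m.
exists (Num.max M N) => k wk; rewrite !le_max; split; apply/orP; [left|right].
  exact: hM.
exact: hN.
Qed.

Let abs2f_cont : continuous (fun k => abs2 (f k)).
Proof. by move=> k; apply: cvgD; rewrite expr2 /=; apply: cvgM; try exact: cr; exact: ci. Qed.

Lemma shift_integral k : (\int[lebesgue_measure]_l (abs2 (f (l - k)))%:E = 1)%E.
Proof.
have dF (x : R) : is_derive x 1 (fun l : R => l - k) 1.
  by apply: is_derive_eq; rewrite subr0.
have d1 : derive1 (fun l : R => l - k) = cst 1.
  by apply/funext => x; rewrite derive1E; exact: derive_val.
rewrite -f1 (@increasing_ge0_integration_by_substitutionT R (fun l => l - k)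
  (fun k => abs2 (f k))) ?d1.
- by apply: eq_integral => l _; rewrite /= mulr1.
- by move=> x y; rewrite ltrD2r.
- by move=> x; exact: cvg_cst.
- exact: is_cvg_cst.
- exact: is_cvg_cst.
- by move=> x; have [] := dF x.
- exact: cvg_addrr_Ny.
- exact: cvg_addrr.
- exact: abs2f_cont.
- by move=> x; exact: abs2_ge0.
Qed.

(** The density of the detector reading l: |f(l - A) y|^2 if y is in the domain, and +oo otherwise.
    The domain condition thus becomes a measurable condition on l. *)
Definition dens (y : H) (l : R) : \bar R :=
  (\int[spectral_measure P y]_k (abs2 (f (l - k)))%:E)%E.

Lemma measurable_joint :
  measurable_fun setT ((fun p => (abs2 (f (p.1 - p.2)))%:E) : T * T -> \bar R).
Proof.
apply/measurable_EFinP.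
have mf : measurable_fun setT (fun k : R => abs2 (f k)) by exact: continuous_measurable_fun.
have mg : measurable_fun setT (fun p : T * T => (p.1 - p.2 : R)).
  by apply: measurable_funB; [exact: measurable_fst|exact: measurable_snd].
exact: (measurableT_comp mf mg).
Qed.

Lemma dens_ge0 y l : (0 <= dens y l)%E.
Proof. by apply: integral_ge0 => k _; rewrite lee_fin abs2_ge0. Qed.

Lemma measurable_dens y : measurable_fun setT (dens y : T -> \bar R).
Proof.
apply: (@measurable_fun_fubini_tonelli_F _ _ T T R (spectral_measure P y)
  (fun p => (abs2 (f (p.1 - p.2)))%:E)) => [|p]; first exact: measurable_joint.
by rewrite lee_fin abs2_ge0.
Qed.

Lemma integral_dens y : (\int[lebesgue_measure]_l dens y l = (sqn y)%:E)%E.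
Proof.
rewrite (@fubini_tonelli _ _ T T R lebesgue_measure (spectral_measure P y)
  (fun p => (abs2 (f (p.1 - p.2)))%:E)) => [| |p]; last 2 first.
- exact: measurable_joint.
- by rewrite lee_fin abs2_ge0.
under eq_integral do rewrite /= shift_integral.
by rewrite integral_cst// mul1e; exact: spectral_measureT.
Qed.

Lemma measurable_dom y : measurable ([set l | calculus_domain P (g l) y] : set T).
Proof.
rewrite (_ : [set l | _] = setT `&` [set l | (dens y l < +oo)%E]); last by rewrite setTI.
by apply: emeasurable_fun_infty_o => //; exact: measurable_dens.
Qed.

Lemma ae_dom y : {ae lebesgue_measure, forall l : R, calculus_domain P (g l) y}.
Proof.
have i : lebesgue_measure.-integrable setT (dens y : T -> \bar R).
  apply/integrableP; split; first exact: measurable_dens.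
  apply: (@le_lt_trans _ _ (sqn y)%:E); last exact: ltry.
  rewrite -integral_dens le_eqVlt; apply/orP; left; apply/eqP.
  by apply: eq_integral => l _; rewrite gee0_abs// dens_ge0.
apply: filterS (integrable_ae measurableT i) => l h.
have := h I; rewrite ge0_fin_numE ?dens_ge0//.
Qed.

Definition shiftop (l : R) (y : H) : H := wop P (g l) y.

Lemma sqn_shiftop l y : calculus_domain P (g l) y -> (sqn (shiftop l y))%:E = dens y l.
Proof. exact: sqn_wop (shift_lbm l). Qed.

(** The squared norm of a difference is the integral over [-m, m] of |f(u_n - k) - f(l - k)|^2. The
    arguments stay in one window since u_n is bounded, so dominated convergence applies. *)
Lemma cowin_seq_continuous m y : seq_continuous (fun l => cowin P (g l) m y).
Proof.
move=> u l ul.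
have b n := win_cbm m (shift_lbm (u n)).
have bl := win_cbm m (shift_lbm l).
rewrite /hcvg.
have e n : sqn (cowin P (g (u n)) m y - cowin P (g l) m y) =
    \int[spectral_measure P y]_k abs2 (win m (g (u n)) k - win m (g l) k).
  by rewrite /cowin -copB// sqn_cop//; exact: cbmB.
under eq_fun do rewrite e.
have [K hK] : exists K : nat, forall n, `|u n| <= K%:R.
  have /cvg_seq_bounded[M [_ hM]] : cvgn u by apply/cvg_ex; exists l.
  exists (Num.truncn (`|M| + 1)).+1 => n.
  apply: le_trans (ltW (truncnS_gt _)); apply: hM => //.
  by rewrite (le_lt_trans (ler_norm M))// ltrDl.
have lK : `|l| <= K%:R.
  have : (fun n => `|u n|) @ \oo --> `|l| by exact: cvg_norm.
  by move=> /ler_cvg_to/(_ (cvg_cst (K%:R : R))); apply; apply: nearW => n.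
have [M1 hM1] := continuous_window_bounded cr (K + m).
have [M2 hM2] := continuous_window_bounded ci (K + m).
have wb v k : `|v| <= K%:R -> @window R m k -> @window R (K + m) (v - k).
  rewrite !windowE ler_norml natrD => /andP[? ?] /andP[? ?].
  by apply/andP; split; lra.
have winE v k : win m (g v) k = (\1_(@window R m) k)%:C * f (v - k) by [].
have fb v k : `|v| <= K%:R -> @window R m k -> abs2 (f (v - k)) <= M1 ^+ 2 + M2 ^+ 2.
  move=> vK wk; have w := wb _ _ vK wk; have h1 := hM1 _ w; have h2 := hM2 _ w.
  rewrite /abs2 -(real_normK (num_real (Re _))) -(real_normK (num_real (Im _))).
  have h1' := le_trans (normr_ge0 _) h1; have h2' := le_trans (normr_ge0 _) h2.
  by apply: lerD; rewrite ler_sqr ?nnegrE ?normr_ge0.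
(* |a - b|^2 <= 2 (|a|^2 + |b|^2), with both squares at most M1^2 + M2^2. *)
pose B := 4 * (M1 ^+ 2 + M2 ^+ 2).
have B0 : 0 <= B by rewrite mulr_ge0// addr_ge0// sqr_ge0.
have bound n k : abs2 (win m (g (u n)) k - win m (g l) k) <= B.
  rewrite !winE -mulrBr abs2M indicE; case: (boolP (k \in _)) => [|_]; last first.
    by rewrite /abs2 /= expr0n addr0 mul0r.
  rewrite inE => wk; rewrite /= (_ : abs2 1%:C = 1); last by rewrite /abs2 /= expr1n expr0n addr0.
  rewrite mul1r; apply: le_trans (abs2D_le _ _) _.
  have -> : abs2 (- f (l - k)) = abs2 (f (l - k)) by rewrite /abs2 !ReImE; ring.
  have := fb _ _ (hK n) wk; have := fb _ _ lK wk; rewrite /B; lra.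
have mn n : measurable_fun setT
    ((fun k => (abs2 (win m (g (u n)) k - win m (g l) k))%:E) : T -> \bar R).
  by apply/measurable_EFinP; have [] := cbm_abs2 (cbmB (b n) bl).
have ib : (spectral_measure P y).-integrable setT (fun k => B%:E).
  exact: finite_measure_integrable_cst.
have cv (k : T) : (fun n => (abs2 (win m (g (u n)) k - win m (g l) k))%:E) @ \oo --> 0%:E.
  apply: cvg_EFin; first exact: nearW.
  have uk : (fun n => u n - k) @ \oo --> l - k by apply: cvgB => //; exact: cvg_cst.
  have h1 : (fun n => Re (f (u n - k))) @ \oo --> Re (f (l - k)).
    exact: (@continuous_cvg _ _ _ _ _ (fun n => u n - k) (fun k => Re (f k)) _ (@cr _) uk).
  have h2 : (fun n => Im (f (u n - k))) @ \oo --> Im (f (l - k)).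
    exact: (@continuous_cvg _ _ _ _ _ (fun n => u n - k) (fun k => Im (f k)) _ (@ci _) uk).
  pose a : R := abs2 (\1_(@window R m) k)%:C.
  rewrite [X in X @ _](_ : _ = fun n => a * ((Re (f (u n - k)) - Re (f (l - k))) *
     (Re (f (u n - k)) - Re (f (l - k))) + (Im (f (u n - k)) - Im (f (l - k))) *
     (Im (f (u n - k)) - Im (f (l - k))))); last first.
    by apply/funext => n /=; rewrite !winE -mulrBr abs2M /a {2}/abs2 !ReImE; ring.
  rewrite [X in _ --> X](_ : 0 = a * ((Re (f (l - k)) - Re (f (l - k))) *
     (Re (f (l - k)) - Re (f (l - k))) + (Im (f (l - k)) - Im (f (l - k))) *
     (Im (f (l - k)) - Im (f (l - k))))); last by ring.
  by apply: cvgMr; apply: cvgD; apply: cvgM; apply: cvgB => //; exact: cvg_cst.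
have dom (k : T) n : (`|(abs2 (win m (g (u n)) k - win m (g l) k))%:E| <= B%:E)%E.
  by rewrite gee0_abs ?lee_fin ?abs2_ge0.
have [_ _ c1] := dominated_convergence measurableT mn (measurable_cst 0%:E)
  (aeW _ (fun k _ => cv k)) ib (aeW _ (fun k n _ => dom k n)).
rewrite integral0 in c1.
exact: fine_cvg c1.
Qed.

Lemma shiftop_smeas y : smeas (fun l => shiftop l y).
Proof.
exists [set l | calculus_domain P (g l) y]; split; first exact: measurable_dom.
exists (fun m l => cowin P (g l) m y); split.
- by move=> m; exact: cowin_seq_continuous.
- by move=> l; exact: wopP (shift_lbm l).
- by move=> l; exact: wop_out (shift_lbm l).
Qed.

Lemma integral_shiftop y : (\int[lebesgue_measure]_l (sqn (shiftop l y))%:E = (sqn y)%:E)%E.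
Proof.
rewrite -integral_dens; apply: ge0_ae_eq_integral => //.
- by apply/measurable_EFinP; apply: smeas_sqn; exact: shiftop_smeas.
- exact: measurable_dens.
- by move=> l _; rewrite lee_fin sqn_ge0.
- by move=> l _; exact: dens_ge0.
by apply: (ae_impl _ (ae_dom y)) => l dl _; exact: sqn_shiftop.
Qed.

Lemma shiftop_lin a x y : {ae lebesgue_measure, forall l : R,
  shiftop l (a *: x + y) = a *: shiftop l x + shiftop l y}.
Proof.
apply: (ae_impl2 _ (ae_dom x) (ae_dom y)) => l dx dy.
by case: (calculus_domain_lin a (shift_lbm l) dx dy).
Qed.

End Shifted.

Section Detector.
Context {R : realType} {H : hilbertType R} (P : pvm H).
Implicit Types (f g : R -> R[i]).

Lemma wop_dual g x y : lbm g -> calculus_domain P g x -> calculus_domain P g y ->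
  inner y (wop P g x) = inner (wop P (fun l => conjc (g l)) y) x.
Proof.
move=> lg dx dy; have /(_ (wop P (fun l => conjc (g l)) y)) := op_adjointP P y _ lg.
move=> [_ /(_ (conj dy erefl))]; apply.
by apply/functional_calculusP.
Qed.

Lemma smooth_continuous f : smooth f ->
  continuous (fun k => Re (f k)) /\ continuous (fun k => Im (f k)).
Proof.
move=> sf; split=> k; have [h1 h2] := sf 0%N k;
  exact/differentiable_continuous/derivable1_diffP.
Qed.

Section Values.
Context f (cr : continuous (fun k => Re (f k))) (ci : continuous (fun k => Im (f k))).

Lemma op_domain_detector l y :
  calculus_domain P (fun k => f (l - k)) y -> op_domain (detector_adjoint P f l) y.
Proof.
move=> dy; exists (wop P (fun k => conjc (f (l - k))) y).
by apply/op_adjointP => //; exact: shift_lbm.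
Qed.

(** On the domain this is [op_adjointP]; off it, [op_value] and [wop] both default to 0, so the
    equality holds for every l. *)
Lemma op_value_detector l y :
  op_value (detector_adjoint P f l) y = shiftop P (fun k => conjc (f k)) l y.
Proof.
have lg := shift_lbm cr ci l.
rewrite /op_value; have [dy|ndy] := pselect (calculus_domain P (fun k => f (l - k)) y).
  apply: xget_subset1; first by apply/op_adjointP.
  by move=> a b /(op_adjointP _ _ _ lg)[_ ->] /(op_adjointP _ _ _ lg)[_ ->].
rewrite xgetPN; last by move=> a /(op_adjointP _ _ _ lg)[].
by rewrite /shiftop wop_out//; [exact: lbmJ lg|rewrite calculus_domainJ].
Qed.

End Values.

End Detector.

(** * The measurement map *)

Section ComplexIntegral.
Context {R : realType} (mu : {measure set (measurableTypeR R) -> \bar R}).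
Implicit Types (g h : R -> R[i]).
Local Notation T := (measurableTypeR R).

Lemma integrable_funD (u v : T -> R) :
  mu.-integrable setT (EFin \o u) -> mu.-integrable setT (EFin \o v) ->
  mu.-integrable setT (fun l => (u l + v l)%:E).
Proof.
move=> iu iv; apply: (eq_integrable measurableT _ _ _ (integrableD measurableT iu iv)).
by [].
Qed.

Lemma integrable_funZ (r : R) (u : T -> R) :
  mu.-integrable setT (EFin \o u) -> mu.-integrable setT (fun l => (r * u l)%:E).
Proof.
move=> iu; apply: (eq_integrable measurableT _ _ _ (integrableZl measurableT r iu)).
by [].
Qed.

Lemma cintegrableD g h : cintegrable mu g -> cintegrable mu h ->
  cintegrable mu (fun l => g l + h l).
Proof.
move=> [g1 g2] [h1 h2]; split.
  by under eq_fun do rewrite ReD; exact: integrable_funD.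
by under eq_fun do rewrite ImD; exact: integrable_funD.
Qed.

Lemma cintegralD g h : cintegrable mu g -> cintegrable mu h ->
  cintegral mu (fun l => g l + h l) = cintegral mu g + cintegral mu h.
Proof.
move=> [g1 g2] [h1 h2]; apply: complex_ext; rewrite ?ReImE /=.
  by under eq_Rintegral do rewrite ReD; rewrite RintegralD.
by under eq_Rintegral do rewrite ImD; rewrite RintegralD.
Qed.

Lemma cintegrableZ a g : cintegrable mu g -> cintegrable mu (fun l => a * g l).
Proof.
move=> [g1 g2]; split.
  under eq_fun do rewrite ReM -mulNr.
  by apply: integrable_funD; exact: integrable_funZ.
under eq_fun do rewrite ImM.
by apply: integrable_funD; exact: integrable_funZ.
Qed.

Lemma cintegralZ a g : cintegrable mu g ->
  cintegral mu (fun l => a * g l) = a * cintegral mu g.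
Proof.
move=> [g1 g2]; apply: complex_ext; rewrite ?ReImE /=.
  under eq_Rintegral do rewrite ReM -mulNr.
  by rewrite RintegralD//; try exact: integrable_funZ; rewrite !RintegralZl// mulNr.
under eq_Rintegral do rewrite ImM.
by rewrite RintegralD//; try exact: integrable_funZ; rewrite !RintegralZl.
Qed.

Lemma cintegral_sum (I : Type) (r : seq I) (F : I -> R -> R[i]) :
  (forall i, cintegrable mu (F i)) ->
  cintegrable mu (fun l => \sum_(i <- r) F i l) /\
  cintegral mu (fun l => \sum_(i <- r) F i l) = \sum_(i <- r) cintegral mu (F i).
Proof.
move=> hF; elim: r => [|i r [ih1 ih2]].
  rewrite big_nil; under eq_fun do rewrite big_nil.
  split; first by split; exact: integrable0.
  by rewrite /cintegral /= /Rintegral integral0.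
rewrite big_cons -ih2; under eq_fun do rewrite big_cons.
by split; [exact: cintegrableD|exact: cintegralD].
Qed.

Lemma cintegral_ae g h : cintegrable mu g -> cintegrable mu h ->
  {ae mu, forall l, g l = h l} -> cintegral mu g = cintegral mu h.
Proof.
have hae (u v : T -> R) : mu.-integrable setT (EFin \o u) -> mu.-integrable setT (EFin \o v) ->
    {ae mu, forall l, u l = v l} -> \int[mu]_l u l = \int[mu]_l v l.
  move=> /measurable_int mu' /measurable_int mv e; congr fine.
  apply: ae_eq_integral => //; apply: ae_impl e => l /= + _.
  by move=> ->.
move=> [g1 g2] [h1 h2] e; rewrite /cintegral.
by congr (_ +i* _); apply: hae => //; apply: ae_impl e => l ->.
Qed.

Lemma cintegral_ge0 g : (forall l, 0 <= g l) -> 0 <= cintegral mu g.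
Proof.
move=> g0; have h l : Im (g l) = 0 /\ 0 <= Re (g l).
  by have := g0 l; rewrite lecE => /andP[/eqP].
rewrite lecE /=; apply/andP; split.
  by under eq_Rintegral do rewrite (h _).1; rewrite /Rintegral integral0.
by apply: Rintegral_ge0 => l _; have [] := h l.
Qed.

Lemma cintegrable_le g (h : R -> R) :
  measurable_fun setT ((fun l => Re (g l)) : T -> R) ->
  measurable_fun setT ((fun l => Im (g l)) : T -> R) ->
  mu.-integrable setT (EFin \o (h : T -> R)) ->
  (forall l, 0 <= h l) -> (forall l, abs2 (g l) <= h l ^+ 2) ->
  cintegrable mu g /\ abs2 (cintegral mu g) <= (2 * \int[mu]_l h l) ^+ 2.
Proof.
move=> mr mi ih h0 gh.
have nr (u : R -> R) : (forall l, u l ^+ 2 <= abs2 (g l)) -> forall l, `|u l| <= h l.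
  move=> hu l; rewrite -ler_sqr ?nnegrE// real_normK ?num_real//.
  exact: le_trans (hu l) (gh l).
have hr := nr _ (fun l => abs2_le_Re (g l)).
have hi : forall l, `|Im (g l)| <= h l.
  by apply: nr => l; rewrite /abs2 lerDr sqr_ge0.
have int (u : R -> R) : measurable_fun setT (u : T -> R) -> (forall l, `|u l| <= h l) ->
    mu.-integrable setT (EFin \o (u : T -> R)).
  move=> mu' hu; apply: (le_integrable measurableT _ _ ih).
    exact/measurable_EFinP.
  by move=> l _ /=; rewrite lee_fin (ger0_norm (h0 l)).
have ir := int _ mr hr; have ii := int _ mi hi; split=> //.
have I0 : 0 <= \int[mu]_l h l by apply: Rintegral_ge0.
have b (u : R -> R) : mu.-integrable setT (EFin \o (u : T -> R)) -> (forall l, `|u l| <= h l) ->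
    (\int[mu]_l u l) ^+ 2 <= (\int[mu]_l h l) ^+ 2.
  move=> iu hu; rewrite -real_normK ?num_real// ler_sqr ?nnegrE//.
  apply: le_trans (le_normr_Rintegral measurableT iu) _.
  apply: le_Rintegral => //; exact: integrable_norm.
(* With I the integral of [h], each part has square at most I^2, and 2 I^2 <= (2 I)^2. *)
have := b _ ir hr; have := b _ ii hi; rewrite /abs2 /=.
by have := sqr_ge0 (\int[mu]_l h l); rewrite exprMn; lra.
Qed.

End ComplexIntegral.

Section SquareIntegrable.
Context {R : realType} {H : hilbertType R}.
Local Notation T := (measurableTypeR R).
Local Notation leb := (@lebesgue_measure R).
Implicit Types (V : R -> H).

Definition sq_integrable V :=
  smeas V /\ leb.-integrable setT (EFin \o ((fun l => sqn (V l)) : T -> R)).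

Lemma sq_integrable_op (A : bounded_op H) V : sq_integrable V ->
  sq_integrable (fun l => A (V l)).
Proof.
move=> [mV iV]; have mAV := smeas_op A mV; split=> //.
have [c c0 hc] := op_bound A.
apply: (le_integrable measurableT _ _ (integrable_funZ c iV)).
  by apply/measurable_EFinP; exact: smeas_sqn.
move=> l _ /=; rewrite lee_fin !ger0_norm ?sqn_ge0//.
by rewrite mulr_ge0 ?sqn_ge0.
Qed.

Lemma sq_integrable_inner V V' : sq_integrable V -> sq_integrable V' ->
  cintegrable leb (fun l => inner (V l) (V' l)) /\
  abs2 (cintegral leb (fun l => inner (V l) (V' l))) <=
    (\int[leb]_l sqn (V l) + \int[leb]_l sqn (V' l)) ^+ 2.
Proof.
move=> [mV iV] [mV' iV'].
(* The factor 1/2 from the arithmetic-geometric mean cancels the 2 in [cintegrable_le]. *)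
pose h (l : T) := 2^-1 * (sqn (V l) + sqn (V' l)).
have iD := integrable_funD iV iV'.
have ih : leb.-integrable setT (EFin \o h) by exact: integrable_funZ.
have [||||c1 c2] := @cintegrable_le _ leb (fun l => inner (V l) (V' l)) h _ _ ih.
- exact: smeas_Re.
- exact: smeas_Im.
- by move=> l; rewrite /h mulr_ge0 ?addr_ge0 ?sqn_ge0.
- move=> l; apply: le_trans (inner_cs _ _) _; rewrite /h.
  by have := sqr_ge0 (sqn (V l) - sqn (V' l)); lra.
split=> //; move: c2; rewrite RintegralZl// RintegralD//.
by rewrite mulrA mulfV ?mul1r.
Qed.

End SquareIntegrable.

Section MeasurementMap.
Context {R : realType} {H : hilbertType R}.
Local Notation T := (measurableTypeR R).
Local Notation leb := (@lebesgue_measure R).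

(* the properties of [W l = f(l - A)^*] from which complete positivity and
   trace preservation follow *)
Definition instrument (W : R -> H -> H) :=
  [/\ forall y, smeas (fun l => W l y),
      forall y, (\int[leb]_l (sqn (W l y))%:E = (sqn y)%:E)%E &
      forall a x y, {ae leb, forall l : R, W l (a *: x + y) = a *: W l x + W l y}].

Variables (W : R -> H -> H) (hW : instrument W).
Implicit Types (rho A B : bounded_op H) (x y z : H).

Lemma instrument_sq y : sq_integrable (fun l => W l y).
Proof.
have [mW iW _] := hW; split; first exact: mW.
apply/integrableP; split.
  by apply/measurable_EFinP; apply: smeas_sqn; exact: mW.
apply: (@le_lt_trans _ _ (sqn y)%:E); last exact: ltry.
rewrite -iW le_eqVlt; apply/orP; left; apply/eqP; apply: eq_integral => l _.
by rewrite /= ger0_norm ?sqn_ge0.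
Qed.

Lemma Rintegral_instrument y : \int[leb]_l sqn (W l y) = sqn y.
Proof. by have [_ iW _] := hW; rewrite /Rintegral iW. Qed.

Definition meas_form rho x y := cintegral leb (fun l => inner (W l x) (rho (W l y))).

Lemma meas_form_integrable rho x y :
  cintegrable leb (fun l => inner (W l x) (rho (W l y))).
Proof.
have [] // := sq_integrable_inner (instrument_sq x)
  (sq_integrable_op rho (instrument_sq y)).
Qed.

Lemma meas_form_linr rho a x y z :
  meas_form rho x (a *: y + z) = a * meas_form rho x y + meas_form rho x z.
Proof.
have [_ _ lW] := hW; have iZ := cintegrableZ a (meas_form_integrable rho x y).
rewrite /meas_form -cintegralZ -?cintegralD//; try exact: meas_form_integrable.
apply: cintegral_ae; [exact: meas_form_integrable| |].
  by apply: cintegrableD => //; exact: meas_form_integrable.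
by apply: ae_impl (lW a y z) => l ->; rewrite op_lin innerDr innerZr.
Qed.

Lemma meas_form_linl rho a x y z :
  meas_form rho (a *: x + y) z = conjc a * meas_form rho x z + meas_form rho y z.
Proof.
have [_ _ lW] := hW; have iZ := cintegrableZ (conjc a) (meas_form_integrable rho x z).
rewrite /meas_form -cintegralZ -?cintegralD//; try exact: meas_form_integrable.
apply: cintegral_ae; [exact: meas_form_integrable| |].
  by apply: cintegrableD => //; exact: meas_form_integrable.
by apply: ae_impl (lW a x y) => l ->; rewrite innerDl innerZl.
Qed.

Lemma meas_form_bound rho : exists2 c : R, 0 <= c & forall x y,
  abs2 (meas_form rho x y) <= (c * (sqn x + sqn y)) ^+ 2.
Proof.
have [c c0 hc] := op_bound rho; exists (1 + c); first by rewrite addr_ge0.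
move=> x y; have sy := sq_integrable_op rho (instrument_sq y).
apply: le_trans (sq_integrable_inner (instrument_sq x) sy).2 _.
have h : \int[leb]_l sqn (rho (W l y)) <= c * sqn y.
  rewrite -Rintegral_instrument -RintegralZl//; last by have [] := instrument_sq y.
  apply: le_Rintegral => //; first by have [] := sy.
  by apply: integrable_funZ; have [] := instrument_sq y.
have h0 : 0 <= \int[leb]_l sqn (rho (W l y)) by apply: Rintegral_ge0 => l _; exact: sqn_ge0.
rewrite Rintegral_instrument ler_sqr ?nnegrE ?addr_ge0 ?sqn_ge0//; last first.
  by rewrite mulr_ge0 ?addr_ge0 ?sqn_ge0.
have := sqn_ge0 x; have := sqn_ge0 y; nra.
Qed.

Lemma ex_meas rho : exists M : bounded_op H, forall x y, inner x (M y) = meas_form rho x y.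
Proof.
have [c c0 hc] := meas_form_bound rho.
exact: op_of_form c0 (@meas_form_linl rho) (@meas_form_linr rho) hc.
Qed.

Definition meas_map rho : bounded_op H := sval (cid (ex_meas rho)).

Lemma meas_mapE rho x y : inner x (meas_map rho y) = meas_form rho x y.
Proof. exact: (svalP (cid (ex_meas rho))). Qed.

Lemma meas_map_linear : linear_map meas_map.
Proof.
move=> a r s t h x; apply: inner_ext => z.
rewrite innerDr innerZr !meas_mapE /meas_form -cintegralZ -?cintegralD//;
  try apply: cintegrableZ; try exact: meas_form_integrable.
by congr cintegral; apply/funext => l; rewrite h innerDr innerZr.
Qed.

End MeasurementMap.

(** * Complete positivity *)

Section Frames.
Context {R : realType} {V : hilbertType R}.
Implicit Types (s us : seq V) (u v : V).

(** The sum of the |u><u|. That it is the identity is the property of an orthonormal basis on which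
    the ampliation relies. *)
Definition frame_op us v := \sum_(u <- us) inner u v *: u.

Lemma frame_op_lin us : lin (frame_op us).
Proof.
move=> a x y; rewrite /frame_op scaler_sumr -big_split /=.
by apply: eq_bigr => u _; rewrite innerDr innerZr scalerDl scalerA.
Qed.

Lemma frame_op_selfadj us x y : inner (frame_op us x) y = inner x (frame_op us y).
Proof.
rewrite /frame_op inner_sum_l inner_sum_r; apply: eq_bigr => u _.
by rewrite innerZl innerZr -innerC mulrC.
Qed.

(** As [frame_op us] is symmetric and fixes each u in [us], the residual r = e - [frame_op us e] is
    orthogonal to all of them; unless it is 0, it is normalized and added. *)
Lemma gram_schmidt s : exists us, {in us, forall u, frame_op us u = u} /\
  {in s, forall e, frame_op us e = e}.
Proof.
elim: s => [|e s [us [h1 h2]]]; first by exists [::].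
pose r := e - frame_op us e.
have [r0|r0] := eqVneq (sqn r) 0.
  exists us; split=> // x; rewrite inE => /orP[/eqP->|]; last exact: h2.
  by apply/esym/subr0_eq/sqn_eq0.
have rpos : 0 < sqn r by rewrite lt_neqAle eq_sym r0 sqn_ge0.
pose w := ((Num.sqrt (sqn r))^-1)%:C *: r.
have ur u : u \in us -> inner u r = 0.
  by move=> hu; rewrite /r innerBr -frame_op_selfadj h1// subrr.
have uw u : u \in us -> inner u w = 0 by move=> hu; rewrite innerZr ur// mulr0.
have wu u : u \in us -> inner w u = 0 by move=> hu; rewrite innerC uw// conjc0.
have Qw v : inner w (frame_op us v) = 0.
  rewrite /frame_op inner_sum_r big_seq big1// => u hu.
  by rewrite innerZr wu// mulr0.
have cons v : frame_op (w :: us) v = inner w v *: w + frame_op us v.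
  by rewrite /frame_op big_cons.
have ww : inner w w = 1.
  rewrite inner_sqn sqnZR exprVn sqr_sqrtr ?sqn_ge0// mulVf//.
have Q0 : frame_op us w = 0.
  by rewrite /frame_op big_seq big1// => u hu; rewrite uw// scale0r.
have old v : frame_op us v = v -> frame_op (w :: us) v = v.
  by move=> hv; rewrite cons -{1}hv Qw scale0r add0r.
exists (w :: us); split=> v; rewrite inE => /orP[/eqP->|hv].
- by rewrite cons ww scale1r Q0 addr0.
- exact/old/h1.
- have er : e = r + frame_op us e by rewrite /r subrK.
  rewrite cons {1}er innerDr Qw addr0.
  have -> : inner w r = (Num.sqrt (sqn r))%:C.
    rewrite innerZl conjcR inner_sqn -rmorphM /=; congr (_%:C).
    by rewrite -{2}(sqr_sqrtr (sqn_ge0 r)) expr2 mulKf// sqrtr_eq0 -ltNge.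
  rewrite scalerA -rmorphM mulfV ?rmorph1 ?scale1r ?subrK//.
  by rewrite sqrtr_eq0 -ltNge.
- exact/old/h2.
Qed.

Lemma ex_frame : finite_dim V -> exists us, forall v, frame_op us v = v.
Proof.
move=> [n [e he]]; have [us [_ h]] := gram_schmidt (codom e).
exists us => v; have [c ->] := he v.
rewrite (lin_sum (@frame_op_lin us)); apply: eq_bigr => i _.
by rewrite (linZ (@frame_op_lin us)) h// codom_f.
Qed.

End Frames.

Section Ampliation.
Context {R : realType} {H V K : hilbertType R} (t : {bilinear H -> V -> K}) (us : seq V).
Hypotheses (tH : forall x y v w, inner (t x v) (t y w) = inner x y * inner v w)
  (frame : forall v, frame_op us v = v).
Implicit Types (T : bounded_op K) (x y : H) (u v : V) (z : K).

Lemma tensor_linl v : lin (fun x => t x v).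
Proof. by move=> a x y; rewrite linearDl linearZl_LR. Qed.

Lemma tensor_linr x : lin (fun v => t x v).
Proof. by move=> a v w; rewrite linearDr linearZr_LR. Qed.

Lemma sqn_tensor x v : sqn (t x v) = sqn x * sqn v.
Proof. by rewrite /sqn tH !inner_sqn -rmorphM. Qed.

Lemma ex_slice u : exists g : K -> H, [/\ lin g, forall z, sqn (g z) <= sqn u * sqn z &
  forall x z, inner x (g z) = inner (t x u) z].
Proof.
apply: ex_adjoint (sqn_ge0 u) (tensor_linl u) _ => x.
by rewrite sqn_tensor mulrC.
Qed.

(** Contraction with u, the adjoint of x |-> x (x) u. *)
Definition slice u : K -> H := sval (cid (ex_slice u)).

Lemma slice_lin u : lin (slice u).
Proof. have [h _ _] := svalP (cid (ex_slice u)); exact: h. Qed.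

Lemma slice_bound u z : sqn (slice u z) <= sqn u * sqn z.
Proof. have [_ h _] := svalP (cid (ex_slice u)); exact: h. Qed.

Lemma sliceE u x z : inner x (slice u z) = inner (t x u) z.
Proof. have [_ _ h] := svalP (cid (ex_slice u)); exact: h. Qed.

Lemma slice_tensor u x v : slice u (t x v) = inner u v *: x.
Proof. by apply: inner_ext => y; rewrite sliceE tH innerZr mulrC. Qed.

Lemma block_subproof T u u' :
  lin (fun x => slice u (T (t x u'))) /\ bdd (fun x => slice u (T (t x u'))).
Proof.
split; first by move=> a x y; rewrite tensor_linl op_lin slice_lin.
have [c c0 hc] := op_bound T; exists (sqn u * (c * sqn u')) => x.
apply: le_trans (slice_bound _ _) _; rewrite -!mulrA ler_wpM2l ?sqn_ge0//.
by apply: le_trans (hc _) _; rewrite sqn_tensor ler_wpM2l// mulrC.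
Qed.

(** The matrix entry of [T] at (u, u'), an operator on [H]. *)
Definition block T u u' : bounded_op H := mkop (block_subproof T u u').

Lemma blockE T u u' x : block T u u' x = slice u (T (t x u')).
Proof. exact: mkopE. Qed.

Variables (Phi : bounded_op H -> bounded_op H) (Phi_lin : linear_map Phi).

Lemma linear_map0 : forall r : bounded_op H, (forall x, r x = 0) -> forall x, Phi r x = 0.
Proof.
move=> r r0 x; have : forall x, r x = (-1) *: r x + r x by move=> y; rewrite r0 scaler0 addr0.
by move=> /Phi_lin ->; rewrite scaleN1r addNr.
Qed.

Lemma linear_mapZ a (r s : bounded_op H) : (forall x, s x = a *: r x) -> forall x, Phi s x = a *: Phi r x.
Proof.
move=> h x; rewrite (@Phi_lin a r (@op0 R H) s).
  by rewrite (@linear_map0 (@op0 R H)) ?addr0// => y; exact: op0E.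
by move=> y; rewrite h op0E addr0.
Qed.

Lemma lift_subproof (A : bounded_op H) u u' :
  lin (fun z => t (A (slice u' z)) u) /\ bdd (fun z => t (A (slice u' z)) u).
Proof.
split; first by move=> a x y; rewrite slice_lin op_lin tensor_linl.
have [c c0 hc] := op_bound A; exists (c * sqn u' * sqn u) => z.
rewrite sqn_tensor [leRHS]mulrAC ler_wpM2r ?sqn_ge0//.
by apply: le_trans (hc _) _; rewrite -mulrA ler_wpM2l// slice_bound.
Qed.

Lemma ex_op_sum (I : Type) (r : seq I) (F : I -> bounded_op K) :
  exists S : bounded_op K, forall z, S z = \sum_(i <- r) F i z.
Proof.
elim: r => [|i r [S hS]].
  by exists (@op0 R K) => z; rewrite big_nil op0E.
by exists (opD (F i) S) => z; rewrite big_cons opDE hS.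
Qed.

Lemma ex_ampliation T : exists S : bounded_op K, forall z, S z =
  \sum_(u <- us) \sum_(u' <- us) t (Phi (block T u u') (slice u' z)) u.
Proof.
have /choice[F hF] : forall u, exists S : bounded_op K, forall z, S z =
    \sum_(u' <- us) t (Phi (block T u u') (slice u' z)) u.
  move=> u; have [S hS] := ex_op_sum us
    (fun u' => mkop (lift_subproof (Phi (block T u u')) u u')).
  by exists S => z; rewrite hS; apply: eq_bigr => u' _; rewrite mkopE.
have [S hS] := ex_op_sum us F; exists S => z.
by rewrite hS; apply: eq_bigr => u _; rewrite hF.
Qed.

(** The sum of the Phi(T_(u,u')) (x) |u><u'|, where T_(u,u') is [block T u u']: Phi applied to each
    matrix entry. *)
Definition ampliation T : bounded_op K := sval (cid (ex_ampliation T)).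

Lemma ampliationE T z : ampliation T z =
  \sum_(u <- us) \sum_(u' <- us) t (Phi (block T u u') (slice u' z)) u.
Proof. exact: (svalP (cid (ex_ampliation T))). Qed.

(** The block of a (x) b at (u, u') is <u, b u'> a. By linearity Phi(a) factors out, and the frame
    identity resums the coefficients to b v. *)
Lemma ampliationP : is_ampliation t Phi ampliation.
Proof.
split=> [a r s T h z|a b c h x v].
  rewrite !ampliationE scaler_sumr -big_split; apply: eq_bigr => u _ /=.
  rewrite scaler_sumr -big_split; apply: eq_bigr => u' _ /=.
  rewrite (@Phi_lin a (block r u u') (block s u u')) ?tensor_linl// => y.
  by rewrite !blockE h slice_lin.
rewrite ampliationE -[X in _ = t _ X]frame /frame_op (lin_sum (tensor_linr _)).
apply: eq_bigr => u _; rewrite (linZ (tensor_linr _)).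
rewrite -{2}[v]frame /frame_op (lin_sum (@op_lin _ _ b)) inner_sum_r scaler_suml.
apply: eq_bigr => u' _.
have hb y : block c u u' y = inner u (b u') *: a y by rewrite blockE h slice_tensor.
rewrite (linear_mapZ hb) slice_tensor (linZ (@op_lin _ _ (Phi a))).
by rewrite (linZ (@op_lin _ _ b)) innerZr !scalerA (linZ (tensor_linl _)) mulrC.
Qed.

End Ampliation.

Section CompletePositivity.
Context {R : realType} {H : hilbertType R} (W : R -> H -> H) (hW : instrument W).
Local Notation leb := (@lebesgue_measure R).

(* The positivity of the ampliation Psi is seen from
   [<z, Psi(T) z> = \int <zeta_l, T zeta_l> dl], where
   [zeta_l = \sum_u (W_l x_u) (x) u] for [z = \sum_u x_u (x) u]. *)
Lemma meas_map_cp : completely_positive (meas_map hW).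
Proof.
split; first exact: meas_map_linear.
move=> V K t fV [tH _]; have [us frame] := ex_frame fV.
exists (ampliation us tH (meas_map hW)).
  exact: (ampliationP _ _ (@meas_map_linear _ _ _ hW)).
move=> T pT z.
pose F u u' l := inner (W l (slice tH u z)) (block tH T u u' (W l (slice tH u' z))).
have e : inner z (ampliation us tH (meas_map hW) T z) =
    \sum_(u <- us) \sum_(u' <- us) cintegral leb (F u u').
  rewrite ampliationE inner_sum_r; apply: eq_bigr => u _.
  rewrite inner_sum_r; apply: eq_bigr => u' _.
  by rewrite innerC -sliceE -innerC meas_mapE.
have h u := cintegral_sum us (fun u' => meas_form_integrable hW (block tH T u u')
  (slice tH u z) (slice tH u' z)).
have -> : inner z (ampliation us tH (meas_map hW) T z) =
    cintegral leb (fun l => \sum_(u <- us) \sum_(u' <- us) F u u' l).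
  rewrite e (cintegral_sum us (fun u => (h u).1)).2.
  by apply: eq_bigr => u _; rewrite -(h u).2.
apply: cintegral_ge0 => l.
suff -> : \sum_(u <- us) \sum_(u' <- us) F u u' l =
    inner (\sum_(u <- us) t (W l (slice tH u z)) u)
      (T (\sum_(u <- us) t (W l (slice tH u z)) u)) by exact: pT.
rewrite inner_sum_l; apply: eq_bigr => u _.
rewrite (lin_sum (@op_lin _ _ T)) inner_sum_r; apply: eq_bigr => u' _.
by rewrite /F blockE sliceE.
Qed.

End CompletePositivity.

(** * Trace preservation *)

Section IntegralEsum.
Context {R : realType} d (T : measurableType d) (mu : {measure set T -> \bar R}).

(** An injection of the countable support into the naturals turns the unordered sum into a series,
    to which monotone convergence applies. *)
Lemma integral_esum (I : choiceType) (D : set I) (a : I -> T -> \bar R) :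
  countable D -> (forall i, measurable_fun setT (a i)) -> (forall i l, 0 <= a i l)%E ->
  (forall i l, ~ D i -> a i l = 0%E) ->
  \esum_(i in [set: I]) (\int[mu]_l a i l)%E = (\int[mu]_l \esum_(i in [set: I]) a i l)%E.
Proof.
move=> /countable_injP[f finj] ma a0 aD.
have [[i0 Di0]|noD] := pselect (exists i, D i); last first.
  have nD i : ~ D i by move=> Di; apply: noD; exists i.
  rewrite esum1; last first.
    by move=> i _; apply: integral0_eq => l _; rewrite aD.
  by apply/esym/integral0_eq => l _; rewrite esum1// => i _; rewrite aD.
(* A left inverse of [f] on [D]; the default [i0] is masked by the test in [b]. *)
pose g (n : nat) := xget i0 [set i | D i /\ f i = n].
have gf i : D i -> g (f i) = i.
  move=> Di; apply: xget_unique; first by [].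
  by move=> j [Dj fij]; apply: finj => //; rewrite inE.
pose b n l := if n \in f @` D then a (g n) l else 0%E.
have b0 n l : (0 <= b n l)%E by rewrite /b; case: ifP.
have mb n : measurable_fun setT (b n).
  by rewrite /b; case: (n \in _); [exact: ma|exact: measurable_cst].
have key (c : I -> \bar R) : (forall i, ~ D i -> c i = 0%E) ->
    \esum_(i in [set: I]) c i = \esum_(n in [set: nat]) if n \in f @` D then c (g n) else 0%E.
  move=> cD; rewrite -esum_mkcond esum_image; last by [].
  rewrite [in RHS]esum_mkcond; apply: eq_esum => i _; case: (boolP (i \in D)).
    by rewrite inE => /gf ->.
  by rewrite notin_setE => /cD.
rewrite key; last by move=> i nDi; apply: integral0_eq => l _; exact: aD.
rewrite [in RHS](eq_integral (fun l => \sum_(n <oo) b n l)%E); last first.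
  by move=> l _; rewrite key ?nneseries_esumT// => i; exact: aD.
rewrite integral_nneseries// nneseries_esumT; last by move=> n; exact: integral_ge0.
apply: eq_esum => n _; rewrite /b; case: ifP => // _.
by rewrite integral0.
Qed.

End IntegralEsum.

Section NetSums.
Context {R : realType} {I : choiceType}.
Implicit Types (a b : I -> R[i]).

(** The convergence in [is_trace] for a single family, isolated in order to take linear
    combinations. *)
Definition net_sum a (t : R[i]) := forall eps : R, 0 < eps ->
  exists J0 : {fset I}, forall J : {fset I}, (J0 `<=` J)%fset ->
    `|t - \sum_(i <- J) a i| < eps%:C.

Lemma net_sum_esum (r : I -> R) (c : R) : (forall i, 0 <= r i) ->
  \esum_(i in [set: I]) (r i)%:E = c%:E -> net_sum (fun i => (r i)%:C) c%:C.
Proof.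
move=> r0 rc eps e0; have [J0 h] := esum_fset_approx r0 rc e0.
exists J0 => J /h; rewrite -rmorph_sum -rmorphB => hJ.
by rewrite normc_abs2 ltcR /abs2 /= expr0n addr0 sqrtr_sqr.
Qed.

Lemma net_sumZ c a t : net_sum a t -> net_sum (fun i => c * a i) (c * t).
Proof.
move=> h eps e0.
have nc : `|c| = (Num.sqrt (abs2 c))%:C by exact: normc_abs2.
have c0 : 0 < Num.sqrt (abs2 c) + 1 by rewrite ltr_wpDl ?sqrtr_ge0.
have [J0 hJ] := h _ (divr_gt0 e0 c0); exists J0 => J /hJ {}hJ.
rewrite -mulr_sumr -mulrBr normrM nc; move: hJ; rewrite normc_abs2 -rmorphM !ltcR.
rewrite ltr_pdivlMr// => hJ; apply: le_lt_trans hJ.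
by rewrite mulrC ler_wpM2l ?sqrtr_ge0// lerDl.
Qed.

Lemma net_sumD a b t s : net_sum a t -> net_sum b s -> net_sum (fun i => a i + b i) (t + s).
Proof.
move=> ha hb eps e0; have e2 : 0 < eps / 2 by rewrite divr_gt0.
have [J1 h1] := ha _ e2; have [J2 h2] := hb _ e2.
exists (J1 `|` J2)%fset => J; rewrite fsubUset => /andP[/h1 {}h1 /h2 {}h2].
rewrite big_split /= opprD addrACA; apply: le_lt_trans (ler_normD _ _) _.
have -> : eps%:C = (eps / 2)%:C + (eps / 2)%:C :> R[i] by rewrite -rmorphD -splitr.
exact: ltrD.
Qed.

Lemma net_sum_sum (K : Type) (r : seq K) (a : K -> I -> R[i]) (t : K -> R[i]) :
  (forall k, net_sum (a k) (t k)) ->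
  net_sum (fun i => \sum_(k <- r) a k i) (\sum_(k <- r) t k).
Proof.
move=> h; elim: r => [|k r ih].
  move=> eps e0; exists fset0 => J _; rewrite big_nil.
  by under eq_bigr do rewrite big_nil; rewrite big1// subrr normr0 ltcR.
rewrite big_cons; have := net_sumD (h k) ih.
by under [in X in _ -> X]eq_fun do rewrite big_cons.
Qed.

End NetSums.

(** * Factorization of trace class operators into Hilbert-Schmidt operators *)

Section HilbertSchmidtFactors.
Context {R : realType} {H : hilbertType R}.
Implicit Types (A B C N Q T S rho : bounded_op H).

Definition hilbert_schmidt Q := forall (I : choiceType) (e : I -> H),
  orthonormal_basis e -> (hs e Q < +oo)%E.

Lemma ex_hs Q : hilbert_schmidt Q ->
  exists r : R, forall (I : choiceType) (e : I -> H), orthonormal_basis e -> hs e Q = r%:E.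
Proof.
move=> hQ; have [[I [e he]]|no] :=
    pselect (exists (I : choiceType) (e : I -> H), orthonormal_basis e); last first.
  by exists 0 => I e he; case: no; exists I, e.
have h0 : (0 <= hs e Q)%E by apply: esum_ge0 => i _; rewrite lee_fin sqn_ge0.
exists (fine (hs e Q)) => J f hf; rewrite (hs_basis Q hf he) fineK//.
by rewrite ge0_fin_numE// hQ.
Qed.

Lemma opadj_contr C : (forall x, sqn (C x) <= sqn x) -> forall x, sqn (opadj C x) <= sqn x.
Proof.
move=> hC x; have h : sqn (opadj C x) = rip x (C (opadj C x)).
  by rewrite /sqn /rip opadjE.
have h1 := rip_cs x (C (opadj C x)); rewrite -h in h1.
have h2 := hC (opadj C x); have h3 := sqn_ge0 x.
have [z|nz] := eqVneq (sqn (opadj C x)) 0; first by rewrite z.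
have p : 0 < sqn (opadj C x) by rewrite lt_neqAle eq_sym nz sqn_ge0.
rewrite -(ler_pM2r p) -expr2; apply: le_trans h1 _.
by rewrite ler_wpM2l.
Qed.

(** Passing to adjoints moves the contraction to the left of N^*, where it shrinks each term of the
    sum. *)
Lemma hs_compr_contr (I : choiceType) (e : I -> H) N C : orthonormal_basis e ->
  (forall x, sqn (C x) <= sqn x) -> (hs e (opM N C) <= hs e N)%E.
Proof.
move=> he hC; rewrite (hs_adj _ he he) (hs_adj N he he).
apply: le_esum => i _; rewrite lee_fin.
suff -> : opadj (opM N C) (e i) = opadj C (opadj N (e i)) by exact: opadj_contr.
by apply: inner_ext => x; rewrite !opadjEr opME.
Qed.

Lemma sqrt_op_sqn N S : positive_op N -> (forall x, N (N x) = S x) ->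
  forall x, rip x (S x) = sqn (N x).
Proof. by move=> pN hN x; rewrite /rip -hN -(pos_selfadj pN). Qed.

(** With rho = C |rho| and N the square root of |rho|, <x, rho y> = <N C^* x, N y>; the sum for N is
    the trace of |rho|. *)
Lemma trace_class_factor rho : trace_class rho -> exists A B,
  [/\ hilbert_schmidt A, hilbert_schmidt B & forall x y, inner x (rho y) = inner (A x) (B y)].
Proof.
move=> [S hS trS]; have [C [cC CS _]] := polar hS.
have [N [pN hN]] := ex_sqrt_op hS.1.
have hsN : hilbert_schmidt N.
  move=> I e he; apply: le_lt_trans (trS I e he); apply: le_esum => i _.
  by rewrite -(sqrt_op_sqn pN hN).
exists (opM N (opadj C)), N; split=> // [I e he|x y].
  apply: le_lt_trans (hsN I e he); apply: hs_compr_contr => //; exact: opadj_contr.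
by rewrite opME (pos_selfadj pN) hN opadjE CS.
Qed.

Lemma sesqui_polarization (a b : H) :
  inner a b = \sum_(k < 4) (4^-1 * 'i ^- k) * (sqn (a + 'i ^+ k *: b))%:C.
Proof.
rewrite -(@polarization _ _ id a b)// mulr_sumr.
by apply: eq_bigr => k _; rewrite inner_sqn mulrA.
Qed.

End HilbertSchmidtFactors.

Section TracePreservation.
Context {R : realType} {H : hilbertType R} (W W' : R -> H -> H).
Local Notation T := (measurableTypeR R).
Local Notation leb := (@lebesgue_measure R).
Hypotheses (hW : instrument W) (hW' : instrument W')
  (dual : forall u x, {ae leb, forall l : R, inner u (W l x) = inner (W' l u) x}).
Implicit Types (A B C Q rho : bounded_op H).

Definition gram Q := opM (opadj Q) Q.

Lemma gramE Q x y : inner x (gram Q y) = inner (Q x) (Q y).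
Proof. by rewrite opME opadjEr. Qed.

Lemma meas_gram Q x : inner x (meas_map hW (gram Q) x) = (\int[leb]_l sqn (Q (W l x)))%:C.
Proof.
rewrite meas_mapE; have e l : inner (W l x) (gram Q (W l x)) = (sqn (Q (W l x)))%:C.
  by rewrite gramE inner_sqn.
rewrite /meas_form /cintegral; apply: complex_ext => /=.
  by apply: eq_Rintegral => l _; rewrite e.
by under eq_Rintegral do rewrite e; rewrite /Rintegral integral0.
Qed.

Lemma meas_gram_pos Q : positive_op (meas_map hW (gram Q)).
Proof. by move=> x; rewrite meas_gram lecR; apply: Rintegral_ge0 => l _; exact: sqn_ge0. Qed.

Lemma meas_gram_EFin Q x :
  (rip x (meas_map hW (gram Q) x))%:E = (\int[leb]_l (sqn (Q (W l x)))%:E)%E.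
Proof.
have [_ iQ] := sq_integrable_op Q (instrument_sq hW x).
by rewrite /rip meas_gram /= /Rintegral fineK//; exact: integrable_fin_num.
Qed.

Lemma hs_meas_gram (I : choiceType) (e : I -> H) Q : orthonormal_basis e ->
  hilbert_schmidt Q ->
  \esum_(i in [set: I]) (rip (e i) (meas_map hW (gram Q) (e i)))%:E = hs e Q.
Proof.
move=> he hQ; have [mW _ _] := hW; have [mW' iW' _] := hW'.
pose u j := opadj Q (e j).
have hsu : \esum_(j in [set: I]) (sqn (u j))%:E = hs e Q by rewrite (hs_adj Q he he).
(* Q^* is Hilbert-Schmidt, so Q^* e_j is nonzero for countably many j only: this permits exchanging
   the integral with the sum over j. *)
have cu : countable [set j | sqn (u j) != 0].
  have [r hr] := ex_hs hQ.
  apply: (@esum_countable_support _ _ _ r) => [j|J]; first exact: sqn_ge0.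
  by rewrite -lee_fin -(hr _ e he) -hsu sum_fset_le_esum// => j; exact: sqn_ge0.
rewrite -hsu.
transitivity (\esum_(i in [set: I]) \esum_(j in [set: I])
    (\int[leb]_l (abs2 (inner (W' l (u j)) (e i)))%:E)%E).
  apply: eq_esum => i _; rewrite meas_gram_EFin.
  transitivity (\int[leb]_l \esum_(j in [set: I]) (abs2 (inner (u j) (W l (e i))))%:E)%E.
    apply: eq_integral => l _; rewrite -(parseval he); apply: eq_esum => j _.
    by rewrite /u opadjE.
  rewrite -(@integral_esum _ _ _ _ _ [set j | sqn (u j) != 0])//.
  - apply: eq_esum => j _; apply: ae_eq_integral => //.
    + by apply/measurable_EFinP; apply: smeas_abs2; [exact: smeas_cst|exact: mW].
    + by apply/measurable_EFinP; apply: smeas_abs2; [exact: mW'|exact: smeas_cst].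
    (* The null set depends on the pair (i, j), so duality is applied to each integral separately,
       after the exchange. *)
    + by apply: ae_impl (dual (u j) (e i)) => l + _; move=> ->.
  - by move=> j; apply/measurable_EFinP; apply: smeas_abs2; [exact: smeas_cst|exact: mW].
  - by move=> j l; rewrite lee_fin abs2_ge0.
  - move=> j l /negP; rewrite negbK => /eqP/sqn_eq0 ->.
    by rewrite inner0l /abs2 /= expr0n addr0.
rewrite esum_swap; last first.
  by move=> i j; apply: integral_ge0 => l _; rewrite lee_fin abs2_ge0.
apply: eq_esum => j _; rewrite -iW'.
(* For the sum over i the countable set comes from [smeas_countable]: the basis vectors not
   orthogonal to every W'_l u_j. *)
rewrite (@integral_esum _ _ _ _ _ [set i | exists l, inner (e i) (W' l (u j)) != 0]).
- apply: eq_integral => l _; rewrite -(parseval he); apply: eq_esum => i _.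
  by rewrite innerC abs2J.
- exact: smeas_countable he (mW' _).
- by move=> i; apply/measurable_EFinP; apply: smeas_abs2; [exact: mW'|exact: smeas_cst].
- by move=> i l; rewrite lee_fin abs2_ge0.
move=> i l h; rewrite innerC abs2J (_ : inner _ _ = 0).
  by rewrite /abs2 /= expr0n addr0.
by apply/eqP; rewrite -[_ == _]negbK; apply/negP => h'; apply: h; exists l.
Qed.

Lemma meas_map_factor rho A B : (forall x y, inner x (rho y) = inner (A x) (B y)) ->
  forall x y, inner x (meas_map hW rho y) =
    cintegral leb (fun l => inner (A (W l x)) (B (W l y))).
Proof.
move=> h x y; rewrite meas_mapE; congr cintegral; apply/funext => l; exact: h.
Qed.

Lemma meas_map_trace_class rho : trace_class rho -> trace_class (meas_map hW rho).
Proof.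
move=> /trace_class_factor[A [B [hA hB hAB]]].
have [S hS] := ex_abs (meas_map hW rho); exists S => // I e he.
have [C [cC _ hC]] := polar hS.
have [N [pN hN]] := ex_sqrt_op (meas_gram_pos A).
have le i : rip (e i) (S (e i)) <= sqn (N (C (e i))) + rip (e i) (meas_map hW (gram B) (e i)).
  rewrite -(sqrt_op_sqn pN hN) /rip -hC (meas_map_factor hAB) !meas_gram /=.
  have [_ b] := sq_integrable_inner (sq_integrable_op A (instrument_sq hW (C (e i))))
    (sq_integrable_op B (instrument_sq hW (e i))).
  have := le_trans (abs2_le_Re _) b => h'.
  have p : 0 <= \int[leb]_l sqn (A (W l (C (e i)))) + \int[leb]_l sqn (B (W l (e i))).
    by apply: addr_ge0; apply: Rintegral_ge0 => l _; exact: sqn_ge0.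
  apply: le_trans (ler_norm _) _.
  by rewrite -ler_sqr ?nnegrE// real_normK ?num_real.
apply: (@le_lt_trans _ _ (\esum_(i in [set: I]) ((sqn (N (C (e i))))%:E +
    (rip (e i) (meas_map hW (gram B) (e i)))%:E)%E)).
  by apply: le_esum => i _; rewrite -EFinD lee_fin; exact: le.
rewrite esumD; first last.
- by move=> i _; rewrite lee_fin; apply: pos_rip; exact: meas_gram_pos.
- by move=> i _; rewrite lee_fin sqn_ge0.
rewrite (hs_meas_gram he hB); apply: lte_add_pinfty; last exact: hB.
have -> : \esum_(i in [set: I]) (sqn (N (C (e i))))%:E = hs e (opM N C).
  by apply: eq_esum => i _; rewrite opME.
apply: le_lt_trans (hs_compr_contr N he cC) _.
suff -> : hs e N = hs e A by exact: hA.
rewrite -(hs_meas_gram he hA); apply: eq_esum => i _.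
by rewrite (sqrt_op_sqn pN hN).
Qed.

Lemma meas_map_trace rho : trace_class rho ->
  exists t, is_trace rho t /\ is_trace (meas_map hW rho) t.
Proof.
move=> /trace_class_factor[A [B [hA hB hAB]]].
pose Q (k : 'I_4) := opD A (opZ ('i ^+ k) B).
have hQ k : hilbert_schmidt (Q k).
  by move=> I e he; apply: hsD_le; [exact: hA|apply: hsZ_lt; exact: hB].
have QE k x : Q k x = A x + 'i ^+ k *: B x by rewrite opDE opZE.
have /choice[r hr] k := ex_hs (hQ k).
(* Polarization reduces <A x, B x> to the |Q_k x|^2 with Q_k = A + i^k B; by [hs_meas_gram], Q_k^*
   Q_k and its image under the map have the same trace [r k]. *)
exists (\sum_(k < 4) (4^-1 * 'i ^- k) * (r k)%:C); split=> I e he.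
  change (net_sum (fun i => inner (e i) (rho (e i)))
    (\sum_(k < 4) (4^-1 * 'i ^- k) * (r k)%:C)).
  have -> : (fun i => inner (e i) (rho (e i))) =
      (fun i => \sum_(k < 4) (4^-1 * 'i ^- k) * (sqn (Q k (e i)))%:C).
    apply/funext => i; rewrite hAB sesqui_polarization.
    by apply: eq_bigr => k _; rewrite QE.
  apply: net_sum_sum => k; apply: net_sumZ; apply: net_sum_esum; last exact: hr.
  by move=> i; exact: sqn_ge0.
change (net_sum (fun i => inner (e i) (meas_map hW rho (e i)))
  (\sum_(k < 4) (4^-1 * 'i ^- k) * (r k)%:C)).
have -> : (fun i => inner (e i) (meas_map hW rho (e i))) =
    (fun i => \sum_(k < 4) (4^-1 * 'i ^- k) *
      (rip (e i) (meas_map hW (gram (Q k)) (e i)))%:C).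
  apply/funext => i; rewrite (meas_map_factor hAB).
  have ig k : cintegrable leb (fun l => inner (W l (e i)) (gram (Q k) (W l (e i)))).
    exact: meas_form_integrable.
  have [_] := cintegral_sum (index_enum 'I_4)
    (fun k => cintegrableZ (4^-1 * 'i ^- k) (ig k)).
  under [in X in _ -> _ = X]eq_bigr do
    rewrite -(pos_Re _ (@meas_gram_pos _)) meas_mapE /meas_form -cintegralZ//.
  move=> <-; congr cintegral; apply/funext => l.
  by rewrite sesqui_polarization; apply: eq_bigr => k _; rewrite gramE inner_sqn QE.
apply: net_sum_sum => k; apply: net_sumZ; apply: net_sum_esum.
  by move=> i; apply: pos_rip; exact: meas_gram_pos.
by rewrite hs_meas_gram// hr.
Qed.

End TracePreservation.

(** * The detector as an instrument *)

Section DetectorInstrument.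
Context {R : realType} {H : hilbertType R} (P : pvm H) (f : R -> R[i]).
Hypotheses (cr : continuous (fun k => Re (f k))) (ci : continuous (fun k => Im (f k)))
  (f1 : (\int[lebesgue_measure]_l (abs2 (f l))%:E = 1)%E).

Lemma shiftop_instrument : instrument (shiftop P f).
Proof.
split=> [y|y|a x y].
- exact: shiftop_smeas.
- exact: integral_shiftop.
- exact: shiftop_lin.
Qed.

Lemma continuous_conjc_Re : continuous (fun k => Re (conjc (f k))).
Proof. by under eq_fun do rewrite ReJ. Qed.

Lemma continuous_conjc_Im : continuous (fun k => Im (conjc (f k))).
Proof. by under eq_fun do rewrite ImJ; move=> k; apply: cvgN; exact: ci. Qed.

Lemma integral_abs2_conjc : (\int[lebesgue_measure]_l (abs2 (conjc (f l)))%:E = 1)%E.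
Proof. by under eq_integral do rewrite abs2J. Qed.

Lemma shiftop_dual u x : {ae lebesgue_measure, forall l : R,
  inner u (shiftop P (fun k => conjc (f k)) l x) = inner (shiftop P f l u) x}.
Proof.
apply: (ae_impl2 _ (ae_dom P cr ci f1 x) (ae_dom P cr ci f1 u)) => l dx du.
rewrite /shiftop wop_dual ?calculus_domainJ//; last by apply: lbmJ; exact: shift_lbm.
by congr (inner (wop P _ u) x); apply/funext => k; rewrite conjcK.
Qed.

End DetectorInstrument.

Theorem mainTheorem1 (R : realType) (H : hilbertType R)
    (A : set (H * H)) (hA : self_adjoint A)
    (P : pvm H) (hP : A = functional_calculus P (fun l => l%:C))
    (f : R -> R[i]) (sigma : R) (hf : smooth f)
    (hf0 : (\int[lebesgue_measure]_l (abs2 (f l))%:E = 1)%E)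
    (hf1 : (\int[lebesgue_measure]_l (l * abs2 (f l))%:E = 0)%E)
    (hf2 : (\int[lebesgue_measure]_l (l ^+ 2 * abs2 (f l))%:E
            = (sigma ^+ 2)%:E)%E) :
  exists Phi : bounded_op H -> bounded_op H,
    [/\ is_measurement_map P f Phi,
        completely_positive Phi &
        forall rho : bounded_op H, trace_class rho ->
          trace_class (Phi rho) /\
          exists t, is_trace rho t /\ is_trace (Phi rho) t].
Proof.
have [cr ci] := smooth_continuous hf.
(* [hW'] belongs to f(l - A), while [hW], for the conjugate of [f], belongs to f(l - A)^* and
   defines Phi. *)
have hW' : instrument (shiftop P f) := shiftop_instrument P cr ci hf0.
have hW := shiftop_instrument P (continuous_conjc_Re cr) (continuous_conjc_Im ci)
  (integral_abs2_conjc hf0).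
exists (meas_map hW); split.
- split=> [y|rho x y /=].
    apply: ae_impl (ae_dom P cr ci hf0 y) => l; exact: op_domain_detector.
  under eq_fun do rewrite !op_value_detector//.
  by split; [exact: meas_form_integrable|exact: meas_mapE].
- exact: meas_map_cp.
move=> rho hrho; split.
  exact: (meas_map_trace_class hW hW' (shiftop_dual P cr ci hf0)).
exact: (meas_map_trace hW hW' (shiftop_dual P cr ci hf0)).
Qed.
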